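(* Let $V\in\mathcal K$ and let $S(t)(x,y)=\chi_{t\ge0}\frac1{4\pi t}V(x)\,\delta_t(|x-y|)$. If $V$ satisfies the distal Kato condition $$\lim_{R\to\infty}\sup_{y\in\mathbb R^3}\int_{|x-y|>R}\frac{|V(x)|\,dx}{|x-y|}=0,$$ then $S$ decays at infinity: $$\lim_{R\to\infty}\|\chi_{\rho\ge R}S(\rho)\|_{L^\infty_y\mathcal M_xL^1_\rho}=0.$$ If $V\in\mathcal K_0$, then $S^N$ is continuous under translation when $N=2$: $$\lim_{\epsilon\to0}\|S^2(\rho+\epsilon)-S^2(\rho)\|_{L^\infty_y\mathcal M_xL^1_\rho}=0.$$
   Context: The global Kato class $\mathcal K$ consists of the (possibly singular) measures $V$ on $\mathbb R^3$ of locally bounded variation with $\|V\|_{\mathcal K}=\sup_{y\in\mathbb R^3}\int_{\mathbb R^3}\frac{d|V|(x)}{|x-y|}<\infty$ (one writes $|V(x)|\,dx$ for $d|V|(x)$); $\mathcal K_0$ is the closure of $C_c^\infty(\mathbb R^3)$ in $\mathcal K$. For each $y$, $S(\rho)(x,y)$ is regarded as a measure in $(x,\rho)\in\mathbb R^3\times\mathbb R$, namely the image of the measure $\frac{V(x)\,dx}{4\pi|x-y|}$ under $x\mapsto(x,|x-y|)$. The norm $\|F\|_{L^\infty_y\mathcal M_xL^1_\rho}$ of such a family is the supremum over $y\in\mathbb R^3$ of the total variation in $(x,\rho)$ of $F(\rho)(x,y)$. Powers denote repeated convolution in $\rho$ combined with composition of kernels: $S^2(\rho)(x,y)=\int_{\mathbb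 R}\int_{\mathbb R^3}S(\rho-\sigma)(x,z)S(\sigma)(z,y)\,dz\,d\sigma$, i.e. for every $y$, $S^2(\rho)(x,y)$ is the measure in $(x,\rho)$ given by $\int_{\mathbb R^3}\frac{V(x)V(z)}{16\pi^2|x-z||z-y|}\,\delta\big(\rho-|x-z|-|z-y|\big)\,dz$. *)

(* Defs.v *)
From mathcomp Require Import all_boot all_order all_algebra.
From mathcomp Require Import all_classical all_reals all_analysis.
From mathcomp Require Import complex.

Set Implicit Arguments.
Unset Strict Implicit.
Unset Printing Implicit Defensive.
Import Order.TTheory GRing.Theory Num.Theory numFieldNormedType.Exports.

Local Open Scope classical_set_scope.
Local Open Scope ring_scope.

(* The product carries the product topology and the product (= Borel)
   sigma-algebra. Its library norm is the sup norm, so the Euclidean norm is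
   defined separately. *)
Notation R3 R := (R * R * R)%type (only parsing).

Definition enorm (R : realType) (x : R3 R) : R :=
  Num.sqrt (x.1.1 ^+ 2 + x.1.2 ^+ 2 + x.2 ^+ 2).

Definition ecball (R : realType) (r : R) : set (R3 R) :=
  [set x | enorm x <= r].

(* Complex measures are complex-valued set functions, whose values matter only
   on a family [B] of sets: all the measurable sets for a finite measure, the
   bounded measurable sets for a measure on R^3 which is finite only locally
   (such a measure need not have a value on unbounded sets). *)

Definition bounded_measurable (R : realType) : set (set (R3 R)) :=
  [set A | measurable A /\ exists r, A `<=` ecball r].

(* |nu|(A): supremum of sum_i |nu(A_i)| over the finite families of pairwise
   disjoint subsets of A that belong to B. *)
Definition measure_variation (R : realType) (X : Type) (B : set (set X))
    (nu : set X -> R[i]) (A : set X) : \bar R :=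
  ereal_sup [set e | exists n (F : 'I_n -> set X),
    [/\ forall i, B (F i), forall i, F i `<=` A, trivIset setT F
      & e = (\sum_(i < n) ComplexField.Normc.normc (nu (F i)))%:E]].

(* The positive part nu^+ in the Jordan decomposition of a signed measure; the
   negative part is the positive part of - nu. *)
Definition pos_part (R : realType) (X : Type) (B : set (set X))
    (nu : set X -> R) (A : set X) : \bar R :=
  ereal_sup [set (nu E)%:E | E in [set E | B E /\ E `<=` A]].

Definition signed_integral d (X : measurableType d) (R : realType)
    (B : set (set X)) (nu : set X -> R) (D : set X) (f : X -> R) : R :=
  fine (\int[pos_part B nu]_(x in D) (f x)%:E)%E
  - fine (\int[pos_part B (fun A => - nu A)%R]_(x in D) (f x)%:E)%E.

Definition complex_integral d (X : measurableType d) (R : realType)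
    (B : set (set X)) (nu : set X -> R[i]) (D : set X) (f : X -> R[i]) : R[i] :=
  let nu1 A := complex.Re (nu A) in let nu2 A := complex.Im (nu A) in
  let f1 x := complex.Re (f x) in let f2 x := complex.Im (f x) in
  ((signed_integral B nu1 D f1 - signed_integral B nu2 D f2)
   +i* (signed_integral B nu1 D f2 + signed_integral B nu2 D f1))%C.

(* V restricts to a finite complex measure on every ball. The variation of V on
   a ball is then finite, as for every complex measure. *)
Definition locally_bounded_variation (R : realType) (V : set (R3 R) -> R[i]) :=
  forall r : R, exists nu1 nu2 : {charge set (R3 R) -> \bar R},
    forall A, measurable A ->
      V (A `&` ecball r) = (fine (nu1 A) +i* fine (nu2 A))%C.

(* The integrand is +oo at x = y ([inve 0 = +oo]): a measure with an atom has
   infinite norm. *)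
Definition kato_norm (R : realType) (V : set (R3 R) -> R[i]) : \bar R :=
  ereal_sup (range (fun y : R3 R =>
    \int[measure_variation (@bounded_measurable R) V]_x
      ((enorm (x - y)%R)%:E)^-1)%E).

Definition kato (R : realType) (V : set (R3 R) -> R[i]) :=
  locally_bounded_variation V /\ (kato_norm V < +oo)%E.

Definition iter_derive (R : realType) (s : seq (R3 R)) (f : R3 R -> R) :
    R3 R -> R :=
  foldr (fun v g x => 'D_v g x) f s.

(* C^oo: all iterated directional derivatives exist and are continuous. *)
Definition smooth (R : realType) (f : R3 R -> R) :=
  forall s : seq (R3 R), continuous (iter_derive s f) /\
    forall x v, derivable (iter_derive s f) x v.

Definition test_function (R : realType) (phi : R3 R -> R[i]) :=
  [/\ smooth (fun x => complex.Re (phi x)),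
      smooth (fun x => complex.Im (phi x))
    & exists r, forall x, ~ ecball r x -> phi x = 0].

Definition density (R : realType) (phi : R3 R -> R[i]) (A : set (R3 R)) :
    R[i] :=
  let leb3 := ((@lebesgue_measure R \x @lebesgue_measure R)
               \x @lebesgue_measure R)%E in
  (fine (\int[leb3]_(x in A) (complex.Re (phi x))%:E)%E
   +i* fine (\int[leb3]_(x in A) (complex.Im (phi x))%:E)%E)%C.

Definition kato0 (R : realType) (V : set (R3 R) -> R[i]) :=
  kato V /\ forall e : R, 0 < e -> exists phi, test_function phi /\
    (kato_norm (fun A => (V A - density phi A)%R) < e%:E)%E.

Definition distal_kato (R : realType) (V : set (R3 R) -> R[i]) :=
  ereal_sup (range (fun y : R3 R =>
    \int[measure_variation (@bounded_measurable R) V]_(x in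
      [set x | (r < enorm (x - y))%R])
      ((enorm (x - y)%R)%:E)^-1)%E) @[r --> +oo] --> 0%E.

(* F y A is the mass of A, a set of pairs (x, rho), for the measure
   F(rho)(x, y). *)
Definition kernel3 (R : realType) := R3 R -> set (R3 R * R) -> R[i].

(* The supremum over y of the total variation in (x, rho). *)
Definition kernel_norm (R : realType) (F : kernel3 R) : \bar R :=
  ereal_sup (range (fun y => measure_variation measurable (F y) setT)).

(* F(rho - sigma)(x, z) G(sigma)(z, y), integrated in (z, sigma): the pair
   p = (z, sigma) is distributed according to G y, and F z is shifted by
   sigma. *)
Definition kernel_comp (R : realType) (F G : kernel3 R) : kernel3 R :=
  fun y A => complex_integral measurable (G y) setT
    (fun p => F p.1 ((fun q : R3 R * R => (q.1, q.2 + p.2)) @^-1` A)).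

(* F^N, for N >= 1. *)
Definition kernel_pow (R : realType) (F : kernel3 R) (N : nat) : kernel3 R :=
  iter N.-1 (kernel_comp F) F.

(* F(rho + e) *)
Definition kernel_shift (R : realType) (e : R) (F : kernel3 R) : kernel3 R :=
  fun y A => F y [set (p.1, p.2 + e) | p in A].

(* chi_{rho >= r} F(rho) *)
Definition kernel_restrict (R : realType) (r : R) (F : kernel3 R) : kernel3 R :=
  fun y A => F y (A `&` [set p | r <= p.2]).

(* For V in the Kato class the point y is |V|-negligible, so that the value of
   the density at x = y does not matter. *)
Definition S_kernel (R : realType) (V : set (R3 R) -> R[i]) : kernel3 R :=
  fun y A => complex_integral (@bounded_measurable R) V
    [set x | A (x, enorm (x - y))]
    (fun x => ((4 * pi * enorm (x - y))^-1)%:C%C).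

(* Main.v *)
Require Import Defs.
From HB Require Import structures.
From mathcomp Require Import all_boot all_order all_algebra.
From mathcomp Require Import all_classical all_reals all_analysis measurable_realfun.
From mathcomp Require Import complex.
From mathcomp Require Import ring lra.

(* The Jordan decomposition writes V, through its real and imaginary parts, as a
   combination of four positive measures m_k with bounded Newton potentials, so
   that S and S^2 are combinations of positive kernels: for S^2 these give a set A
   the masses [dpot m_k m_l y A]. The mass of S beyond distance r from y is at
   most the Newton potential of |V| outside a ball of radius r - 1, which is the
   first claim.

   For the second claim, approximating V in the Kato norm by a test function
   writes m_k = a_k + b_k, where a_k has a continuous compactly supported density
   and b_k a small potential; so it is enough to treat the a_k, and to bound the
   mass of A moved by e from above by the mass of A plus a small error, uniformly
   in A and y (the lower bound follows by taking complements). On a line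
   z = (z', t) the distance rho(t) = |x - z| + |z - y| is strictly convex in t,
   uniformly if z' stays away from x and y. On each side of its minimum, rho
   decreases by e when t moves to some F(t); the slope of a convex function
   increases, so F expands lengths. Hence {rho - e in A} is at most O(sqrt e)
   longer than {rho in A}, for an arbitrary A. On short intervals the densities
   are almost constant, and the points z close to x or y contribute little. *)

Set Implicit Arguments.
Unset Strict Implicit.
Unset Printing Implicit Defensive.
Import Order.TTheory GRing.Theory Num.Theory numFieldNormedType.Exports.

Local Open Scope classical_set_scope.
Local Open Scope ring_scope.

(** * Integrals and positive parts of set functions *)

(** A single factor [S] would not do: for each y it is carried by the graph [rho = |x - y|], which a
    translation moves off itself. In [S^2] the integration over z spreads rho.

    The lines are parallel to the third axis and the separation of the points is measured by their
    first coordinates alone. This condition does not change along a line, and what it excludes are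
    slabs, whose Newton potential is uniformly small.

    The integrals that define S and S^2 are taken with Jordan decompositions, whereas the
    approximation of V yields other decompositions, whose two parts may overlap. Hence any
    representation as a difference of positive measures is first shown to give the same integrals.

    The constants are chosen in this order: the accuracy of the approximation in the Kato norm, the
    width of the slabs, the length of the cells on which the densities are almost constant, and last
    e, because every cell costs O(sqrt e). The bounds on the potentials of the a_k must therefore
    not depend on the test function. *)

Section integral_set_function.
Local Open Scope ereal_scope.
Context d (T : measurableType d) (R : realType).
Variables mu nu : set T -> \bar R.
Hypotheses (mu0 : mu set0 = 0) (nu0 : nu set0 = 0).
Hypothesis mu_nu : forall A, measurable A -> 0 <= mu A <= nu A.

Import HBNNSimple.

Let sintegral_range (m : set T -> \bar R) (h : T -> R) : m set0 = 0 ->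
  sintegral m h = \sum_(x \in range h) x%:E * m (h @^-1` [set x]).
Proof.
move=> m0; rewrite (fsbig_widen (range h) setT)//= => x [_ Nhx] /=.
by rewrite preimage10// m0 mule0.
Qed.

(** The negative part contributes 0 although [m] is just a set function: a nonnegative simple
    function below 0 vanishes, and [m set0 = 0] removes from [sintegral] the values that are not
    attained. *)
Let nonneg_integral (m : set T -> \bar R) (D : set T) (f : T -> \bar R) :
  m set0 = 0 -> (forall x, D x -> 0 <= f x) -> integral m D f =
  ereal_sup [set sintegral m h |
    h in [set h : {nnsfun T >-> R} | forall x, (h x)%:E <= (f \_ D) x]].
Proof.
move=> m0 f0; rewrite /integral funeneg_restrict funepos_restrict.
have /eq_restrictP-> := ge0_funeposE f0.
have /eq_restrictP-> := ge0_funenegE f0.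
rewrite erestrict0 (_ : ereal_sup [set sintegral m h |
  h in [set h : {nnsfun T >-> R} | forall x, (h x)%:E <= cst 0 x]] = 0).
  by rewrite sube0.
have E (h : {nnsfun T >-> R}) : (forall x, (h x)%:E <= cst 0 x) ->
    sintegral m h = 0.
  move=> h0; rewrite sintegral_range// fsbig1// => _ [x _ <-].
  suff -> : h x = 0%R by rewrite mul0e.
  by apply/eqP; rewrite eq_le -lee_fin h0/=.
apply/eqP; rewrite eq_le; apply/andP; split.
  by apply: ge_ereal_sup => _ [h h0 <-]; rewrite E.
by apply: ereal_sup_ubound; exists nnsfun0 => //; rewrite E.
Qed.

(* mu and nu need not be measures: this is how the integrals of the Kato norm,
   taken against the set function measure_variation, are bounded from below. *)
Lemma le_integral_set_function (D E : set T) (f g : T -> \bar R) :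
  (forall x, D x -> 0 <= f x) -> (forall x, E x -> 0 <= g x) ->
  (forall x, D x -> E x /\ f x <= g x) ->
  \int[mu]_(x in D) f x <= \int[nu]_(x in E) g x.
Proof.
move=> f0 g0 fg; rewrite !nonneg_integral//.
apply: ge_ereal_sup => _ [h hf <-].
apply: (@le_trans _ _ (sintegral nu h)); last first.
  apply: ereal_sup_ubound; exists h => // x; apply: (le_trans (hf x)).
  rewrite /patch; case: ifPn => [|_].
    by rewrite inE => /fg[Ex ?]; rewrite mem_set.
  by case: ifPn => //; rewrite inE; apply: g0.
rewrite !sintegral_range// lee_fsum// => _ [x _ <-].
have /mu_nu/andP[m1 m2] : measurable (h @^-1` [set h x]) by [].
by rewrite lee_pmul// lee_fin.
Qed.

End integral_set_function.

(** * Measures with a density *)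

Section density.
Local Open Scope ereal_scope.
Context d (T : measurableType d) (R : realType).
Variables (m : {measure set T -> \bar R}) (w : T -> R).
Hypotheses (w0 : forall x, (0 <= w x)%R) (mw : measurable_fun setT w).

Definition dens (A : set T) : \bar R := \int[m]_(x in A) (w x)%:E.

Let dens0 : dens set0 = 0. Proof. exact: integral_set0. Qed.

Let dens_ge0 A : 0 <= dens A.
Proof. by apply: integral_ge0 => x _; rewrite lee_fin. Qed.

Let dens_sigma_additive : semi_sigma_additive dens.
Proof. by apply: semi_sigma_additive_nng_induced; [exact/measurable_EFinP|]. Qed.

Definition density_measure : {measure set T -> \bar R} :=
  HB.pack dens (isMeasure.Build _ _ _ dens dens0 dens_ge0 dens_sigma_additive).

Import HBNNSimple.

Lemma integral_density (D : set T) (f : T -> \bar R) :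
  measurable D -> measurable_fun setT f -> (forall x, 0 <= f x) ->
  \int[density_measure]_(x in D) f x = \int[m]_(x in D) (f x * (w x)%:E).
Proof.
move=> mD mf f0.
have mfD : measurable_fun D f by exact: measurable_funTS.
have mwD : measurable_fun D w by exact: measurable_funTS.
pose f_ := nnsfun_approx mD mfD.
have f_cvg x : D x -> (f_ n x)%:E @[n --> \oo] --> f x.
  by move=> Dx; apply: cvg_nnsfun_approx.
transitivity (limn (fun n => \int[density_measure]_(x in D) (f_ n x)%:E)).
  rewrite -monotone_convergence//.
  - by apply: eq_integral => y /[!inE] yD; apply/esym/cvg_lim => //; exact: f_cvg.
  - by move=> n; exact/measurable_EFinP/measurable_funTS.
  - by move=> n y _; rewrite lee_fin.
  - by move=> y _ a b ab; rewrite lee_fin; exact/lefP/nd_nnsfun_approx.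
transitivity (limn (fun n => \int[m]_(x in D) ((f_ n x)%:E * (w x)%:E))); last first.
  rewrite -monotone_convergence//; last 3 first.
  - by move=> n; apply/measurable_EFinP/measurable_funM => //; exact: measurable_funTS.
  - by move=> n x _; rewrite mule_ge0// lee_fin.
  - move=> x _ a b ab; rewrite lee_wpmul2r ?lee_fin//.
    exact/lefP/nd_nnsfun_approx.
  apply: eq_integral => x /[!inE] Dx; apply/cvg_lim => //.
  by apply: cvgeZr => //; exact: f_cvg.
congr (limn _); apply/funext => n.
have mk k : measurable (f_ n @^-1` [set k]) by [].
under eq_integral do rewrite fimfunE -fsumEFin//.
rewrite ge0_integral_fsum//; last 2 first.
  - by move=> y; apply/measurable_EFinP/measurable_funTS/measurable_funM.
  - by move=> y x _; rewrite EFinM nnfun_muleindic_ge0.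
transitivity (\sum_(k \in range (f_ n))
    \int[m]_(x in D) (k%:E * (\1_(f_ n @^-1` [set k]) x * w x)%:E)).
  apply: eq_fsbigr => k /[!inE] -[y _ <-].
  rewrite (integralZl_indic _ (fun=> f_ n @^-1` [set f_ n y]))//.
  rewrite integral_indic// ge0_integralZl_EFin//.
  - rewrite /= /dens setIC; congr (_ * _).
    rewrite integral_mkcondr; apply: eq_integral => x _.
    by rewrite /patch indicE; case: ifPn => _; rewrite ?mul1r ?mul0r.
  - by move=> x _; rewrite lee_fin mulr_ge0.
  - by apply/measurable_EFinP/measurable_funM.
  - by move=> ?; rewrite preimage_nnfun0.
rewrite -ge0_integral_fsum//; last 2 first.
  - move=> k; apply/measurable_EFinP/measurable_funTS/measurable_funM => //.
    exact: measurable_funM.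
  - by move=> k x _; rewrite EFinM muleA mule_ge0 ?nnfun_muleindic_ge0// lee_fin.
apply: eq_integral => x _.
rewrite [in RHS](fimfunE (f_ n)) -fsumEFin// ge0_mule_fsuml.
  by apply: eq_fsbigr => k _; rewrite EFinM muleA -EFinM.
by move=> k; rewrite EFinM nnfun_muleindic_ge0.
Qed.
End density.

Section signed_set_function.
Context d (X : measurableType d) (R : realType).
Implicit Types (B : set (set X)) (nu : set X -> R).

(** Covers both families of sets in use, all measurable sets and the bounded ones. In the second
    case a set function has no meaningful value on unbounded sets; the exhaustion carries identities
    between measures from B to all measurable sets. *)
Record set_base B : Prop := SetBase {
  base_measurable : B `<=` measurable;
  base_setI : forall E A, B E -> measurable A -> B (E `&` A);
  base_setU : forall E F, B E -> B F -> B (E `|` F);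
  base_exhaustion : exists G : (set X)^nat,
    [/\ forall n, B (G n), nondecreasing_seq G & \bigcup_n G n = setT] }.

Definition base_additive B nu :=
  forall E (F : (set X)^nat), B E -> (forall i, measurable (F i)) ->
    trivIset setT F -> E = \bigcup_i F i ->
    (\sum_(0 <= i < n) nu (F i)) @[n --> \oo] --> nu E.

Lemma base0 B : set_base B -> B set0.
Proof.
move=> bB; have [G [BG _ _]] := base_exhaustion bB.
by rewrite -(setI0 (G 0%N)); exact: base_setI.
Qed.

(** The terms of a convergent series tend to 0, and here every term is [nu set0]. *)
Lemma base_additive0 B nu : set_base B -> base_additive B nu -> nu set0 = 0.
Proof.
move=> bB anu.
have /= c1 := anu set0 (fun=> set0) (base0 bB) (fun=> measurable0)
  (@trivIset_set0 _ _ _) (esym (bigcup0 (fun _ _ => erefl))).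
have c2 : (\sum_(0 <= i < n.+1) nu set0) @[n --> \oo] --> nu set0.
  by move: c1; rewrite -cvg_shiftS.
have : (nu set0 @[_ --> \oo] --> nu set0 - nu set0).
  rewrite [X in X @ _ --> _](_ : _ = fun n : nat =>
      \sum_(0 <= i < n.+1) nu set0 - \sum_(0 <= i < n) nu set0).
    exact: cvgB.
  by apply/funext => n; rewrite big_nat_recr//= addrAC subrr add0r.
by rewrite subrr => /(cvg_lim (@Rhausdorff _)) <-; rewrite lim_cst.
Qed.

Lemma base_additiveN B nu : base_additive B nu -> base_additive B (fun A => - nu A).
Proof.
move=> anu E F BE mF tF EF; under eq_fun do rewrite sumrN.
by apply: cvgN; exact: anu.
Qed.

Lemma base_additiveU B nu : set_base B -> base_additive B nu ->
  forall E F, B E -> B F -> E `&` F = set0 -> nu (E `|` F) = nu E + nu F.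
Proof.
move=> bB anu E F BE BF EF0.
have nu0 := base_additive0 bB anu.
have mE := base_measurable bB BE.
have mF := base_measurable bB BF.
have := anu (E `|` F) (bigcup2 E F) (base_setU bB BE BF).
have -> : E `|` F = \bigcup_i bigcup2 E F i by rewrite bigcup2E.
move=> h.
have mEF i : measurable (bigcup2 E F i).
  by case: i => [|[|i]] /=; [exact: mE|exact: mF|exact: measurable0].
have tEF : trivIset setT (bigcup2 E F) by rewrite -trivIset_bigcup2.
rewrite -(cvg_lim (@Rhausdorff _) (h mEF tEF erefl)).
apply: (cvg_lim (@Rhausdorff _)); apply: cvg_near_cst; exists 2%N => // n /= n2.
rewrite (big_cat_nat _ n2)//= [X in _ + X]big_nat_cond.
rewrite [X in _ + X]big1 ?addr0; last by move=> [|[|i]].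
by rewrite !big_nat_recr//= big_geq// add0r.
Qed.

Section pos_part_measure.
Local Open Scope ereal_scope.
Variables (B : set (set X)) (nu : set X -> R).
Hypotheses (bB : set_base B) (anu : base_additive B nu).

Let nu0 := base_additive0 bB anu.

Lemma le_pos_part A A' : A `<=` A' -> pos_part B nu A <= pos_part B nu A'.
Proof.
move=> AA'; apply: ereal_sup_le => _ [E [BE EA] <-]; exists E => //.
by split => //; exact: subset_trans AA'.
Qed.

Lemma pos_part_ub E A : B E -> E `<=` A -> (nu E)%:E <= pos_part B nu A.
Proof. by move=> BE EA; apply: ereal_sup_ubound; exists E. Qed.

Lemma pos_part_ge0 A : 0 <= pos_part B nu A.
Proof. by have := pos_part_ub (base0 bB) (sub0set A); rewrite nu0. Qed.

Lemma pos_part0 : pos_part B nu set0 = 0.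
Proof.
apply/eqP; rewrite eq_le pos_part_ge0 andbT.
by apply: ge_ereal_sup => _ [E [_ +] <-]; rewrite subset0 => ->; rewrite nu0.
Qed.

Lemma pos_part_superadditive A A' : A `&` A' = set0 ->
  pos_part B nu A + pos_part B nu A' <= pos_part B nu (A `|` A').
Proof.
move=> AA0; have [->|cy] := eqVneq (pos_part B nu (A `|` A')) +oo.
  exact: leey.
have cf : pos_part B nu (A `|` A') \is a fin_num.
  by rewrite ge0_fin_numE ?pos_part_ge0// ltey.
have fA' : pos_part B nu A' \is a fin_num.
  rewrite ge0_fin_numE ?pos_part_ge0//; apply: le_lt_trans.
    by apply: (@le_pos_part _ (A `|` A')); right.
  by rewrite ltey.
rewrite -leeBrDr//; apply: ge_ereal_sup => _ [E [BE EA] <-].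
rewrite leeBrDr// addeC -leeBrDr//; apply: ge_ereal_sup => _ [F [BF FA] <-].
rewrite leeBrDr// -EFinD addrC -(base_additiveU bB anu)//.
  apply: pos_part_ub; first exact: base_setU.
  exact: setUSS.
by rewrite -subset0 -AA0; exact: setISS.
Qed.

(** No Hahn set enters. A competitor E splits along the [F i], which bounds the supremum from above;
    competitors in finitely many disjoint sets can be united, which bounds it from below. *)
Let pos_part_sigma_additive : semi_sigma_additive (pos_part B nu).
Proof.
move=> F mF tF mU.
have cF : cvgn (fun n => \sum_(0 <= i < n) pos_part B nu (F i)).
  by apply: is_cvg_ereal_nneg_natsum => n _; exact: pos_part_ge0.
suff -> : pos_part B nu (\bigcup_n F n) =
    limn (fun n => \sum_(0 <= i < n) pos_part B nu (F i)) by exact: cF.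
apply/eqP; rewrite eq_le; apply/andP; split.
  apply: ge_ereal_sup => _ [E [BE EF] <-].
  have mE := base_measurable bB BE.
  have tEF : trivIset setT (fun i => E `&` F i) by exact: trivIset_setIl.
  have hc : (\sum_(0 <= i < n) (nu (E `&` F i))%:E @[n --> \oo] --> (nu E)%:E).
    under eq_fun do rewrite sumEFin.
    apply: cvg_EFin; first exact: nearW.
    apply: (anu BE _ tEF); first by move=> i; exact: measurableI.
    by rewrite -setI_bigcupr (setIidl EF).
  rewrite -(cvg_lim _ hc)//; apply: lee_lim => //.
    by apply/cvg_ex; exists (nu E)%:E.
  apply: nearW => n; apply: lee_sum => i _; apply: pos_part_ub => //.
  exact: base_setI.
apply: lime_le => //; apply: nearW => n.
apply: (@le_trans _ _ (pos_part B nu (\big[setU/set0]_(0 <= i < n) F i))).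
  elim: n => [|n ih]; first by rewrite !big_geq// pos_part0.
  rewrite !big_nat_recr//=; apply: (le_trans (leeD2r _ ih)); apply: pos_part_superadditive.
  rewrite setIC big_mkord -bigcup_mkord setI_bigcupr bigcup0// => i /= ni.
  by move/trivIsetP : tF; apply => //; rewrite gt_eqF.
by apply: le_pos_part; rewrite big_mkord; exact: bigsetU_bigcup.
Qed.

Definition pos_part_measure : {measure set X -> \bar R} :=
  HB.pack (pos_part B nu) (isMeasure.Build _ _ _ (pos_part B nu)
    pos_part0 pos_part_ge0 pos_part_sigma_additive).

End pos_part_measure.

(** The pair need not be the Jordan decomposition: this allows the positive parts of a test function
    and of a remainder to be added. *)
Definition represents B nu (a b : set X -> \bar R) := forall E, B E ->
  [/\ (a E < +oo)%E, (b E < +oo)%E & nu E = fine (a E) - fine (b E)].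

Section representation.
Local Open Scope ereal_scope.
Variables (B : set (set X)) (nu : set X -> R).
Variables (a b : {measure set X -> \bar R}).
Hypotheses (bB : set_base B) (rab : represents B nu a b).

Let fin (m : {measure set X -> \bar R}) A : m A < +oo -> m A \is a fin_num.
Proof. by move=> ?; rewrite ge0_fin_numE. Qed.

Lemma represents_additive : base_additive B nu.
Proof.
move=> E F BE mF tF EF; have [aE bE ->] := rab BE.
have BF i : B (F i).
  have <- : E `&` F i = F i by apply/setIidr; rewrite EF; exact: bigcup_sup.
  exact: base_setI.
have mE := base_measurable bB BE.
have FE i : F i `<=` E by rewrite EF; exact: bigcup_sup.
have cf (m : {measure set X -> \bar R}) : m E < +oo ->
    ((\sum_(0 <= i < n) fine (m (F i)))%R @[n --> \oo] --> fine (m E)).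
  move=> mEy; have mFf i : m (F i) \is a fin_num.
    by apply: fin; apply: le_lt_trans mEy; rewrite le_measure ?inE.
  under eq_fun do rewrite sum_fine//.
  apply: fine_cvg; rewrite fineK; last exact: fin.
  rewrite EF; apply: measure_semi_sigma_additive => //.
  by rewrite -EF.
have -> : (fun n => \sum_(0 <= i < n) nu (F i))%R = (fun n =>
    \sum_(0 <= i < n) fine (a (F i)) - \sum_(0 <= i < n) fine (b (F i)))%R.
  apply/funext => n; rewrite -sumrB; apply: eq_bigr => i _.
  by have [_ _ ->] := rab (BF i).
by apply: cvgB; exact: cf.
Qed.

(** Minimality of the Jordan decomposition: a competitor E in A satisfies [nu E <= a E <= a A]. *)
Lemma pos_part_le_represents A : measurable A -> pos_part B nu A <= a A.
Proof.
move=> mA; apply: ge_ereal_sup => _ [E [BE EA] <-].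
have [aE bE ->] := rab BE.
apply: (@le_trans _ _ (a E)); last first.
  by rewrite le_measure// inE//; exact: base_measurable BE.
rewrite -[leRHS]fineK; last exact: fin.
by rewrite lee_fin gerBl// fine_ge0.
Qed.

End representation.

Lemma representsN B nu a b : represents B nu a b ->
  represents B (fun A => - nu A) b a.
Proof.
by move=> rab E BE; have [? ? ->] := rab E BE; split; rewrite // opprB.
Qed.

Section jordan.
Local Open Scope ereal_scope.
Variables (B : set (set X)) (nu : set X -> R).
Hypotheses (bB : set_base B) (anu : base_additive B nu).
Let nneg A := (- nu A)%R.

(** The map from F to the complement of F in E exchanges the competitors of the two suprema. The
    difference is written as a sum because both sides may be infinite. *)
Lemma pos_partB E : B E -> pos_part B nu E = (nu E)%:E + pos_part B nneg E.
Proof.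
move=> BE; have nuD F : B F -> F `<=` E -> nu E = (nu F + nu (E `\` F))%R.
  move=> BF FE; rewrite -(base_additiveU bB anu)//.
  - by rewrite setDUK.
  - by rewrite setDE; apply: base_setI => //; apply/measurableC/(base_measurable bB).
  - by rewrite setDE setICA setICr setI0.
have BD F : B F -> B (E `\` F).
  by move=> BF; rewrite setDE; apply: base_setI => //; apply/measurableC/(base_measurable bB).
apply/eqP; rewrite eq_le; apply/andP; split.
  apply: ge_ereal_sup => _ [F [BF FE] <-].
  rewrite -leeBlDl// -EFinB; apply: ereal_sup_ubound; exists (E `\` F).
    by split; [exact: BD|exact: subDsetl].
  by rewrite /nneg (nuD F)//; congr EFin; ring.
rewrite -leeBrDl//; apply: ge_ereal_sup => _ [F [BF FE] <-].
rewrite leeBrDr// -EFinD; apply: ereal_sup_ubound; exists (E `\` F).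
  by split; [exact: BD|exact: subDsetl].
by rewrite /nneg (nuD F)//; congr EFin; ring.
Qed.

(** Finiteness passes from the positive to the negative part by [pos_partB]. *)
Lemma jordan_represents : (forall E, B E -> pos_part B nu E < +oo) ->
  represents B nu (pos_part B nu) (pos_part B nneg).
Proof.
move=> fp E BE; have pE := fp E BE.
have n0 : 0 <= pos_part B nneg E by exact/pos_part_ge0/base_additiveN.
have p0 : 0 <= pos_part B nu E by exact: pos_part_ge0.
have nE : pos_part B nneg E < +oo.
  move: pE; rewrite pos_partB//.
  by case: (pos_part B nneg E) n0 => // r _ _; rewrite ltey.
split=> //; move: (pos_partB BE) pE nE n0 p0.
case: (pos_part B nu E) => // r; case: (pos_part B nneg E) => // s.
by rewrite -EFinD => -[->] _ _ _ _; rewrite /= addrK.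
Qed.

End jordan.

Section signed_integral.
Local Open Scope ereal_scope.
Variables (B : set (set X)) (nu : set X -> R).
Variables (a b : {measure set X -> \bar R}).
Hypotheses (bB : set_base B) (rab : represents B nu a b).

Let anu := represents_additive bB rab.
Let p : {measure set X -> \bar R} := pos_part_measure bB anu.
Let n : {measure set X -> \bar R} := pos_part_measure bB (base_additiveN anu).

(** This is [p - n = a - b] in a form that makes sense for infinite masses. It holds on B, and both
    sides are measures, so that it extends along the exhaustion. *)
Let pD A : measurable A -> measure_add p b A = measure_add a n A.
Proof.
have [G [BG ndG GT]] := base_exhaustion bB.
have base_case E : B E -> measure_add p b E = measure_add a n E.
  move=> BE; rewrite !measure_addE /= pos_partB//.
  have [aE bE ->] := rab BE.
  have : pos_part B (fun A => (- nu A)%R) E <= b E.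
    apply: (pos_part_le_represents bB (representsN rab)).
    exact: base_measurable BE.
  rewrite -[in a E](fineK (_ : a E \is a fin_num)) ?ge0_fin_numE//.
  rewrite -[in b E](fineK (_ : b E \is a fin_num)) ?ge0_fin_numE//.
  have : 0 <= pos_part B (fun A => (- nu A)%R) E.
    exact/pos_part_ge0/base_additiveN.
  case: (pos_part _ _ _) => // r _ _.
  by rewrite -!EFinD; congr EFin; rewrite !fineK ?ge0_fin_numE//; ring.
move=> mA.
have mG k : measurable (G k) by exact: (base_measurable bB).
have c (m : {measure set X -> \bar R}) : m (A `&` G k) @[k --> \oo] --> m A.
  have AE : \bigcup_k (A `&` G k) = A by rewrite -setI_bigcupr GT setIT.
  rewrite -[in X in _ --> X]AE; apply: nondecreasing_cvg_mu.
  - by move=> k; exact: measurableI.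
  - by apply: bigcup_measurable => k _; exact: measurableI.
  - by move=> i j ij; apply/subsetPset; apply: setIS; apply/subsetPset; exact: ndG.
apply: etrans (esym (cvg_lim (@ereal_hausdorff _) (c (measure_add p b)))) _.
apply: etrans (cvg_lim (@ereal_hausdorff _) (c (measure_add a n))).
congr (limn _); apply/funext => k; apply: base_case.
by rewrite setIC; exact: base_setI.
Qed.

(** [signed_integral] is defined by the Jordan decomposition, but [p + b = a + n] lets any
    representation compute it; [p <= a] and [n <= b] make f integrable for p and n. *)
Lemma signed_integralE (D : set X) (f : X -> R) : measurable D ->
  a.-integrable D (EFin \o f) -> b.-integrable D (EFin \o f) ->
  signed_integral B nu D f =
  (fine (\int[a]_(x in D) (f x)%:E) - fine (\int[b]_(x in D) (f x)%:E))%R.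
Proof.
move=> mD ia ib.
have mf : measurable_fun D (EFin \o f) by exact: measurable_int ia.
have sub (m1 m2 : {measure set X -> \bar R}) :
    (forall A, measurable A -> m1 A <= m2 A) ->
    m2.-integrable D (EFin \o f) -> m1.-integrable D (EFin \o f).
  move=> m12 /integrableP[_ fy]; apply/integrableP; split => //.
  apply: le_lt_trans fy; apply: le_integral_set_function; rewrite ?measure0//.
  by move=> A mA; rewrite measure_ge0 m12.
have ip : p.-integrable D (EFin \o f).
  by apply: sub ia => A mA; exact: (pos_part_le_represents bB rab).
have iN : n.-integrable D (EFin \o f).
  by apply: sub ib => A mA; exact: (pos_part_le_represents bB (representsN rab)).
have := @eq_measure_integral _ _ _ D (measure_add a n) (measure_add p b)
  (EFin \o f) (fun A mA _ => pD mA).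
rewrite !integral_measure_add//.
rewrite /signed_integral -[pos_part B nu]/(p : set X -> \bar R).
rewrite -[pos_part B (fun A => (- nu A)%R)]/(n : set X -> \bar R).
have := integrable_fin_num mD ia; have := integrable_fin_num mD ib.
have := integrable_fin_num mD ip; have := integrable_fin_num mD iN.
rewrite /comp/=.
move: (integral p _ _) (integral n _ _) (integral a _ _) (integral b _ _).
by move=> [?||] [?||] [?||] [?||] // _ _ _ _ [] ? /=; lra.
Qed.

End signed_integral.

End signed_set_function.

(** * Level sets of a convex function *)

Section expanding_map.
Context (R : realType).
Local Open Scope ereal_scope.

(** E lies in the interval of length r that starts at its infimum. It is an arbitrary set:
    [lebesgue_measure] is an outer measure defined on all sets. *)
Lemma lebesgue_measure_diameter (E : set R) (r : R) : (0 <= r)%R ->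
  (forall x y, E x -> E y -> (x - y <= r)%R) -> lebesgue_measure E <= r%:E.
Proof.
move=> r0 Er; have [->|/set0P[x0 Ex0]] := eqVneq E set0.
  by rewrite measure0 lee_fin.
have ubE : has_ubound E by exists (r + x0)%R => x Ex; rewrite -lerBlDr; exact: Er.
have lbE : has_lbound E by exists (x0 - r)%R => x Ex; have := Er _ _ Ex0 Ex; lra.
have E0 : E !=set0 by exists x0.
have -> : r%:E = lebesgue_measure `[inf E, (inf E + r)%R] :> \bar R.
  by rewrite lebesgue_measure_itv/= lte_fin ltrDl; case: ltP => r1;
    rewrite -?EFinD//; congr EFin; lra.
apply: le_outer_measure => x Ex /=; rewrite in_itv/=; apply/andP; split.
  exact: ge_inf.
rewrite -lerBlDr; apply: lb_le_inf => // y Ey; rewrite lerBlDr.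
by have := Er _ _ Ex Ey; lra.
Qed.

(* E and B need not be measurable: the preimages of the intervals of a cover of B
   are sets of smaller diameter which cover E. *)
Lemma lebesgue_measure_expanding (E B : set R) (F : R -> R) :
  (forall x, E x -> B (F x)) ->
  (forall x y, E x -> E y -> (x <= y -> y - x <= `|F y - F x|)%R) ->
  lebesgue_measure E <= lebesgue_measure B.
Proof.
move=> EB Fexp.
rewrite [leRHS](_ : _ = ((wlength idfun)^* B)%mu)//.
rewrite outer_measure_open_itv_cover; apply: le_ereal_inf_tmp => _ [G [Gitv BG] <-].
pose Ek k := E `&` F @^-1` G k.
have EEk : E `<=` \bigcup_k Ek k by move=> x Ex; have [k _ Gk] := BG _ (EB _ Ex); exists k.
apply: (@le_trans _ _ (\sum_(k <oo) lebesgue_measure (Ek k))).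
  rewrite [leLHS](_ : _ = ((wlength idfun)^* E)%mu)//.
  apply: le_trans (outer_measure_sigma_subadditive _ _).
  exact: le_outer_measure.
apply: lee_nneseries => [k _ _|k _]; first exact: outer_measure_ge0.
have [[a b] /= Gab] := Gitv k.
have [-> |/set0P[x0 Ex0]] := eqVneq (Ek k) set0.
  by rewrite measure0; exact: wlength_ge0.
have ab : (a < b)%R.
  by case: Ex0 => _; rewrite /preimage/= Gab /= in_itv/= => /andP[]; exact: lt_trans.
rewrite Gab wlength_itv /= lte_fin ab -EFinB.
apply: lebesgue_measure_diameter; first by rewrite subr_ge0 ltW.
move=> x y [Ex +] [Ey +]; rewrite /preimage/= Gab /= !in_itv/= => /andP[? ?] /andP[? ?].
have [xy|yx] := leP x y; first lra.
apply: le_trans (Fexp _ _ Ey Ex (ltW yx)) _; rewrite ler_norml; lra.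
Qed.

End expanding_map.

Section convex_branch.
Context (R : realType) (f : R -> R) (c : R).
Hypotheses (cf : continuous f) (c0 : 0 < c).
Hypothesis cvxf : forall s t l : R, 0 <= l <= 1 ->
  f (l * s + (1 - l) * t) <= l * f s + (1 - l) * f t.

Lemma convex_slope (u v w : R) : u < v -> v < w ->
  (f v - f u) * (w - v) <= (f w - f v) * (v - u).
Proof using cvxf.
move=> uv vw; have uw : 0 < w - u by lra.
pose l := (w - v) / (w - u).
have l01 : 0 <= l <= 1.
  by apply/andP; split; rewrite ?ler_pdivrMr// ?divr_ge0//; lra.
have := cvxf u w l01.
have -> : l * u + (1 - l) * w = v by rewrite /l; field; lra.
move=> H; have {H} := ler_wpM2r (ltW uw) H.
have -> : (l * f u + (1 - l) * f w) * (w - u) = (w - v) * f u + (v - u) * f w.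
  by rewrite /l; field; lra.
nra.
Qed.

(** Both slopes are compared with that of the chord from u to v'; denominators are cleared. *)
Lemma convex_slope_shift (u v u' v' : R) : u <= u' -> v <= v' -> u < v -> u' < v' ->
  (f v - f u) * (v' - u') <= (f v' - f u') * (v - u).
Proof using cvxf.
move=> uu vv uv uv'.
have vu : u < v' by lra.
have h1 : (f v - f u) * (v' - u) <= (f v' - f u) * (v - u).
  have [<-|vvN] := eqVneq v v'; first lra.
  by have := convex_slope uv (_ : v < v'); rewrite lt_neqAle vvN vv => /(_ isT); nra.
have h2 : (f v' - f u) * (v' - u') <= (f v' - f u') * (v' - u).
  have [<-|uuN] := eqVneq u u'; first lra.
  by have := convex_slope (_ : u < u') uv'; rewrite lt_neqAle uuN uu => /(_ isT); nra.
have p1 : 0 < v' - u by lra.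
rewrite -(ler_pM2r p1); nra.
Qed.

(* F t is the point between x0 and t where f is smaller by e. The slopes of f
   increase, so F t moves at least as much as t. *)
Lemma convex_branch (x0 b e : R) : 0 <= e -> x0 <= b ->
  (forall t, x0 <= t <= b -> f x0 + c * (t - x0) ^+ 2 <= f t) ->
  exists F : R -> R,
    (forall t, x0 <= t <= b -> f x0 + e <= f t ->
       [/\ x0 <= F t, F t <= t & f (F t) = f t - e]) /\
    (forall s t, x0 <= s -> s <= t -> t <= b ->
       f x0 + e <= f s -> f x0 + e <= f t -> t - s <= `|F t - F s|).
Proof using cf c0 cvxf.
move=> e0 x0b scf.
(* The slope on [u, v] is at least the slope on [x0, u], which is nonnegative; equality of f u and f
   v would force f v <= f x0, against the quadratic lower bound. *)
have incf u v : x0 <= u -> u < v -> v <= b -> f u < f v.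
  move=> x0u uv vb; have h := scf v; have := convex_slope_shift x0u (ltW uv).
  have [<-|x0uN] := eqVneq x0 u; last first.
    have x0u' : x0 < u by rewrite lt_neqAle x0uN.
    move=> /(_ x0u' uv) hs.
    have : f x0 <= f u.
      have := scf u; rewrite x0u (le_trans (ltW uv))// => /(_ isT); apply: le_trans.
      by rewrite lerDl mulr_ge0 ?sqr_ge0// ltW.
    have hv : f x0 < f v.
      apply: lt_le_trans (h _); last by apply/andP; split; lra.
      by rewrite ltrDl mulr_gt0// exprn_gt0// subr_gt0; lra.
    have := convex_slope x0u' uv => hs' fu.
    have p1 : 0 < u - x0 by lra.
    have p2 : 0 < v - u by lra.
    rewrite ltNge; apply/negP => fvu; nra.
  move=> _; apply: lt_le_trans (h _); last by apply/andP; split; lra.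
  by rewrite ltrDl mulr_gt0// exprn_gt0// subr_gt0; lra.
(* The intermediate value theorem on [x0, t] applies because [f x0 <= f t - e <= f t]; elsewhere 0
   is a dummy value. *)
have ex t : exists t', x0 <= t <= b -> f x0 + e <= f t ->
    [/\ x0 <= t', t' <= t & f t' = f t - e].
  have [/andP[x0t tb]|] := boolP (x0 <= t <= b); last by exists 0.
  have [ft|] := leP (f x0 + e) (f t); last by exists 0.
  have [] := @IVT R f x0 t (f t - e) x0t.
  - by apply: continuous_subspaceT => x; exact: cf.
  - rewrite ge_min le_max; apply/andP; split; apply/orP; [left|right]; lra.
  - by move=> t'; rewrite in_itv/= => /andP[? ?] ?; exists t'.
have [F HF] := choice ex; exists F; split=> // s t x0s st tb fs ft.
have [->|sN] := eqVneq s t; first by rewrite subrr normr_ge0.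
have {sN}st' : s < t by rewrite lt_neqAle sN.
have := HF s; rewrite x0s (le_trans st)// => /(_ isT fs)[s1 s2 s3].
have := HF t; rewrite tb (le_trans x0s)// => /(_ isT ft)[t1 t2 t3].
have fst : f s < f t by exact: incf.
have FF : F s < F t.
  rewrite ltNge; apply/negP; rewrite le_eqVlt => /predU1P[E|FF].
    by rewrite E in t3; lra.
  by have := incf _ _ t1 FF _; rewrite (le_trans s2) ?(le_trans st)// => /(_ isT); lra.
rewrite ger0_norm; last lra.
have := convex_slope_shift s2 t2 FF st'.
have -> : f (F t) - f (F s) = f t - f s by lra.
by rewrite ler_pM2l//; lra.
Qed.

End convex_branch.

Section convex_shift.
Context (R : realType) (f : R -> R) (c : R).
Hypotheses (cf : continuous f) (c0 : 0 < c).
Hypothesis cvxf : forall s t l : R, 0 <= l <= 1 ->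
  f (l * s + (1 - l) * t) <= l * f s + (1 - l) * f t.

Local Notation leb := (@lebesgue_measure R).

Let mf : measurable_fun setT f.
Proof. exact: continuous_measurable_fun. Qed.

Let m_level (A : set R) (e : R) : measurable A -> measurable [set t | A (f t - e)].
Proof.
move=> mA; have := @measurable_funB _ _ _ setT f (cst e) mf (measurable_cst _).
by move=> /(_ measurableT A mA); rewrite setTI.
Qed.

Let m_level0 (A : set R) : measurable A -> measurable [set t | A (f t)].
Proof. by move=> /(m_level 0); under eq_set do rewrite subr0. Qed.

(* Where f < min f + e there is no F, but this set is contained in an interval of
   length 2 r. On the rest, convex_branch applies to the right of the minimum
   point, and to its left after a reflection. *)
Lemma convex_level_shift (a b e r : R) (A : set R) : measurable A ->
  a < b -> 0 <= e -> 0 <= r -> e <= 2 * c * r ^+ 2 ->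
  (forall s t, a <= s <= b -> a <= t <= b ->
     f ((s + t) / 2) <= (f s + f t) / 2 - c * (t - s) ^+ 2) ->
  (leb (`[a, b[ `&` [set t | A (f t - e)%R]) <=
   leb (`[a, b[ `&` [set t | A (f t)]) + (2 * r)%:E)%E.
Proof using cf c0 cvxf.
move=> mA ab e0 r0 er scf.
have [x0] := @EVT_min R f a b (ltW ab) (continuous_subspaceT cf).
rewrite in_itv/= => /andP[ax0 x0b] x0min.
(* Strict midpoint convexity between x0 and t, at whose midpoint f is at least f x0; solving for f t
   doubles the constant c. *)
have x0minE t : a <= t <= b -> f x0 + 2 * c * (t - x0) ^+ 2 <= f t.
  move=> /andP[at_ tb].
  have h1 : f x0 <= f ((x0 + t) / 2) by apply: x0min; rewrite in_itv/=; lra.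
  have := scf x0 t; rewrite ax0 x0b at_ tb => /(_ isT isT); lra.
pose E := `[a, b[ `&` [set t | A (f t - e)].
pose B := `[a, b[ `&` [set t | A (f t)].
have mE : measurable E by apply: measurableI => //; exact: m_level.
have mB : measurable B by apply: measurableI => //; exact: m_level0.
pose small := [set t | f t < f x0 + e].
have msmall : measurable small.
  have := mf measurableT (@measurable_itv R `]-oo, (f x0 + e)%R[).
  by rewrite setTI.
have small_r t : a <= t <= b -> small t -> x0 - r <= t <= x0 + r.
  rewrite /small/= => /x0minE h1 h2.
  have h3 : (t - x0) ^+ 2 <= r ^+ 2.
    by rewrite -(ler_pM2l (_ : 0 < 2 * c)) ?mulr_gt0//; lra.
  have : `|t - x0| <= r.
    by rewrite -(ler_pXn2r (_ : 0 < 2)%N) ?nnegrE// real_normK ?num_real.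
  by rewrite ler_norml; lra.
have lsmall : (leb (E `&` small) <= (2 * r)%:E)%E.
  apply: (@le_trans _ _ (leb `[x0 - r, x0 + r])); last first.
    rewrite lebesgue_measure_itv/= lte_fin; case: ifPn => _.
      by rewrite -EFinD lee_fin; lra.
    by rewrite lee_fin; lra.
  apply: le_outer_measure => t [[/= + _] st]; rewrite !in_itv/= => /andP[? ?].
  by apply: small_r => //; lra.
pose H : set R := `[x0, +oo[%classic.
have mH : measurable H by exact: measurable_itv.
have right : (leb ((E `\` small) `&` H) <= leb (B `&` H))%E.
  have scf' t : x0 <= t <= b -> f x0 + c * (t - x0) ^+ 2 <= f t.
    move=> /andP[? ?]; have := x0minE t; rewrite (le_trans ax0)//= => /(_ ltac:(done)).
    by have := mulr_ge0 (ltW c0) (sqr_ge0 (t - x0)); lra.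
  have [F [F1 F2]] := convex_branch cf c0 cvxf e0 x0b scf'.
  apply: (@lebesgue_measure_expanding _ _ _ F).
    move=> t [[[/= + At] +] +]; rewrite /H/= !in_itv/= => /andP[? ?] /negP + /andP[? _].
    rewrite -leNgt => ft; have [|//|F3 F4 F5] := F1 t; first by lra.
    by split; [split|]; rewrite /= ?in_itv/= ?F5 ?andbT//; lra.
  move=> s t [[[/= + _] +] +] [[[/= + _] +] +].
  rewrite /H/= !in_itv/= => /andP[? ?] /negP + /andP[? _] /andP[? ?] /negP + /andP[? _].
  by rewrite -!leNgt => ? ? ?; apply: F2 => //; lra.
have left : (leb ((E `\` small) `\` H) <= leb (B `\` H))%E.
  pose g t := f (- t).
  have cg : continuous g by move=> t; apply: continuous_comp; [exact: opp_continuous|exact: cf].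
  have cvxg s t l : 0 <= l <= 1 -> g (l * s + (1 - l) * t) <= l * g s + (1 - l) * g t.
    by move=> l01; have := cvxf (- s) (- t) l01; rewrite /g opprD !mulrN.
  have scg t : - x0 <= t <= - a -> g (- x0) + c * (t - - x0) ^+ 2 <= g t.
    move=> /andP[? ?]; have := x0minE (- t); rewrite /g opprK.
    have -> : (- t - x0) ^+ 2 = (t + x0) ^+ 2 by ring.
    move=> /(_ ltac:(lra)).
    by have := mulr_ge0 (ltW c0) (sqr_ge0 (t + x0)); lra.
  have ax0' : - x0 <= - a by lra.
  have [G [G1 G2]] := convex_branch cg c0 cvxg e0 ax0' scg.
  rewrite /g opprK in G1 G2.
  (* The reflected map may take the value x0, which belongs to [H]. Adding this point costs no
     measure. *)
  apply: (@le_trans _ _ (leb ((B `\` H) `|` [set x0]))); last first.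
    apply: (le_trans (measureU2 _ _ _)) => //; first exact: measurableD.
    rewrite -[leRHS]adde0 leeD//; by rewrite -(lebesgue_measure_set1 x0).
  apply: (@lebesgue_measure_expanding _ _ _ (fun t => - G (- t))).
    move=> t [[[/= + At] +] +]; rewrite /H/= !in_itv/= andbT => /andP[? ?] /negP + /negP.
    rewrite -leNgt -ltNge => ft tx.
    have [||F3 F4 F5] := G1 (- t); rewrite ?opprK//; first by lra.
    have [->|Fx] := eqVneq (- G (- t)) x0; first by right.
    left; split; last by rewrite andbT; apply/negP; rewrite -ltNge lt_neqAle Fx; lra.
    by split; rewrite /= ?F5 ?opprK// in_itv/=; lra.
  move=> s t [[[/= + _] +] +] [[[/= + _] +] +].
  rewrite /H/= !in_itv/= !andbT => /andP[? ?] /negP + /negP + /andP[? ?] /negP + /negP.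
  rewrite -!leNgt -!ltNge => ? ? ? ? ?.
  have -> : - G (- t) - - G (- s) = G (- s) - G (- t) by ring.
  have -> : t - s = - s - - t by ring.
  by apply: G2; rewrite ?opprK; lra.
have -> : leb E = (leb (E `\` small) + leb (E `&` small))%E by exact: measureDI.
apply: leeD => //.
apply: le_trans (_ : leb (B `\` H) + leb (B `&` H) <= _)%E; last first.
  by have := measureDI leb mB mH => <-.
apply: le_trans (leeD left right).
by have := measureDI leb (measurableD mE msmall) mH => <-.
Qed.

Section weighted.
Local Open Scope ereal_scope.
Variables (k : R -> R) (C eta : R).
Hypotheses (mk : measurable_fun setT k) (k0 : forall t, (0 <= k t)%R).
Hypotheses (kC : forall t, (k t <= C)%R) (eta0 : (0 <= eta)%R).
Variables (a h e r : R) (N : nat) (A : set R).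
Hypotheses (mA : measurable A) (h0 : (0 < h)%R).
Hypotheses (e0 : (0 <= e)%R) (r0 : (0 <= r)%R) (er : (e <= 2 * c * r ^+ 2)%R).
Hypothesis k_osc : forall s t, (`|s - t| <= h -> `|k s - k t| <= eta)%R.
Hypothesis scf : forall s t, (a <= s <= a + N%:R * h)%R ->
  (a <= t <= a + N%:R * h)%R ->
  (f ((s + t) / 2) <= (f s + f t) / 2 - c * (t - s) ^+ 2)%R.

Let Ae := [set t | A (f t - e)%R].
Let A0 := [set t | A (f t)].

(** On a cell k is within eta of k u. Replacing k by the constant [k u + eta] and back costs 2 eta
    on a length of at most h, and the extra length 2 r has weight at most [C + eta]. *)
Let weighted_cell (u : R) : (a <= u)%R -> (u + h <= a + N%:R * h)%R ->
  \int[leb]_(t in `[u, (u + h)%R[ `&` Ae) (k t)%:E <=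
  \int[leb]_(t in `[u, (u + h)%R[ `&` A0) (k t)%:E +
  (2 * eta * h + (C + eta) * (2 * r))%:E.
Proof.
move=> au uh; set I := [set` `[u, (u + h)%R[].
have mI : measurable I by exact: measurable_itv.
have mAe : measurable Ae by exact: m_level.
have mA0 : measurable A0 by exact: m_level0.
have lI : leb (I `&` A0) <= h%:E.
  apply: (@le_trans _ _ (leb I)); first by apply: le_outer_measure; exact: subIsetl.
  by rewrite /I lebesgue_measure_itv/= lte_fin ltrDl h0 -EFinB lee_fin; lra.
have ku t : I t -> (k u - eta <= k t <= k u + eta)%R.
  rewrite /I/= in_itv/= => /andP[? ?]; have := @k_osc t u.
  by rewrite ger0_norm ?ler_norml; lra.
have C0 : (0 <= C)%R by exact: le_trans (k0 u) (kC u).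
have kue : (0 <= k u + eta)%R by rewrite addr_ge0.
apply: (@le_trans _ _ ((k u + eta)%:E * leb (I `&` Ae))).
  rewrite -integral_cst; last exact: measurableI.
  apply: ge0_le_integral.
  - exact: measurableI.
  - by move=> t _; rewrite lee_fin.
  - exact/measurable_EFinP/measurable_funTS.
  - exact: measurable_cst.
  - by move=> t [It _]; rewrite lee_fin; have /andP[] := ku t It.
have shift : leb (I `&` Ae) <= leb (I `&` A0) + (2 * r)%:E.
  apply: (@convex_level_shift u (u + h) e r A) => //.
    by rewrite ltrDl.
  move=> s t su tu; apply: scf; lra.
apply: (@le_trans _ _ ((k u + eta)%:E * (leb (I `&` A0) + (2 * r)%:E))).
  by apply: lee_wpmul2l => //; rewrite lee_fin.
have -> : (2 * eta * h + (C + eta) * (2 * r))%:E = (2 * eta * h)%:E + ((C + eta) * (2 * r))%:E by rewrite EFinD.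
rewrite ge0_muleDr ?lee_fin ?mulr_ge0// addeA; apply: leeD; last first.
  by rewrite -EFinM lee_fin ler_wpM2r ?mulr_ge0// lerD2r.
rewrite -integral_cst; last exact: measurableI.
apply: (@le_trans _ _ (\int[leb]_(t in I `&` A0) ((k t)%:E + (2 * eta)%:E))).
  apply: ge0_le_integral.
  - exact: measurableI.
  - by move=> t _; rewrite lee_fin.
  - exact: measurable_cst.
  - apply: emeasurable_funD; last exact: measurable_cst.
    exact/measurable_EFinP/measurable_funTS.
  - by move=> t [It _]; rewrite lee_fin /cst/=; have /andP[] := ku t It; lra.
rewrite ge0_integralD//; last 4 first.
- exact: measurableI.
- by move=> t _; rewrite lee_fin.
- exact/measurable_EFinP/measurable_funTS.
- by move=> t _; rewrite lee_fin mulr_ge0.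
apply: leeD => //.
have := integral_cst leb (measurableI _ _ mI mA0) (2 * eta)%:E; rewrite /cst => ->.
by rewrite (EFinM (2 * eta)%R h); apply: lee_wpmul2l => //; rewrite lee_fin mulr_ge0.
Qed.

(** Each cell contains its own minimum of f, so that the term with r is paid N times, whereas the
    oscillation is paid in proportion to the total length N h. *)
Lemma weighted_level_shift (b : R) : b = (a + N%:R * h)%R ->
  \int[leb]_(t in `[a, b[ `&` Ae) (k t)%:E <=
  \int[leb]_(t in `[a, b[ `&` A0) (k t)%:E +
  (N%:R * (2 * eta * h + (C + eta) * (2 * r)))%:E.
Proof.
move=> ->; have mAe : measurable Ae by exact: m_level.
have mA0 : measurable A0 by exact: m_level0.
have step n : (n <= N)%N ->
    \int[leb]_(t in `[a, (a + n%:R * h)%R[ `&` Ae) (k t)%:E <=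
    \int[leb]_(t in `[a, (a + n%:R * h)%R[ `&` A0) (k t)%:E +
    (n%:R * (2 * eta * h + (C + eta) * (2 * r)))%:E; last exact: step.
elim: n => [_|n ih nN].
  by rewrite !mul0r !addr0 set_itvco0 !set0I !integral_set0.
pose u := (a + n%:R * h)%R.
have uh : (a + n.+1%:R * h = u + h)%R by rewrite /u -natr1; ring.
have uN : (u + h <= a + N%:R * h)%R by rewrite -uh lerD2l ler_pM2r// ler_nat.
have au : (a <= u)%R by rewrite /u lerDl mulr_ge0// ltW.
have split (B : set R) : measurable B ->
    \int[leb]_(t in `[a, (a + n.+1%:R * h)%R[ `&` B) (k t)%:E =
    \int[leb]_(t in `[a, u[ `&` B) (k t)%:E +
    \int[leb]_(t in `[u, (u + h)%R[ `&` B) (k t)%:E.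
  move=> mB; rewrite -ge0_integral_setU.
  - rewrite -setIUl uh; congr (integral _ (_ `&` _) _).
    by rewrite -itv_bndbnd_setU// bnd_simp// lerDl ltW.
  - by apply: measurableI => //; exact: measurable_itv.
  - by apply: measurableI => //; exact: measurable_itv.
  - exact/measurable_EFinP/measurable_funTS.
  - by move=> t _; rewrite lee_fin.
  - apply/disj_setPS => t [[/= + _] [/= + _]]; rewrite !in_itv/= => /andP[_ tu] /andP[ut _].
    by have := lt_le_trans tu ut; rewrite ltxx.
rewrite !split//; apply: (le_trans (leeD (ih (ltnW nN)) (weighted_cell au uN))).
rewrite addeACA leeD2l// -EFinD lee_fin -natr1; lra.
Qed.

End weighted.

End convex_shift.

(** * Distance to a point that moves on a line *)

Section line_distance.
Context (R : realType).
Implicit Types a s t u l : R.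

(** For a point at squared distance a from a line, with projection at coordinate u, this is the
    distance to the point of the line at coordinate t. *)
Definition line_dist a u t := Num.sqrt (a + (u - t) ^+ 2).

Lemma line_dist_ge0 a u t : 0 <= line_dist a u t.
Proof. exact: sqrtr_ge0. Qed.

Lemma line_dist_sqr a u t : 0 <= a -> line_dist a u t ^+ 2 = a + (u - t) ^+ 2.
Proof. by move=> a0; rewrite sqr_sqrtr// addr_ge0// sqr_ge0. Qed.

Lemma continuous_line_dist a u : continuous (line_dist a u).
Proof.
move=> t; apply: (@continuous_comp _ _ _ (fun t => a + (u - t) ^+ 2) Num.sqrt).
  apply: continuousD; first exact: cst_continuous.
  apply: continuousM; (apply: continuousB; [exact: cst_continuous|exact: cvg_id]).
exact: sqrt_continuous.
Qed.

(** Cauchy-Schwarz for the plane vectors [(sqrt a, u - s)] and [(sqrt a, u - t)]. *)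
Lemma line_dist_cauchy a u s t : 0 <= a ->
  a + (u - s) * (u - t) <= line_dist a u s * line_dist a u t.
Proof.
move=> a0; have Ps := line_dist_sqr u s a0; have Qs := line_dist_sqr u t a0.
have P0 := line_dist_ge0 a u s; have Q0 := line_dist_ge0 a u t.
move: (line_dist a u s) (line_dist a u t) Ps Qs P0 Q0 => P Q Ps Qs P0 Q0.
have PQ0 := mulr_ge0 P0 Q0.
rewrite leNgt; apply/negP => lt.
have : (P * Q) ^+ 2 < (a + (u - s) * (u - t)) ^+ 2 by rewrite ltr_pXn2r// nnegrE// ltW// (le_lt_trans PQ0).
rewrite exprMn Ps Qs.
have := mulr_ge0 a0 (sqr_ge0 (s - t)); nra.
Qed.

Lemma line_dist_convex a u s t l : 0 <= a -> 0 <= l <= 1 ->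
  line_dist a u (l * s + (1 - l) * t) <= l * line_dist a u s + (1 - l) * line_dist a u t.
Proof.
move=> a0 /andP[l0 l1]; have l1' : 0 <= 1 - l by rewrite subr_ge0.
have c := line_dist_cauchy u s t a0.
have Ps := line_dist_sqr u s a0; have Qs := line_dist_sqr u t a0.
have P0 := line_dist_ge0 a u s; have Q0 := line_dist_ge0 a u t.
rewrite /line_dist -(ler_pXn2r (_ : 0 < 2)%N) ?nnegrE ?sqrtr_ge0 ?addr_ge0 ?mulr_ge0 ?sqrtr_ge0//.
rewrite sqr_sqrtr ?addr_ge0 ?sqr_ge0// -!/(line_dist _ _ _).
move: (line_dist a u s) (line_dist a u t) Ps Qs P0 Q0 c => P Q Ps Qs P0 Q0 c.
have -> : (l * P + (1 - l) * Q) ^+ 2 =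
  l ^+ 2 * P ^+ 2 + (1 - l) ^+ 2 * Q ^+ 2 + 2 * (l * (1 - l)) * (P * Q) by ring.
rewrite Ps Qs.
have := ler_wpM2l (mulr_ge0 l0 l1') c; nra.
Qed.

(** Let P, Q, M be the distances at s, t and the midpoint, and z the defect in [line_dist_cauchy].
    Lagrange's identity gives [z * (P * Q + (a + (u - s) * (u - t))) = a * (t - s) ^+ 2], the
    parallelogram law gives [(P + Q) ^+ 2 - 4 * M ^+ 2 = 2 * z]. The cofactors are at most
    [2 * H ^+ 2] and [4 * H], whence [8 * H ^+ 3]. *)
Lemma line_dist_midpoint a u s t d H : 0 < H -> 0 <= d -> d <= a ->
  line_dist a u s <= H -> line_dist a u t <= H -> 
  line_dist a u ((s + t) / 2) <=
    (line_dist a u s + line_dist a u t) / 2 - d / (8 * H ^+ 3) * (t - s) ^+ 2.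
Proof.
move=> H0 d0 da PH QH; have a0 := le_trans d0 da.
have c := line_dist_cauchy u s t a0.
have Ps := line_dist_sqr u s a0; have Qs := line_dist_sqr u t a0.
have P0 := line_dist_ge0 a u s; have Q0 := line_dist_ge0 a u t.
have Ms := line_dist_sqr u ((s + t) / 2) a0.
have M0 := line_dist_ge0 a u ((s + t) / 2).
have MH : 2 * line_dist a u ((s + t) / 2) <= line_dist a u s + line_dist a u t.
  have := @line_dist_convex a u s t 2^-1 a0.
  have -> : 2^-1 * s + (1 - 2^-1) * t = (s + t) / 2 by field.
  by move=> /(_ ltac:(lra)); lra.
move: (line_dist a u s) (line_dist a u t) (line_dist a u ((s + t) / 2))
  PH QH Ps Qs P0 Q0 c Ms M0 MH => P Q M PH QH Ps Qs P0 Q0 c Ms M0 MH.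
set D := d * (t - s) ^+ 2; have D0 : 0 <= D by rewrite mulr_ge0// sqr_ge0.
have PQH : P * Q <= H ^+ 2 by rewrite expr2 ler_pM.
set z := P * Q - (a + (u - s) * (u - t)); have z0 : 0 <= z by rewrite subr_ge0.
have zD : D <= z * (2 * H ^+ 2).
  apply: (@le_trans _ _ (z * (P * Q + (a + (u - s) * (u - t))))); last first.
    by rewrite ler_wpM2l//; lra.
  have -> : z * (P * Q + (a + (u - s) * (u - t))) = a * (t - s) ^+ 2.
    rewrite /z -subr_sqr exprMn Ps Qs; ring.
  by rewrite ler_wpM2r// sqr_ge0.
have MPQ : (P + Q - 2 * M) * (P + Q + 2 * M) = 2 * z.
  by rewrite -subr_sqr exprMn Ms sqrrD Ps Qs /z; field.
have w0 : 0 <= P + Q - 2 * M by lra.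
have zH : 2 * z <= (P + Q - 2 * M) * (4 * H).
  by rewrite -MPQ ler_wpM2l//; lra.
have H30 : 0 < 8 * H ^+ 3 by rewrite mulr_gt0// exprn_gt0.
have H20 : 0 <= 2 * H ^+ 2 by rewrite mulr_ge0// exprn_ge0// ltW.
suff : d / (8 * H ^+ 3) * (t - s) ^+ 2 <= (P + Q - 2 * M) / 2 by lra.
rewrite mulrAC -/D ler_pdivrMr//.
have := ler_wpM2r H20 zH; have e3 : H ^+ 3 = H * H ^+ 2 by ring.
rewrite e3; nra.
Qed.

Lemma line_dist_lipschitz a u s t : 0 <= a ->
  `|line_dist a u s - line_dist a u t| <= `|s - t|.
Proof.
move=> a0; wlog st : s t / line_dist a u t <= line_dist a u s.
  move=> H; have [/H//|ts] := leP (line_dist a u t) (line_dist a u s).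
  by rewrite distrC (distrC s); apply: H; exact: ltW.
rewrite ger0_norm ?subr_ge0//.
have c := line_dist_cauchy u s t a0.
have Ps := line_dist_sqr u s a0; have Qs := line_dist_sqr u t a0.
have n0 := normr_ge0 (s - t).
rewrite -(ler_pXn2r (_ : 0 < 2)%N) ?nnegrE ?subr_ge0// real_normK ?num_real//.
rewrite sqrrB Ps Qs; nra.
Qed.

End line_distance.

(** * Newton potentials *)

Section newton_kernel.
Context (R : realType).
Implicit Types x y z : R3 R.

(** At x = y the value is 0, since [0^-1 = 0], whereas the integrand of [kato_norm] is [+oo] there;
    the former is still bounded by the latter. *)
Definition newton y x : R := (4 * pi * enorm (x - y))^-1.

Lemma enorm_ge0 x : 0 <= enorm x. Proof. exact: sqrtr_ge0. Qed.

Lemma newton_ge0 y x : 0 <= newton y x.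
Proof. by rewrite invr_ge0 mulr_ge0 ?enorm_ge0// mulr_ge0// pi_ge0. Qed.

Lemma newton_le y x : newton y x <= (enorm (x - y))^-1.
Proof.
rewrite /newton; have [->|n0] := eqVneq (enorm (x - y)) 0; first by rewrite mulr0 invr0.
have np : 0 < enorm (x - y) by rewrite lt_neqAle eq_sym n0 enorm_ge0.
have pi4 : 1 <= 4 * pi :> R by have := @pi_ge2 R; lra.
by rewrite lef_pV2 ?posrE ?mulr_gt0//; [rewrite ler_peMl// ltW|lra].
Qed.

Lemma measurable_enorm : measurable_fun setT (@enorm R).
Proof.
have ms : measurable_fun setT (@Num.sqrt R).
  exact: continuous_measurable_fun (@sqrt_continuous R).
apply: (measurableT_comp ms).
apply: measurable_funD; [apply: measurable_funD|]; apply: measurable_funX.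
- by apply: measurableT_comp => //; exact: measurable_fst.
- by apply: measurableT_comp => //; exact: measurable_snd.
- exact: measurable_snd.
Qed.

Lemma measurable_R3B d (T : measurableType d) (f g : T -> R3 R) :
  measurable_fun setT f -> measurable_fun setT g ->
  measurable_fun setT (fun t => f t - g t).
Proof.
move=> mf mg.
have m1 (h : T -> R3 R) : measurable_fun setT h ->
    [/\ measurable_fun setT (fun t => (h t).1.1),
        measurable_fun setT (fun t => (h t).1.2) &
        measurable_fun setT (fun t => (h t).2)].
  move=> mh; split.
  - by apply: measurableT_comp; [|apply: measurableT_comp mh].
  - by apply: measurableT_comp; [|apply: measurableT_comp mh].
  - exact: measurableT_comp mh.
have [f1 f2 f3] := m1 _ mf; have [g1 g2 g3] := m1 _ mg.
apply: (measurable_fun_pair (f := fun t => (f t).1 - (g t).1) (g := fun t => (f t).2 - (g t).2)).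
  apply: (measurable_fun_pair (f := fun t => (f t).1.1 - (g t).1.1)
                              (g := fun t => (f t).1.2 - (g t).1.2)).
    exact: measurable_funB.
  exact: measurable_funB.
exact: measurable_funB.
Qed.

Lemma measurable_enormB d (T : measurableType d) (f g : T -> R3 R) :
  measurable_fun setT f -> measurable_fun setT g ->
  measurable_fun setT (fun t => enorm (f t - g t)).
Proof.
by move=> mf mg; apply: measurableT_comp measurable_enorm _; exact: measurable_R3B.
Qed.

Lemma measurable_newton d (T : measurableType d) (f g : T -> R3 R) :
  measurable_fun setT f -> measurable_fun setT g ->
  measurable_fun setT (fun t => newton (f t) (g t)).
Proof.
move=> mf mg.
rewrite (_ : (fun t => newton (f t) (g t)) =
   (fun t => (4 * pi * enorm (g t - f t)) `^ (-1))); last first.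
  by apply/funext => t; rewrite powR_inv1// mulr_ge0 ?enorm_ge0// mulr_ge0// pi_ge0.
apply: (measurableT_comp (measurable_powR _)).
by apply: measurable_funM => //; exact: measurable_enormB.
Qed.

End newton_kernel.

Lemma product_measure_sigma_finite d1 d2 (T1 : measurableType d1)
    (T2 : measurableType d2) (R : realType)
    (m1 : {sigma_finite_measure set T1 -> \bar R})
    (m2 : {sigma_finite_measure set T2 -> \bar R}) :
  sigma_finite setT (m1 \x m2)%E.
Proof.
have /sigma_finiteP[F [FT ndF mF]] := sigma_finiteT m1.
have /sigma_finiteP[G [GT ndG mG]] := sigma_finiteT m2.
exists (fun n => F n `*` G n) => [|n]; last first.
  have [[mFn Foo] [mGn Goo]] := (mF n, mG n); split; first exact: measurableX.
  by rewrite product_measure1E// lte_mul_pinfty// ge0_fin_numE.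
apply/esym; rewrite -subTset => -[x y] _.
have [n _ Fx] : (\bigcup_n F n) x by rewrite -FT.
have [k _ Gy] : (\bigcup_n G n) y by rewrite -GT.
exists (maxn n k) => //; split => /=.
- by have /subsetPset := ndF _ _ (leq_maxl n k); apply.
- by have /subsetPset := ndG _ _ (leq_maxr n k); apply.
Qed.

Section newton_potential.
Context (R : realType).
Local Open Scope ereal_scope.

Let mtid : measurableTypeR R -> R := idfun.

Let measurable_mtid : measurable_fun setT mtid.
Proof. by move=> _ Y mY; rewrite setTI. Qed.

(* The library puts lebesgue_measure on a copy of R whose sigma-algebra carries
   another display; leb, leb2, leb3 live on the canonical R, R^2, R^3. *)
Definition lebR : set R -> \bar R := @lebesgue_measure R.

Let lebR0 : lebR set0 = 0. Proof. exact: (measure0 (@lebesgue_measure R)). Qed.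

Let lebR_ge0 A : 0 <= lebR A. Proof. exact: (measure_ge0 (@lebesgue_measure R)). Qed.

Let lebR_sigma_additive : semi_sigma_additive lebR.
Proof. exact: (measure_semi_sigma_additive (s := @lebesgue_measure R)). Qed.

Let lebR_sigma_finite : sigma_finite setT lebR.
Proof. exact: (sigma_finiteT (@lebesgue_measure R)). Qed.

HB.instance Definition _ :=
  isMeasure.Build _ _ _ lebR lebR0 lebR_ge0 lebR_sigma_additive.

HB.instance Definition _ :=
  Measure_isSigmaFinite.Build _ _ _ lebR lebR_sigma_finite.

Definition leb : {sigma_finite_measure set R -> \bar R} :=
  [the {sigma_finite_measure set _ -> \bar R} of lebR].

(* The library's sigma-finite structure on product measures is not found by
   unification, hence the named copies. *)
Definition lebR2 : set (R * R)%type -> \bar R := leb \x leb.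

HB.instance Definition _ := Measure.on lebR2.

HB.instance Definition _ :=
  Measure_isSigmaFinite.Build _ _ _ lebR2 (product_measure_sigma_finite leb leb).

Definition leb2 : {sigma_finite_measure set (R * R)%type -> \bar R} :=
  [the {sigma_finite_measure set _ -> \bar R} of lebR2].

Definition lebR3 : set (R3 R) -> \bar R := leb2 \x leb.

HB.instance Definition _ := Measure.on lebR3.

HB.instance Definition _ :=
  Measure_isSigmaFinite.Build _ _ _ lebR3 (product_measure_sigma_finite leb2 leb).

Definition leb3 : {sigma_finite_measure set (R3 R) -> \bar R} :=
  [the {sigma_finite_measure set _ -> \bar R} of lebR3].

Lemma integral_leb (D : set R) (f : R -> \bar R) :
  measurable D -> measurable_fun D f -> (forall x, 0 <= f x) ->
  \int[leb]_(x in D) f x = \int[@lebesgue_measure R]_(x in D) f x.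
Proof.
move=> mD mf f0; rewrite -[RHS](ge0_integral_pushforward measurable_mtid)//.
Qed.

Lemma leb2X (A B : set R) : measurable A -> measurable B ->
  leb2 (A `*` B) = leb A * leb B.
Proof. exact: product_measure1E. Qed.

Lemma leb3X (A : set (R * R)%type) (B : set R) : measurable A -> measurable B ->
  leb3 (A `*` B) = leb2 A * leb B.
Proof. exact: product_measure1E. Qed.

Definition box (a b : R3 R) : set (R3 R) :=
  (`[a.1.1, b.1.1] `*` `[a.1.2, b.1.2]) `*` `[a.2, b.2].

Lemma measurable_box a b : measurable (box a b).
Proof. by apply: measurableX; [apply: measurableX|]; exact: measurable_itv. Qed.

Lemma leb3_box (a b : R3 R) :
  (a.1.1 <= b.1.1)%R -> (a.1.2 <= b.1.2)%R -> (a.2 <= b.2)%R ->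
  leb3 (box a b) = ((b.1.1 - a.1.1) * (b.1.2 - a.1.2) * (b.2 - a.2))%:E.
Proof.
have H (u v : R) : (u <= v)%R -> leb `[u, v]%classic = (v - u)%:E.
  rewrite [LHS](_ : _ = (@lebesgue_measure R) `[u, v]%classic)// lebesgue_measure_itv/= lte_fin le_eqVlt => /predU1P[->|->].
    by rewrite ltxx subrr.
  by rewrite EFinB.
move=> h1 h2 h3; rewrite leb3X; [|apply: measurableX|]; try exact: measurable_itv.
rewrite leb2X; [|exact: measurable_itv|exact: measurable_itv].
by rewrite !EFinM; congr (_ * _ * _); exact: H.
Qed.

(** Cubes stand in for Euclidean balls, which they contain, because their volume is that of a
    box. *)
Definition cube (y : R3 R) (r : R) := box (y - (r, r, r))%R (y + (r, r, r))%R.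

Lemma coord_le_enorm (x : R3 R) :
  [/\ `|x.1.1| <= enorm x, `|x.1.2| <= enorm x & `|x.2| <= enorm x]%R.
Proof.
by split; rewrite -sqrtr_sqr ler_wsqrtr//;
  have := sqr_ge0 x.1.1; have := sqr_ge0 x.1.2; have := sqr_ge0 x.2; lra.
Qed.

Lemma in_cube (y x : R3 R) r : (enorm (x - y) <= r)%R -> cube y r x.
Proof.
move=> xr; have /= [] := coord_le_enorm (x - y)%R.
move=> /le_trans /(_ xr) h1 /le_trans /(_ xr) h2 /le_trans /(_ xr) h3.
move: h1 h2 h3; rewrite !ler_norml => h1 h2 h3.
by split; [split|]; rewrite /= in_itv/=; lra.
Qed.

Lemma leb3_cube y (r : R) : (0 <= r)%R -> leb3 (cube y r) = (8 * r ^+ 3)%:E.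
Proof. by move=> r0; rewrite leb3_box/=; [congr EFin; ring|lra|lra|lra]. Qed.

Let dyadic (r n : R) : (0 < n)%R -> (n <= r)%R ->
  exists k : nat, (r / 2 ^+ k.+1 < n <= r / 2 ^+ k)%R.
Proof.
move=> n0 nr; have r0 := lt_le_trans n0 nr.
have ex : exists k, (r / 2 ^+ k.+1 < n)%R.
  exists (Num.truncn (r / n)); rewrite ltr_pdivrMr ?exprn_gt0// mulrC -ltr_pdivrMr//.
  apply: (@lt_le_trans _ _ (Num.truncn (r / n)).+1%:R); first exact: truncnS_gt.
  by rewrite -natrX ler_nat ltnW// ltn_expl.
have [k kP kmin] := ex_minnP ex; exists k; rewrite kP/=.
case: k kP kmin => [|k] _ kmin; first by rewrite expr0 divr1.
by rewrite leNgt; apply/negP => /kmin; rewrite ltnn.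
Qed.

(** Beyond distance r the kernel is at most 1/r. At a distance between r / 2^(k+1) and r / 2^k it is
    at most 2^(k+1) / r, and x lies in the k-th cube. Potentials are thus estimated by volumes of
    cubes, without polar coordinates. *)
Let newton_dyadic (r : R) y x : (0 < r)%R ->
  (newton y x)%:E <= (r^-1)%:E +
    \sum_(k <oo) ((2 ^+ k.+1 / r)%:E * (\1_(cube y (r / 2 ^+ k)) x)%:E).
Proof.
move=> r0; set S := \sum_(k <oo) _.
have t0 k : 0 <= (2 ^+ k.+1 / r)%:E * (\1_(cube y (r / 2 ^+ k)) x)%:E.
  by rewrite -EFinM lee_fin mulr_ge0// divr_ge0// ?exprn_ge0// ltW.
have S0 : 0 <= S by apply: nneseries_ge0 => k _ _; exact: t0.
have rV0 : 0 <= (r^-1)%:E by rewrite lee_fin invr_ge0 ltW.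
have [n0|n0] := eqVneq (enorm (x - y)%R) 0%R.
  by rewrite /newton n0 mulr0 invr0 adde_ge0.
have np : (0 < enorm (x - y)%R)%R by rewrite lt_neqAle eq_sym n0 enorm_ge0.
have [rn|nr] := ltP r (enorm (x - y)%R).
  apply: (@le_trans _ _ (r^-1)%:E); last exact: leeDl.
  rewrite lee_fin; apply: (le_trans (newton_le _ _)).
  by rewrite lef_pV2 ?posrE// ltW.
have [k /andP[kn nk]] := dyadic np nr.
apply: (@le_trans _ _ S); last exact: leeDr.
have := @nneseries_lim_ge _ _ xpredT _ k.+1 (fun k _ _ => t0 k).
move/(_ 0%N); apply: le_trans; rewrite big_nat_recr//= -[leLHS]add0e; apply: leeD.
  by apply: sume_ge0 => i _; exact: t0.
rewrite indicE mem_set; last exact: in_cube.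
rewrite mule1 lee_fin; apply: (le_trans (newton_le _ _)).
rewrite -[leRHS]invrK lef_pV2 ?posrE// ?invr_gt0 ?divr_gt0 ?exprn_gt0//.
by rewrite invf_div ltW.
Qed.

(** The part near y is O(r^2) for every E, and the rest is proportional to the volume of E. The
    radius r is free: it can be taken small first, and the volume afterwards. *)
Lemma newton_potential_le (r : R) y (E : set (R3 R)) : (0 < r)%R -> measurable E ->
  \int[leb3]_(x in E) (newton y x)%:E <= (32 * r ^+ 2)%:E + (r^-1)%:E * leb3 E.
Proof.
move=> r0 mE.
pose g k (x : R3 R) := (2 ^+ k.+1 / r)%:E * (\1_(cube y (r / 2 ^+ k)) x)%:E.
have g0 k x : 0 <= g k x.
  by rewrite /g -EFinM lee_fin mulr_ge0// divr_ge0// ?exprn_ge0// ltW.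
have mg k : measurable_fun setT (g k).
  apply/measurable_EFinP/measurable_funM => //.
  by apply: measurable_indic; exact: measurable_box.
have mgE k : measurable_fun E (g k) by exact: measurable_funTS.
apply: (@le_trans _ _ (\int[leb3]_(x in E) ((r^-1)%:E + \sum_(k <oo) g k x))).
  apply: ge0_le_integral => //.
  - by move=> x _; rewrite lee_fin newton_ge0.
  - apply/measurable_EFinP/measurable_funTS/measurable_newton => //.
  - apply: emeasurable_funD => //.
    by apply: ge0_emeasurable_sum => // k x _ _; exact: g0.
  - by move=> x _; exact: newton_dyadic.
rewrite ge0_integralD//; last 3 first.
- by move=> x _; rewrite lee_fin invr_ge0 ltW.
- by move=> x _; apply: nneseries_ge0 => k _ _; exact: g0.
- by apply: ge0_emeasurable_sum => // k x _ _; exact: g0.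
have := integral_cst leb3 mE (r^-1)%:E; rewrite /cst => ->.
rewrite addeC; apply: leeD => //.
rewrite integral_nneseries//.
(* The k-th cube contributes 16 r^2 / 4^k, relaxed to 32 r^2 / 2^(k+1), a series with sum 32 r^2. *)
apply: (@le_trans _ _ (\sum_(k <oo) ((32 * r ^+ 2) / (2 ^ k.+1)%:R)%:E)); last first.
  by apply: epsilon_trick0; rewrite mulr_ge0// exprn_ge0// ltW.
apply: lee_nneseries => [k _ _|k _]; first exact: integral_ge0.
rewrite /g ge0_integralZl_EFin//; last 2 first.
- apply/measurable_EFinP/measurable_funTS; apply: measurable_indic.
  exact: measurable_box.
- by rewrite divr_ge0// ?exprn_ge0// ltW.
rewrite integral_indic//; last exact: measurable_box.
apply: (@le_trans _ _ ((2 ^+ k.+1 / r)%:E * leb3 (cube y (r / 2 ^+ k)))).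
  apply: lee_wpmul2l; first by rewrite lee_fin divr_ge0// ?exprn_ge0// ltW.
  by rewrite measureIl//; exact: measurable_box.
rewrite leb3_cube; last by rewrite divr_ge0// ?exprn_ge0// ltW.
have -> : (2 ^ k.+1)%:R = (2 ^+ k.+1)%R :> R by rewrite natrX.
rewrite -EFinM lee_fin exprS.
have p2 : (1 <= 2 ^+ k :> R)%R by rewrite exprn_ege1// ler1n.
have p20 : (0 < 2 ^+ k :> R)%R by exact: lt_le_trans p2.
have -> : (2 * 2 ^+ k / r * (8 * (r / 2 ^+ k) ^+ 3) = 16 * r ^+ 2 / (2 ^+ k) / 2 ^+ k)%R.
  by field; rewrite ?gt_eqF.
have -> : (32 * r ^+ 2 / (2 * 2 ^+ k) = 16 * r ^+ 2 / 2 ^+ k)%R.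
  by field; rewrite ?gt_eqF.
rewrite ler_pdivrMr// ler_peMr// divr_ge0// ?(ltW p20)//.
by rewrite mulr_ge0// exprn_ge0// ltW.
Qed.

Lemma newton_potential_bounded (L : R) : (0 <= L)%R ->
  exists K : R, [/\ (0 <= K)%R & forall y,
    \int[leb3]_(x in cube 0%R L) (newton y x)%:E <= K%:E].
Proof.
move=> L0; exists (32 + 8 * L ^+ 3)%R; split.
  by rewrite addr_ge0// mulr_ge0// exprn_ge0.
move=> y; apply: (le_trans (newton_potential_le y ltr01 (measurable_box _ _))).
by rewrite leb3_cube// -EFinM -EFinD lee_fin invr1 expr1n; lra.
Qed.

Lemma measurable_slab (d : R) (y : R3 R) :
  measurable [set x : R3 R | (`|x.1.1 - y.1.1| < d)%R].
Proof.
have mg : measurable_fun setT (fun x : R3 R => `|x.1.1 - y.1.1|%R).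
  apply: measurableT_comp => //; apply: measurable_funB => //.
  by apply: measurableT_comp => //; exact: measurable_fst.
rewrite [X in measurable X](_ : _ =
    (fun x : R3 R => `|x.1.1 - y.1.1|%R) @^-1` [set` `]-oo, d[]).
  by rewrite -[X in measurable X]setTI; apply: mg => //; exact: measurable_itv.
by apply/seteqP; split => x /=; rewrite in_itv.
Qed.

Lemma newton_potential_slab (L s : R) : (0 <= L)%R -> (0 < s)%R ->
  exists d : R, [/\ (0 < d)%R & forall y,
    \int[leb3]_(x in cube 0%R L `&` [set x | (`|x.1.1 - y.1.1| < d)%R])
      (newton y x)%:E <= s%:E].
Proof.
(* From r <= 1 and r <= s / 64 the near part 32 r^2 is at most s / 2. The slab has volume at most 8
   d L^2, and d makes this at most r s / 2; the summand 1 in [L ^+ 2 + 1] avoids a division by 0. *)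
move=> L0 s0; pose r := (Num.min 1 (s / 64))%R.
have r0 : (0 < r)%R by rewrite lt_min ltr01 divr_gt0.
have r1 : (r <= 1)%R by rewrite ge_min lexx.
have rs : (r <= s / 64)%R by rewrite ge_min lexx orbT.
have L20 : (0 < L ^+ 2 + 1)%R by rewrite ltr_wpDl// sqr_ge0.
pose d := (s * r / (16 * (L ^+ 2 + 1)))%R.
have d0 : (0 < d)%R by rewrite divr_gt0// mulr_gt0.
exists d; split=> // y; set E := (X in \int[_]_(x in X) _).
have mE : measurable E.
  by apply: measurableI; [exact: measurable_box|exact: measurable_slab].
apply: (le_trans (newton_potential_le y r0 mE)).
have lE : leb3 E <= (8 * d * L ^+ 2)%:E.
  apply: (@le_trans _ _ (leb3 (box (y.1.1 - d, - L, - L)%R (y.1.1 + d, L, L)%R))).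
    apply: le_measure; rewrite ?inE//; first exact: measurable_box.
    move=> x [[[/= _ h2] h3] /=]; rewrite ltr_norml => /andP[h4 h5].
    rewrite !in_itv/= !add0r in h2 h3.
    by split; [split|]; rewrite /= in_itv/=; lra.
  by rewrite leb3_box/= ?lee_fin; lra.
apply: (@le_trans _ _ ((32 * r ^+ 2)%:E + (r^-1)%:E * (8 * d * L ^+ 2)%:E)).
  by rewrite leeD2l// lee_wpmul2l// lee_fin invr_ge0 ltW.
rewrite -EFinM -EFinD lee_fin.
have h1 : (32 * r ^+ 2 <= s / 2)%R.
  have : (r ^+ 2 <= r)%R by rewrite expr2 ger_pMr.
  lra.
have -> : (r^-1 * (8 * d * L ^+ 2) = s / 2 * (L ^+ 2 / (L ^+ 2 + 1)))%R.
  by rewrite /d; field; rewrite ?gt_eqF.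
have h2 : (L ^+ 2 / (L ^+ 2 + 1) <= 1)%R by rewrite ler_pdivrMr//; lra.
have : (s / 2 * (L ^+ 2 / (L ^+ 2 + 1)) <= s / 2)%R by rewrite ger_pMr// divr_gt0.
lra.
Qed.

End newton_potential.

(** * Potentials of the composed kernel *)

Section double_potential.
Context (R : realType).
Local Open Scope ereal_scope.
Implicit Types (m : {sigma_finite_measure set (R3 R) -> \bar R}).
Implicit Types (A : set (R3 R * R)) (y z : R3 R).

(* pot m A (z, s) is the mass of A for the measure F(. - s)(x, z), F being the
   kernel of m; dpot m m' y A is the mass of A for the composed kernel. *)
Definition pot m A (p : R3 R * R) : \bar R :=
  \int[m]_x (newton p.1 x * \1_A (x, enorm (x - p.1) + p.2))%:E.

Definition dpot m m' y A : \bar R :=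
  \int[m]_z ((newton y z)%:E * pot m' A (z, enorm (z - y)%R)).

Lemma measurable_incidence d (T : measurableType d) A (x z : T -> R3 R) (s : T -> R) :
  measurable A -> measurable_fun setT x -> measurable_fun setT z ->
  measurable_fun setT s ->
  measurable_fun setT (fun t => (\1_A (x t, enorm (x t - z t) + s t)%R : R)).
Proof.
move=> mA mx mz ms.
have mi : measurable_fun setT (\1_A : R3 R * R -> R) by exact: measurable_indic.
apply: (measurableT_comp mi); apply: measurable_fun_pair => //.
by apply: measurable_funD => //; exact: measurable_enormB.
Qed.

Lemma measurable_pot_integrand A p : measurable A ->
  measurable_fun setT
    (fun x => (newton p.1 x * \1_A (x, enorm (x - p.1) + p.2))%:E : \bar R).
Proof.
move=> mA; apply/measurable_EFinP/measurable_funM; first exact: measurable_newton.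
exact: measurable_incidence.
Qed.

Lemma pot_integrand_ge0 A (p : R3 R * R) x :
  0 <= (newton p.1 x * \1_A (x, enorm (x - p.1) + p.2))%:E.
Proof. by rewrite lee_fin mulr_ge0// newton_ge0. Qed.

Lemma pot_ge0 m A p : 0 <= pot m A p.
Proof. by apply: integral_ge0 => x _; exact: pot_integrand_ge0. Qed.

Lemma measurable_pot m A : measurable A -> measurable_fun setT (pot m A).
Proof.
move=> mA.
pose f (q : (R3 R * R) * R3 R) : \bar R :=
  (newton q.1.1 q.2 * \1_A (q.2, enorm (q.2 - q.1.1) + q.1.2))%:E.
apply: (@measurable_fun_fubini_tonelli_F _ _ _ _ _ m f).
  apply/measurable_EFinP/measurable_funM.
    by apply: measurable_newton => //; apply: measurableT_comp => //; exact: measurable_fst.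
  by apply: measurable_incidence => //; apply: measurableT_comp => //; exact: measurable_fst.
by move=> q; exact: pot_integrand_ge0.
Qed.

Lemma measurable_dpot_integrand m A y : measurable A ->
  measurable_fun setT (fun z => (newton y z)%:E * pot m A (z, enorm (z - y)%R)).
Proof.
move=> mA; apply: emeasurable_funM; first exact/measurable_EFinP/measurable_newton.
apply: (measurableT_comp (measurable_pot m mA)); apply: measurable_fun_pair => //.
exact: measurable_enormB.
Qed.

Lemma dpot_integrand_ge0 m A y z : 0 <= (newton y z)%:E * pot m A (z, enorm (z - y)%R).
Proof. by rewrite mule_ge0 ?pot_ge0// lee_fin newton_ge0. Qed.

Lemma dpot_ge0 m m' y A : 0 <= dpot m m' y A.
Proof. by apply: integral_ge0 => z _; exact: dpot_integrand_ge0. Qed.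

Lemma potU m A B p : measurable A -> measurable B -> A `&` B = set0 ->
  pot m (A `|` B) p = pot m A p + pot m B p.
Proof.
move=> mA mB AB0; rewrite /pot -ge0_integralD//; last 4 first.
- by move=> x _; exact: pot_integrand_ge0.
- exact: measurable_pot_integrand.
- by move=> x _; exact: pot_integrand_ge0.
- exact: measurable_pot_integrand.
apply: eq_integral => x _; rewrite -EFinD -mulrDr; congr (_ * _)%:E.
rewrite !indicE in_setU; set q := (x, _).
have [/set_mem Aq|_] := boolP (q \in A); last by rewrite add0r.
have [/set_mem Bq|_] := boolP (q \in B); last by rewrite addr0.
by have : (A `&` B) q by []; rewrite AB0.
Qed.

Lemma dpotU m m' y A B : measurable A -> measurable B -> A `&` B = set0 ->
  dpot m m' y (A `|` B) = dpot m m' y A + dpot m m' y B.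
Proof.
move=> mA mB AB0; rewrite /dpot -ge0_integralD//; last 4 first.
- by move=> x _; exact: dpot_integrand_ge0.
- exact: measurable_dpot_integrand.
- by move=> x _; exact: dpot_integrand_ge0.
- exact: measurable_dpot_integrand.
by apply: eq_integral => z _; rewrite potU// ge0_muleDr// pot_ge0.
Qed.

Lemma pot_le m A p : measurable A -> pot m A p <= \int[m]_x (newton p.1 x)%:E.
Proof.
move=> mA; apply: ge0_le_integral => //.
- by move=> x _; exact: pot_integrand_ge0.
- exact: measurable_pot_integrand.
- exact/measurable_EFinP/measurable_newton.
- by move=> x _; rewrite lee_fin ler_piMr ?newton_ge0// indicE lern1 leq_b1.
Qed.

Lemma dpot_le m m' (K K' : R) y A : measurable A ->
  \int[m]_z (newton y z)%:E <= K%:E ->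
  (forall z, \int[m']_x (newton z x)%:E <= K'%:E) ->
  dpot m m' y A <= (K * K')%:E.
Proof.
move=> mA mK mK'.
have K'0 : 0 <= K'%:E.
  by apply: le_trans (mK' 0%R); apply: integral_ge0 => x _; rewrite lee_fin newton_ge0.
apply: (@le_trans _ _ (\int[m]_z ((newton y z)%:E * K'%:E))).
  apply: ge0_le_integral => //.
  - by move=> x _; exact: dpot_integrand_ge0.
  - exact: measurable_dpot_integrand.
  - by apply: emeasurable_funM => //; exact/measurable_EFinP/measurable_newton.
  - move=> z _; rewrite lee_wpmul2l ?lee_fin ?newton_ge0//.
    exact: le_trans (pot_le _ _ mA) _.
rewrite ge0_integralZr//; last 2 first.
- exact/measurable_EFinP/measurable_newton.
- by move=> z _; rewrite lee_fin newton_ge0.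
by rewrite EFinM lee_wpmul2r.
Qed.

Section sum_of_measures.
Variables (m a b m' : {sigma_finite_measure set (R3 R) -> \bar R}).
Hypothesis mab : forall E : set (R3 R), measurable E -> m E = a E + b E.

Let integral_sum (f : R3 R -> \bar R) : measurable_fun setT f ->
  (forall x, 0 <= f x) -> \int[m]_x f x = \int[a]_x f x + \int[b]_x f x.
Proof.
move=> mf f0; rewrite -ge0_integral_measure_add//.
by apply: eq_measure_integral => E mE _; apply: (etrans (mab mE)); rewrite -measure_addE.
Qed.

Lemma pot_sum A p : measurable A -> pot m A p = pot a A p + pot b A p.
Proof.
move=> mA; apply: integral_sum; first exact: measurable_pot_integrand.
by move=> x; exact: pot_integrand_ge0.
Qed.

Lemma dpot_suml y A : measurable A -> dpot m m' y A = dpot a m' y A + dpot b m' y A.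
Proof.
move=> mA; apply: integral_sum; first exact: measurable_dpot_integrand.
by move=> x; exact: dpot_integrand_ge0.
Qed.

Lemma dpot_sumr y A : measurable A -> dpot m' m y A = dpot m' a y A + dpot m' b y A.
Proof.
move=> mA; rewrite /dpot -ge0_integralD//; last 4 first.
- by move=> x _; exact: dpot_integrand_ge0.
- exact: measurable_dpot_integrand.
- by move=> x _; exact: dpot_integrand_ge0.
- exact: measurable_dpot_integrand.
by apply: eq_integral => z _; rewrite pot_sum// ge0_muleDr// pot_ge0.
Qed.

End sum_of_measures.

End double_potential.

(** * Translation of the composed kernel of two densities *)

Section line.
Context (R : realType).
Local Open Scope ereal_scope.

(** The strict convexity of rho comes from the first distance alone, whose point is at distance at
    least d from the line; the second one is merely convex. The constant is that of
    [line_dist_midpoint] with [H = 4 * M]. *)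
Lemma line_weighted_shift (a b u v d M C eta h e r : R) (N : nat) (k : R -> R) (A : set R) :
  (0 < d)%R -> (d ^+ 2 <= a)%R -> (0 <= b)%R -> (0 < M)%R ->
  (forall t, - M <= t <= M -> line_dist a u t <= 4 * M)%R ->
  measurable_fun setT k -> (forall t, (0 <= k t <= C)%R) -> (0 <= eta)%R ->
  (0 < h)%R -> (N%:R * h = 2 * M)%R ->
  (forall s t, `|s - t| <= h -> `|k s - k t| <= eta)%R ->
  (0 <= e)%R -> (0 <= r)%R -> (e <= 2 * (d ^+ 2 / (8 * (4 * M) ^+ 3)) * r ^+ 2)%R ->
  measurable A ->
  let rho t := (line_dist a u t + line_dist b v t)%R in
  (forall t, ~ (- M <= t < M)%R -> k t = 0%R) ->
  \int[leb R]_t (k t * \1_A (rho t - e)%R)%:E <=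
  \int[leb R]_t (k t * \1_A (rho t))%:E +
  (N%:R * (2 * eta * h + (C + eta) * (2 * r)))%:E.
Proof.
move=> d0 da b0 M0 uM mk kC eta0 h0 Nh k_osc e0 r0 er mA rho ksupp.
have a0 : (0 <= a)%R by apply: le_trans da; exact: sqr_ge0.
have crho : continuous rho.
  by move=> t; apply: continuousD; exact: continuous_line_dist.
have mrho : measurable_fun setT rho by exact: continuous_measurable_fun.
have k0 t : (0 <= k t)%R by have /andP[] := kC t.
pose c := (d ^+ 2 / (8 * (4 * M) ^+ 3))%R.
have c0 : (0 < c)%R by rewrite divr_gt0 ?exprn_gt0// mulr_gt0// exprn_gt0// mulr_gt0.
have crv s t l : (0 <= l <= 1 -> rho (l * s + (1 - l) * t) <= l * rho s + (1 - l) * rho t)%R.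
  move=> l01; rewrite /rho.
  by have := line_dist_convex u s t a0 l01; have := line_dist_convex v s t b0 l01; lra.
have toset (B : set R) : measurable B ->
    \int[leb R]_t (k t * \1_B t)%:E =
    \int[@lebesgue_measure R]_(t in `[(- M)%R, M[ `&` B) (k t)%:E.
  move=> mB; rewrite -integral_leb; last 3 first.
  - by apply: measurableI => //; exact: measurable_itv.
  - exact/measurable_EFinP/measurable_funTS.
  - by move=> t; rewrite lee_fin.
  rewrite [RHS]integral_mkcond; apply: eq_integral => t _; rewrite /patch indicE in_setI.
  case: (boolP (t \in B)) => tB; last by rewrite andbF mulr0.
  rewrite andbT mulr1; case: ifPn => // /negP tM; rewrite ksupp// => tM'; apply: tM.
  by rewrite inE /= in_itv.
have mAe : measurable [set t | A (rho t - e)%R].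
  have mre : measurable_fun setT (fun t => rho t - e)%R by exact: measurable_funB.
  by rewrite -[X in measurable X]setTI; exact: mre.
have mA0 : measurable [set t | A (rho t)].
  by rewrite -[X in measurable X]setTI; exact: mrho.
have -> : \int[leb R]_t (k t * \1_A (rho t - e)%R)%:E =
    \int[@lebesgue_measure R]_(t in `[(- M)%R, M[ `&` [set t | A (rho t - e)%R]) (k t)%:E.
  by rewrite -toset.
have -> : \int[leb R]_t (k t * \1_A (rho t))%:E =
    \int[@lebesgue_measure R]_(t in `[(- M)%R, M[ `&` [set t | A (rho t)]) (k t)%:E.
  by rewrite -toset.
apply: (@weighted_level_shift R rho c crho c0 crv k C eta mk k0 _ eta0 (- M)%R h e r N A
  mA h0 e0 r0 er k_osc _ M).
- by move=> t; have /andP[] := kC t.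
- move=> s t; rewrite Nh => sM tM; rewrite /rho.
  have M4 : (0 < 4 * M)%R by rewrite mulr_gt0.
  have h1 := @line_dist_midpoint R a u s t (d ^+ 2)%R (4 * M)%R M4 (sqr_ge0 _) da.
  have := h1 (uM s _) (uM t _); rewrite -/c.
  have := @line_dist_convex R b v s t 2^-1 b0.
  have -> : (2^-1 * s + (1 - 2^-1) * t = (s + t) / 2)%R by field.
  move=> /(_ ltac:(lra)) h2 /(_ ltac:(lra) ltac:(lra)); lra.
- by rewrite Nh; lra.
Qed.

End line.

Section kernel_on_line.
Context (R : realType).
Implicit Types (x y z : R3 R) (d : R).

(** The constant 4 rounds up 2 sqrt 3. *)
Lemma norm_bound (p q w m : R) : - (2 * m) <= p <= 2 * m -> - (2 * m) <= q <= 2 * m ->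
  - (2 * m) <= w <= 2 * m -> Num.sqrt (p ^+ 2 + q ^+ 2 + w ^+ 2) <= 4 * m.
Proof.
move=> pm qm wm; have sq_le a : - (2 * m) <= a <= 2 * m -> a ^+ 2 <= (2 * m) ^+ 2.
  by move=> am; rewrite -real_normK ?num_real// ler_pXn2r ?nnegrE// ?ler_norml//; lra.
have q1 := sq_le p pm; have q2 := sq_le q qm; have q3 := sq_le w wm.
rewrite -[leRHS]ger0_norm; last by lra.
rewrite -sqrtr_sqr; apply: ler_wsqrtr; have := sqr_ge0 (2 * m); lra.
Qed.

Lemma newton_far d y x : 0 < d -> d <= `|x.1.1 - y.1.1| -> newton y x <= d^-1.
Proof.
move=> d0 dx; apply: (le_trans (newton_le _ _)).
have [h _ _] := coord_le_enorm (x - y)%R.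
have dn := le_trans dx h.
by rewrite lef_pV2 ?posrE//; exact: lt_le_trans dn.
Qed.

Lemma newton_lipschitz d (p q : R) : 0 < d -> d <= p -> d <= q ->
  `|(4 * pi * p)^-1 - (4 * pi * q)^-1| <= d^-1 ^+ 2 * `|p - q|.
Proof.
move=> d0 dp dq; have p0 := lt_le_trans d0 dp; have q0 := lt_le_trans d0 dq.
have pi0 : 0 < pi :> R by exact: pi_gt0.
have pi4 : 1 <= 4 * pi :> R by have := @pi_ge2 R; lra.
have -> : (4 * pi * p)^-1 - (4 * pi * q)^-1 = (4 * pi * (p * q))^-1 * (q - p).
  move: (pi : R) pi0 => P P0; field.
  by rewrite (gt_eqF P0) (gt_eqF p0) (gt_eqF q0).
rewrite normrM distrC ler_wpM2r// ger0_norm; last first.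
  by rewrite invr_ge0 !mulr_ge0// ltW.
rewrite exprVn lef_pV2 ?posrE ?exprn_gt0 ?mulr_gt0//.
apply: (@le_trans _ _ (p * q)); first by rewrite expr2 ler_pM// ltW.
by rewrite ler_peMl// mulr_ge0// ltW.
Qed.

Lemma enorm_line_l x (z' : R * R) (t : R) :
  enorm (x - (z', t))%R = line_dist ((x.1.1 - z'.1) ^+ 2 + (x.1.2 - z'.2) ^+ 2) x.2 t.
Proof. by []. Qed.

Lemma enorm_line_r y (z' : R * R) (t : R) :
  enorm ((z', t) - y)%R = line_dist ((z'.1 - y.1.1) ^+ 2 + (z'.2 - y.1.2) ^+ 2) y.2 t.
Proof. by rewrite /enorm /line_dist /=; congr (Num.sqrt (_ + _)); ring. Qed.

Lemma newton_line_l d x (z' : R * R) s t : 0 < d -> d <= `|x.1.1 - z'.1| ->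
  `|newton (z', s) x - newton (z', t) x| <= d^-1 ^+ 2 * `|s - t|.
Proof.
move=> d0 dx; have far u : d <= enorm (x - (z', u))%R.
  by have [h _ _] := coord_le_enorm (x - (z', u))%R; exact: le_trans h.
apply: (le_trans (newton_lipschitz d0 (far s) (far t))).
rewrite ler_wpM2l ?sqr_ge0// !enorm_line_l; apply: line_dist_lipschitz.
by rewrite addr_ge0// sqr_ge0.
Qed.

Lemma newton_line_r d y (z' : R * R) s t : 0 < d -> d <= `|z'.1 - y.1.1| ->
  `|newton y (z', s) - newton y (z', t)| <= d^-1 ^+ 2 * `|s - t|.
Proof.
move=> d0 dx; have far u : d <= enorm ((z', u) - y)%R.
  by have [h _ _] := coord_le_enorm ((z', u) - y)%R; exact: le_trans h.
apply: (le_trans (newton_lipschitz d0 (far s) (far t))).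
rewrite ler_wpM2l ?sqr_ge0// !enorm_line_r; apply: line_dist_lipschitz.
by rewrite addr_ge0// sqr_ge0.
Qed.

End kernel_on_line.

Section translation.
Context (R : realType).
Variables (f g : R3 R -> R) (L C : R).
Hypotheses (L0 : 0 < L) (C0 : 0 < C).
Hypotheses (mf : measurable_fun setT f) (mg : measurable_fun setT g).
Hypotheses (f0 : forall x, 0 <= f x <= C) (g0 : forall x, 0 <= g x <= C).
Hypotheses (fsupp : forall x, ~ cube 0 L x -> f x = 0).
Hypotheses (gsupp : forall x, ~ cube 0 L x -> g x = 0).
(** Of the two densities, f is the one evaluated at the moving point z; g is evaluated at x, which
    stays fixed. *)
Hypothesis f_uc : forall w : R, 0 < w -> exists2 h : R, 0 < h &
  forall (z' : R * R) s t, `|s - t| <= h -> `|f (z', s) - f (z', t)| <= w.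

(** The margin makes the half-open interval [-M, M[, which is cut into cells, contain the closed
    interval [-L, L]. *)
Let M := L + 1.

(* When z moves parallel to the third axis, a separation of the first coordinates
   keeps |x - z| uniformly strictly convex and the kernels bounded. *)
Definition separated (d : R) (y z x : R3 R) :=
  (d <= `|x.1.1 - z.1.1|) && (d <= `|z.1.1 - y.1.1|).

Definition weight (y z x : R3 R) := f z * newton y z * (g x * newton z x).

(** For d = 0 the condition is empty and this is [weight]; the same integrand thus serves for the
    full and for the truncated mass. *)
Definition sep_weight d y z x := (separated d y z x)%:R * weight y z x.

Let fC x : f x <= C. Proof. by have /andP[] := f0 x. Qed.
Let gC x : g x <= C. Proof. by have /andP[] := g0 x. Qed.
Let fge0 x : 0 <= f x. Proof. by have /andP[] := f0 x. Qed.
Let gge0 x : 0 <= g x. Proof. by have /andP[] := g0 x. Qed.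

Lemma weight_ge0 y z x : 0 <= weight y z x.
Proof. by rewrite /weight !mulr_ge0// newton_ge0. Qed.

Lemma sep_weight_ge0 d y z x : 0 <= sep_weight d y z x.
Proof. by rewrite mulr_ge0// weight_ge0. Qed.

Lemma sep_weight_le d y z x : sep_weight d y z x <= weight y z x.
Proof. by rewrite ler_piMl ?weight_ge0// lern1 leq_b1. Qed.

Lemma sep_weight_bound d y z x : 0 < d -> sep_weight d y z x <= C ^+ 2 * d^-1 ^+ 2.
Proof.
move=> d0; rewrite /sep_weight /separated.
have [/andP[h1 h2]|_] := boolP (_ && _); last first.
  by rewrite mul0r mulr_ge0// sqr_ge0.
rewrite mul1r /weight.
have -> : C ^+ 2 * d^-1 ^+ 2 = (C * d^-1) * (C * d^-1) by ring.
by rewrite ler_pM ?mulr_ge0 ?newton_ge0// ler_pM ?newton_ge0// newton_far.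
Qed.

(** The cut-off is constant along the line, since [separated] ignores the third coordinates. The
    remaining product is telescoped, one factor at a time. *)
Lemma sep_weight_osc d y (z' : R * R) x s t w : 0 < d ->
  `|f (z', s) - f (z', t)| <= w ->
  `|sep_weight d y (z', s) x - sep_weight d y (z', t) x| <=
    C * (w * d^-1 ^+ 2 + 2 * C * d^-1 ^+ 3 * `|s - t|).
Proof.
move=> d0 fw; have w0 : 0 <= w by exact: le_trans fw.
have D0 : 0 < d^-1 by rewrite invr_gt0.
have st0 : 0 <= `|s - t| by [].
rewrite /sep_weight /separated /=.
have [/andP[h1 h2]|_] := boolP (_ && _); last first.
  rewrite !mul0r subrr normr0 mulr_ge0 ?(ltW C0)// addr_ge0//.
    by rewrite mulr_ge0// sqr_ge0.
  by rewrite !mulr_ge0 ?exprn_ge0// ltW.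
rewrite !mul1r /weight.
have l1 := newton_line_l s t d0 h1; have l2 := newton_line_r s t d0 h2.
have b1 u : 0 <= newton (z', u) x <= d^-1 by rewrite newton_ge0 newton_far.
have b2 u : 0 <= newton y (z', u) <= d^-1 by rewrite newton_ge0 newton_far.
have := b1 s; have := b1 t; have := b2 s; have := b2 t.
have := f0 (z', t); have := f0 (z', s); have := g0 x; move: l1 l2 fw.
move: (newton (z', s) x) (newton (z', t) x) (newton y (z', s)) (newton y (z', t))
  (f (z', s)) (f (z', t)) (g x) => n1 n2 m1 m2 a1 a2 G.
set D := d^-1 in D0 *; set e := `|s - t| in st0 *.
move=> l1 l2 fw /andP[G0 GC] /andP[a10 a1C] /andP[a20 a2C].
move=> /andP[m20 m2D] /andP[m10 m1D] /andP[n20 n2D] /andP[n10 n1D].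
have -> : a1 * m1 * (G * n1) - a2 * m2 * (G * n2) =
  G * ((a1 - a2) * (m1 * n1) + a2 * ((m1 - m2) * n1) + a2 * (m2 * (n1 - n2))) by ring.
rewrite normrM (ger0_norm G0) ler_pM//.
have e1 : `|(a1 - a2) * (m1 * n1)| <= w * D ^+ 2.
  by rewrite normrM ler_pM// ger0_norm ?mulr_ge0// expr2 ler_pM.
have e2 : `|a2 * ((m1 - m2) * n1)| <= C * (D ^+ 2 * e * D).
  by rewrite normrM (ger0_norm a20) ler_pM// normrM (ger0_norm n10) ler_pM.
have e3 : `|a2 * (m2 * (n1 - n2))| <= C * (D * (D ^+ 2 * e)).
  by rewrite normrM (ger0_norm a20) ler_pM// normrM (ger0_norm m20) ler_pM.
apply: (le_trans (ler_normD _ _)); apply: (le_trans (lerD (ler_normD _ _) (lexx _))).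
have -> : 2 * C * D ^+ 3 * e = C * (D ^+ 2 * e * D) + C * (D * (D ^+ 2 * e)) by ring.
lra.
Qed.

Lemma measurable_far d dT (T : measurableType dT) (h k : T -> R3 R) :
  measurable_fun setT h -> measurable_fun setT k ->
  measurable_fun setT (fun t => (d <= `|(h t).1.1 - (k t).1.1|)%R%:R : R).
Proof.
move=> mh mk.
have coord1 (u : T -> R3 R) : measurable_fun setT u -> measurable_fun setT (fun t => (u t).1.1).
  move=> mu; apply: measurableT_comp; first exact: measurable_fst.
  exact: measurableT_comp mu.
rewrite (_ : (fun _ => _) = \1_(`[d, +oo[%classic : set R) \o
    (fun t => `|(h t).1.1 - (k t).1.1|)); last first.
  apply/funext => t /=; rewrite indicE; congr ((nat_of_bool _)%:R).
  by apply/idP/idP; rewrite inE /= in_itv/= andbT.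
apply: measurableT_comp; first by apply: measurable_indic; exact: measurable_itv.
apply: measurableT_comp => //.
by apply: measurable_funB; apply: coord1.
Qed.

Lemma measurable_sep_weight d y dT (T : measurableType dT) (z x : T -> R3 R) :
  measurable_fun setT z -> measurable_fun setT x ->
  measurable_fun setT (fun t => sep_weight d y (z t) (x t)).
Proof.
move=> mz mx.
rewrite (_ : (fun t => _) = (fun t => (d <= `|(x t).1.1 - (z t).1.1|)%R%:R *
   (d <= `|(z t).1.1 - y.1.1|)%R%:R * (f (z t) * newton y (z t) * (g (x t) * newton (z t) (x t))))).
  apply: measurable_funM; first by apply: measurable_funM; exact: measurable_far.
  apply: measurable_funM; apply: measurable_funM; try exact: measurable_newton.
    exact: (measurableT_comp mf mz).
  exact: (measurableT_comp mg mx).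
by apply/funext => t; rewrite /sep_weight /separated -mulnb natrM.
Qed.

Definition shift_set (e : R) (A : set (R3 R * R)) := [set q : R3 R * R | A (q.1, q.2 - e)].

Lemma measurable_shift_set e A : measurable A -> measurable (shift_set e A).
Proof.
move=> mA; have ms : measurable_fun setT (fun q : R3 R * R => (q.1, q.2 - e)).
  apply: measurable_fun_pair; first exact: measurable_fst.
  by apply: measurable_funB => //; exact: measurable_snd.
by rewrite -[X in measurable X]setTI; exact: ms.
Qed.

Local Open Scope ereal_scope.

Let sq : set (R * R)%type := `[(- L)%R, L] `*` `[(- L)%R, L].

Let msq : measurable sq.
Proof. by apply: measurableX; exact: measurable_itv. Qed.

Let leb2_sq : leb2 R sq = ((2 * L) ^+ 2)%:E.
Proof.
have l : leb R `[(- L)%R, L]%classic = (2 * L)%:E.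
  rewrite [LHS](_ : _ = @lebesgue_measure R `[(- L)%R, L]%classic)// lebesgue_measure_itv/=.
  by rewrite lte_fin gtrN// -EFinD; congr EFin; ring.
by rewrite leb2X ?expr2 ?EFinM ?l//; exact: measurable_itv.
Qed.

(** The inner variable is z, contrary to [dpot]: once x and y are fixed, z can run along lines.
    [dpot_shift] exchanges the two integrals. *)
Definition sep_mass d y A := \int[leb3 R]_x \int[leb3 R]_z
  (sep_weight d y z x * \1_A (x, enorm (x - z) + enorm (z - y))%R)%:E.

(** The weight vanishes on the lines that miss the supports, so that the error can carry the
    indicators of the cube and of the square; this keeps its integral over x and z' finite. *)
Let line_error d y (h w r eta : R) (N : nat) A e (x : R3 R) (z' : R * R) :
  (0 < d)%R -> (0 < h)%R -> (0 < w)%R -> (0 <= r)%R -> (N%:R * h = 2 * M)%R ->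
  (forall s t, `|s - t| <= h -> `|f (z', s) - f (z', t)| <= w)%R ->
  measurable A -> (0 <= e <= 2 * (d ^+ 2 / (8 * (4 * M) ^+ 3)) * r ^+ 2)%R ->
  eta = (C * (w * d^-1 ^+ 2 + 2 * C * d^-1 ^+ 3 * h))%R ->
  \int[leb R]_t (sep_weight d y (z', t) x *
     \1_(shift_set e A) (x, enorm (x - (z', t)) + enorm ((z', t) - y))%R)%:E <=
  \int[leb R]_t (sep_weight d y (z', t) x *
     \1_A (x, enorm (x - (z', t)) + enorm ((z', t) - y))%R)%:E +
  (N%:R * (2 * eta * h + (C ^+ 2 * d^-1 ^+ 2 + eta) * (2 * r)) * (\1_(cube 0%R L) x * \1_sq z'))%:E.
Proof.
move=> d0 h0 w0 r0 Nh fh mA /andP[e0 er] etaE.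
have D0 : (0 < d^-1)%R by rewrite invr_gt0.
have eta0 : (0 <= eta)%R.
  by rewrite etaE mulr_ge0 ?(ltW C0)// addr_ge0// !mulr_ge0 ?exprn_ge0// ltW.
have err0 : (0 <= N%:R * (2 * eta * h + (C ^+ 2 * d^-1 ^+ 2 + eta) * (2 * r)))%R.
  rewrite mulr_ge0// addr_ge0// ?mulr_ge0// ?(ltW h0)//.
  by rewrite addr_ge0// mulr_ge0// exprn_ge0// ltW.
have trivial_case : (forall t, sep_weight d y (z', t) x = 0%R) ->
  \int[leb R]_t (sep_weight d y (z', t) x *
     \1_(shift_set e A) (x, enorm (x - (z', t)) + enorm ((z', t) - y))%R)%:E <=
  \int[leb R]_t (sep_weight d y (z', t) x *
     \1_A (x, enorm (x - (z', t)) + enorm ((z', t) - y))%R)%:E +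
  (N%:R * (2 * eta * h + (C ^+ 2 * d^-1 ^+ 2 + eta) * (2 * r)) * (\1_(cube 0%R L) x * \1_sq z'))%:E.
  move=> k0; under eq_integral do rewrite k0 mul0r.
  under [in leRHS]eq_integral do rewrite k0 mul0r.
  by rewrite integral0 add0e lee_fin !indicE -natrM mulr_ge0.
have [xQ|xQ] := pselect (cube 0%R L x); last first.
  by apply: trivial_case => t; rewrite /sep_weight /weight gsupp// mul0r !mulr0.
have [zQ|zQ] := pselect (sq z'); last first.
  apply: trivial_case => t; rewrite /sep_weight /weight fsupp ?mul0r ?mulr0//.
  by move=> [/= + _]; rewrite !sub0r !add0r; exact: zQ.
(* The third coordinate [x.2] is a placeholder: the condition does not see it. *)
have [/andP[s1 s2]|ns] := boolP (separated d y (z', x.2) x); last first.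
  by apply: trivial_case => t; rewrite /sep_weight [separated _ _ _ _](negbTE ns) mul0r.
rewrite !indicE (mem_set xQ) (mem_set zQ) !mulr1.
have Ax : measurable [set s | A (x, s)].
  have mp : measurable_fun setT (fun s : R => (x, s)) by exact: measurable_fun_pair.
  by rewrite -[X in measurable X]setTI; exact: mp.
have M0 : (0 < M)%R by rewrite /M addr_gt0.
set a := ((x.1.1 - z'.1) ^+ 2 + (x.1.2 - z'.2) ^+ 2)%R.
set b := ((z'.1 - y.1.1) ^+ 2 + (z'.2 - y.1.2) ^+ 2)%R.
have da : (d ^+ 2 <= a)%R.
  apply: (@le_trans _ _ ((x.1.1 - z'.1) ^+ 2)%R); last by rewrite lerDl sqr_ge0.
  by rewrite -(real_normK (num_real (x.1.1 - z'.1)%R)) ler_pXn2r// ?nnegrE// ltW.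
have b0 : (0 <= b)%R by rewrite addr_ge0// sqr_ge0.
case: (xQ) => -[/=]; rewrite !in_itv/= !sub0r !add0r => x1 x2 x3.
case: (zQ) => /=; rewrite !in_itv/= => z1 z2.
have uM t : (- M <= t <= M -> line_dist a x.2 t <= 4 * M)%R.
  by move=> tM; apply: norm_bound; rewrite /M in tM *; lra.
have -> : (fun t => (sep_weight d y (z', t) x *
     \1_(shift_set e A) (x, enorm (x - (z', t)) + enorm ((z', t) - y))%R)%:E) =
  (fun t => (sep_weight d y (z', t) x *
     \1_[set s | A (x, s)] (line_dist a x.2 t + line_dist b y.2 t - e)%R)%:E).
  apply/funext => t; congr (_ * _)%:E.
  by rewrite enorm_line_l enorm_line_r.
have -> : (fun t => (sep_weight d y (z', t) x *
     \1_A (x, enorm (x - (z', t)) + enorm ((z', t) - y))%R)%:E) =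
  (fun t => (sep_weight d y (z', t) x *
     \1_[set s | A (x, s)] (line_dist a x.2 t + line_dist b y.2 t)%R)%:E).
  apply/funext => t; congr (_ * _)%:E.
  by rewrite enorm_line_l enorm_line_r.
apply: (@line_weighted_shift R a b x.2 y.2 d M _ eta h e r N _ _ d0 da b0 M0 uM) => //.
- by apply: measurable_sep_weight => //; exact: measurable_fun_pair.
- by move=> t; rewrite sep_weight_ge0 sep_weight_bound.
- move=> s t st; apply: (le_trans (sep_weight_osc y x d0 (fh s t st))).
  rewrite etaE ler_wpM2l ?(ltW C0)// lerD2l ler_wpM2l//.
  by rewrite !mulr_ge0 ?exprn_ge0// ltW.
- move=> t tM; rewrite /sep_weight /weight fsupp ?mul0r ?mulr0//.
  by move=> [_ /=]; rewrite in_itv/= sub0r add0r => tL; apply: tM; rewrite /M; lra.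
Qed.

Let sep_integrand d y A (x z : R3 R) : \bar R :=
  (sep_weight d y z x * \1_A (x, enorm (x - z) + enorm (z - y))%R)%:E.

Let sep_integrand_ge0 d y A x z : 0 <= sep_integrand d y A x z.
Proof. by rewrite lee_fin mulr_ge0// sep_weight_ge0. Qed.

Let measurable_sep_integrand d y A dT (T : measurableType dT) (x z : T -> R3 R) :
  measurable A -> measurable_fun setT x -> measurable_fun setT z ->
  measurable_fun setT (fun t => sep_integrand d y A (x t) (z t)).
Proof.
move=> mA mx mz; apply/measurable_EFinP/measurable_funM; first exact: measurable_sep_weight.
by apply: measurable_incidence => //; exact: measurable_enormB.
Qed.

Let inner_shift d y (h w r eta : R) (N : nat) A e (x : R3 R) :
  (0 < d)%R -> (0 < h)%R -> (0 < w)%R -> (0 <= r)%R -> (N%:R * h = 2 * M)%R ->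
  (forall z' s t, `|s - t| <= h -> `|f (z', s) - f (z', t)| <= w)%R ->
  measurable A -> (0 <= e <= 2 * (d ^+ 2 / (8 * (4 * M) ^+ 3)) * r ^+ 2)%R ->
  eta = (C * (w * d^-1 ^+ 2 + 2 * C * d^-1 ^+ 3 * h))%R -> (0 <= eta)%R ->
  \int[leb3 R]_z sep_integrand d y (shift_set e A) x z <=
  \int[leb3 R]_z sep_integrand d y A x z +
  ((2 * L) ^+ 2 * (N%:R * (2 * eta * h + (C ^+ 2 * d^-1 ^+ 2 + eta) * (2 * r))) *
    \1_(cube 0%R L) x)%:E.
Proof.
move=> d0 h0 w0 r0 Nh fh mA er etaE eta0.
have mAe := measurable_shift_set e mA.
set err := (N%:R * _)%R.
have err0 : (0 <= err)%R.
  rewrite mulr_ge0// addr_ge0// ?mulr_ge0// ?(ltW h0)//.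
  by rewrite addr_ge0// mulr_ge0// exprn_ge0// ?invr_ge0 ltW.
have fubini B : measurable B -> \int[leb3 R]_z sep_integrand d y B x z =
    \int[leb2 R]_z' \int[leb R]_t sep_integrand d y B x (z', t).
  move=> mB; apply: (@fubini_tonelli1 _ _ _ _ _ (leb2 R) (leb R) (sep_integrand d y B x)) => //.
  by apply: (@measurable_sep_integrand d y B _ _ (cst x) id).
rewrite !fubini//.
apply: (@le_trans _ _ (\int[leb2 R]_z' (\int[leb R]_t sep_integrand d y A x (z', t) +
    (err * (\1_(cube 0%R L) x * \1_sq z'))%:E))).
  apply: ge0_le_integral => //.
  - by move=> z' _; apply: integral_ge0.
  - apply: (@measurable_fun_fubini_tonelli_F _ _ _ _ _ (leb R)
      (sep_integrand d y (shift_set e A) x)) => //.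
    by apply: (@measurable_sep_integrand d y (shift_set e A) _ _ (cst x) id).
  - apply: emeasurable_funD.
      apply: (@measurable_fun_fubini_tonelli_F _ _ _ _ _ (leb R) (sep_integrand d y A x)) => //.
      by apply: (@measurable_sep_integrand d y A _ _ (cst x) id).
    by apply/measurable_EFinP/measurable_funM => //; apply: measurable_funM.
  - by move=> z' _; exact: (@line_error d y h w r eta N A e x z' d0 h0 w0 r0 Nh (fh z') mA er etaE).
rewrite ge0_integralD//; last 4 first.
- by move=> z' _; exact: integral_ge0.
- apply: (@measurable_fun_fubini_tonelli_F _ _ _ _ _ (leb R) (sep_integrand d y A x)) => //.
  by apply: (@measurable_sep_integrand d y A _ _ (cst x) id).
- by move=> z' _; rewrite lee_fin !indicE -natrM mulr_ge0.
- by apply/measurable_EFinP/measurable_funM => //; apply: measurable_funM.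
rewrite leeD2l//.
under eq_integral do rewrite mulrA EFinM.
rewrite ge0_integralZl_EFin//; last 2 first.
- by apply/measurable_EFinP; exact: measurable_indic.
- by rewrite mulr_ge0// indicE.
apply: (@le_trans _ _ ((err * \1_(cube 0%R L) x)%:E * leb2 R sq)).
  by rewrite integral_indic// setIT.
by rewrite leb2_sq -EFinM lee_fin mulrC mulrA.
Qed.

Lemma sep_mass_shift (d s : R) : (0 < d)%R -> (0 < s)%R -> exists2 e0 : R, (0 < e0)%R &
  forall y A e, measurable A -> (0 <= e <= e0)%R ->
    sep_mass d y (shift_set e A) <= sep_mass d y A + s%:E.
Proof.
move=> d0 s0; have M0 : (0 < M)%R by rewrite /M addr_gt0.
have D0 : (0 < d^-1)%R by rewrite invr_gt0.
(* [V] is the area of the square of the z' times the volume of the cube of the x. As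
   [N * h = 2 * M], the total error is [4 * M * eta * V + 2 * N * B * r * V]; [eta1] and [r] make
   each term at most s / 2. N depends on h, so that r comes last. *)
pose V := ((2 * L) ^+ 2 * (8 * L ^+ 3))%R.
have V0 : (0 < V)%R by rewrite !mulr_gt0 ?exprn_gt0 ?mulr_gt0.
pose eta1 := (s / (8 * M * V))%R.
have eta10 : (0 < eta1)%R by rewrite divr_gt0// !mulr_gt0.
(* [w] and [h1] each make one of the two terms of the oscillation [eta] at most [eta1 / 2]. *)
pose w := (eta1 / (2 * C * d^-1 ^+ 2))%R.
have w0 : (0 < w)%R by rewrite divr_gt0// !mulr_gt0// exprn_gt0.
pose h1 := (eta1 / (4 * C ^+ 2 * d^-1 ^+ 3))%R.
have h10 : (0 < h1)%R by rewrite divr_gt0// !mulr_gt0// exprn_gt0.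
have [h2 h20 fh2] := f_uc w0.
pose h3 := Num.min h1 h2.
have h30 : (0 < h3)%R by rewrite lt_min h10 h20.
pose N := (Num.truncn (2 * M / h3)).+1.
have N0 : (0 < N%:R :> R)%R by rewrite ltr0n.
pose h := (2 * M / N%:R)%R.
have h0 : (0 < h)%R by rewrite divr_gt0// mulr_gt0.
have hh3 : (h <= h3)%R.
  rewrite /h ler_pdivrMr// (mulrC h3) -ler_pdivrMr//; apply: ltW.
  exact: truncnS_gt.
have Nh : (N%:R * h = 2 * M)%R by rewrite /h mulrC divfK// gt_eqF.
have fh (z' : R * R) p q : (`|p - q| <= h -> `|f (z', p) - f (z', q)| <= w)%R.
  move=> pq; apply: fh2; apply: (le_trans pq); apply: (le_trans hh3).
  by rewrite ge_min lexx orbT.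
pose eta := (C * (w * d^-1 ^+ 2 + 2 * C * d^-1 ^+ 3 * h))%R.
have D20 : (0 < d^-1 ^+ 2)%R by exact: exprn_gt0.
have D30 : (0 < d^-1 ^+ 3)%R by exact: exprn_gt0.
have eta0 : (0 < eta)%R.
  apply: mulr_gt0 => //; apply: addr_gt0; first exact: mulr_gt0.
  by apply: mulr_gt0 => //; apply: mulr_gt0 => //; apply: mulr_gt0.
have etale : (eta <= eta1)%R.
  have e1 : (C * (w * d^-1 ^+ 2) = eta1 / 2)%R.
    by rewrite /w; field; rewrite ?invr_eq0 !gt_eqF.
  have e2 : (C * (2 * C * d^-1 ^+ 3 * h1) = eta1 / 2)%R.
    by rewrite /h1; field; rewrite ?invr_eq0 !gt_eqF.
  have hh1 : (h <= h1)%R by apply: (le_trans hh3); rewrite ge_min lexx.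
  have e3 : (C * (2 * C * d^-1 ^+ 3 * h) <= C * (2 * C * d^-1 ^+ 3 * h1))%R.
    rewrite ler_pM2l//; apply: ler_wpM2l => //; apply: mulr_ge0; last exact: ltW.
    by apply: mulr_ge0 => //; exact: ltW.
  by rewrite /eta mulrDr e1; move: e3; rewrite e2; lra.
pose B := (C ^+ 2 * d^-1 ^+ 2 + eta)%R.
have B0 : (0 < B)%R by apply: addr_gt0 => //; apply: mulr_gt0 => //; exact: exprn_gt0.
pose r := (s / (4 * N%:R * B * V))%R.
have r0 : (0 < r)%R by rewrite divr_gt0// !mulr_gt0.
exists (2 * (d ^+ 2 / (8 * (4 * M) ^+ 3)) * r ^+ 2)%R.
  by rewrite mulr_gt0 ?exprn_gt0// mulr_gt0// divr_gt0 ?exprn_gt0// mulr_gt0// exprn_gt0// mulr_gt0.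
move=> y A e mA e0; have mAe := measurable_shift_set e mA.
set err := ((2 * L) ^+ 2 * (N%:R * (2 * eta * h + B * (2 * r))))%R.
have err0 : (0 <= err)%R.
  apply: mulr_ge0; first exact: sqr_ge0.
  apply: mulr_ge0 => //; apply: addr_ge0.
    by apply: mulr_ge0; [apply: mulr_ge0 => //|]; exact: ltW.
  by apply: mulr_ge0; [|apply: mulr_ge0 => //]; exact: ltW.
have errV : (err * (8 * L ^+ 3) <= s)%R.
  have -> : (err * (8 * L ^+ 3) = 2 * eta * (N%:R * h) * V + N%:R * B * (2 * r) * V)%R.
    by rewrite /err /V; ring.
  have -> : (N%:R * B * (2 * r) * V = s / 2)%R by rewrite /r; field; rewrite !gt_eqF.
  have : (2 * eta * (2 * M) * V <= 2 * eta1 * (2 * M) * V)%R.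
    by rewrite !ler_pM2r ?ler_pM2l// mulr_gt0.
  have -> : (2 * eta1 * (2 * M) * V = s / 2)%R by rewrite /eta1; field; rewrite !gt_eqF.
  rewrite Nh; lra.
have mint E : measurable E -> measurable_fun setT (fun x => \int[leb3 R]_z sep_integrand d y E x z).
  move=> mE; apply: (@measurable_fun_fubini_tonelli_F _ _ _ _ _ (leb3 R)
    (fun q => sep_integrand d y E q.1 q.2)) => //.
  by apply: (@measurable_sep_integrand d y E _ _ fst snd).
apply: (@le_trans _ _ (\int[leb3 R]_x (\int[leb3 R]_z sep_integrand d y A x z +
    (err * \1_(cube 0%R L) x)%:E))).
  apply: ge0_le_integral => //.
  - by move=> x _; apply: integral_ge0 => z _; exact: sep_integrand_ge0.
  - exact: mint.
  - apply: emeasurable_funD; first exact: mint.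
    by apply/measurable_EFinP/measurable_funM => //; apply: measurable_indic; exact: measurable_box.
  - by move=> x _; exact: (@inner_shift d y h w r eta N A e x d0 h0 w0 (ltW r0) Nh fh mA e0 erefl (ltW eta0)).
rewrite ge0_integralD//; last 4 first.
- by move=> x _; apply: integral_ge0 => z _; exact: sep_integrand_ge0.
- exact: mint.
- by move=> x _; rewrite lee_fin mulr_ge0// indicE.
- by apply/measurable_EFinP/measurable_funM => //; apply: measurable_indic; exact: measurable_box.
rewrite leeD2l//; under eq_integral do rewrite EFinM.
rewrite ge0_integralZl_EFin//; last first.
  by apply/measurable_EFinP; apply: measurable_indic; exact: measurable_box.
apply: (@le_trans _ _ (err%:E * leb3 R (cube 0%R L))).
  by rewrite integral_indic ?setIT//; exact: measurable_box.
by rewrite leb3_cube ?(ltW L0)// -EFinM lee_fin.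
Qed.

Let near d (x z : R3 R) : R := (1 - (d <= `|x.1.1 - z.1.1|)%R%:R)%R.

Let near_ge0 d x z : (0 <= near d x z)%R.
Proof. by rewrite subr_ge0 lern1 leq_b1. Qed.

Let measurable_near d dT (T : measurableType dT) (x z : T -> R3 R) :
  measurable_fun setT x -> measurable_fun setT z ->
  measurable_fun setT (fun t => near d (x t) (z t)).
Proof. by move=> mx mz; apply: measurable_funB => //; exact: measurable_far. Qed.

(** With a and b the indicators of the two conditions in [separated],
    [1 <= a * b + (1 - a) + (1 - b)]. Each defect is attached to the Newton kernel of the same pair
    of points, whose integral is then over a slab. *)
Let weight_split d y z x : (weight y z x <= sep_weight d y z x +
  ((f z * newton y z) * (near d x z * (g x * newton z x)) +
   (near d z y * (f z * newton y z)) * (g x * newton z x)))%R.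
Proof.
rewrite /sep_weight /separated /near -/(weight y z x).
have W0 := weight_ge0 y z x; rewrite /weight in W0 *.
move: (f z * newton y z)%R (g x * newton z x)%R W0 => p q W0.
case: (d <= _)%R; case: (d <= _)%R => /=; nra.
Qed.

Let cut_bound (h : R3 R -> R) (E : set (R3 R)) (z : R3 R) (Q : R) :
  measurable E -> measurable_fun setT h ->
  (forall x, 0 <= h x <= C * (newton z x * \1_E x))%R ->
  \int[leb3 R]_(x in E) (newton z x)%:E <= Q%:E ->
  \int[leb3 R]_x (h x)%:E <= (C * Q)%:E.
Proof.
move=> mE mh hE EQ; have C0' := ltW C0.
have m1 : measurable_fun setT (fun x => (newton z x * \1_E x)%:E).
  apply/measurable_EFinP/measurable_funM; first exact: measurable_newton.
  exact: measurable_indic.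
apply: (@le_trans _ _ (\int[leb3 R]_x (C%:E * (newton z x * \1_E x)%:E))).
  apply: ge0_le_integral => //.
  - by move=> x _; rewrite lee_fin; have /andP[] := hE x.
  - exact/measurable_EFinP.
  - exact: emeasurable_funM.
  - by move=> x _; rewrite -EFinM lee_fin; have /andP[] := hE x.
rewrite ge0_integralZl_EFin//; last first.
  by move=> x _; rewrite lee_fin mulr_ge0 ?newton_ge0// indicE.
rewrite EFinM lee_wpmul2l ?lee_fin//; apply: le_trans EQ.
rewrite [leRHS]integral_mkcond le_eqVlt; apply/orP; left; apply/eqP.
by apply: eq_integral => x _; rewrite /patch indicE; case: ifPn; rewrite ?mulr1 ?mulr0.
Qed.

Let product_bound (p : R3 R -> R) (q : R3 R -> R3 R -> R) (P Q : R) :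
  (forall z, 0 <= p z)%R -> (forall z x, 0 <= q z x)%R ->
  measurable_fun setT p ->
  measurable_fun setT (fun zx : R3 R * R3 R => q zx.1 zx.2) ->
  \int[leb3 R]_z (p z)%:E <= P%:E ->
  (forall z, \int[leb3 R]_x (q z x)%:E <= Q%:E) ->
  \int[leb3 R]_z \int[leb3 R]_x (p z * q z x)%:E <= (P * Q)%:E.
Proof.
move=> p0 q0 mp mq pP qQ.
have Q0 : 0 <= Q%:E.
  by apply: le_trans (qQ 0%R); apply: integral_ge0 => x _; rewrite lee_fin.
have mqz z : measurable_fun setT (q z).
  by apply: (measurableT_comp mq (g := fun x => (z, x))); exact: measurable_fun_pair.
apply: (@le_trans _ _ (\int[leb3 R]_z ((p z)%:E * Q%:E))).
  apply: ge0_le_integral => //.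
  - by move=> z _; apply: integral_ge0 => x _; rewrite lee_fin mulr_ge0.
  - apply: (@measurable_fun_fubini_tonelli_F _ _ _ _ _ (leb3 R)
      (fun zx => (p zx.1 * q zx.1 zx.2)%:E)) => //.
      apply/measurable_EFinP/measurable_funM => //.
      by apply: measurableT_comp => //; exact: measurable_fst.
    by move=> zx; rewrite lee_fin mulr_ge0.
  - by apply: emeasurable_funM => //; exact/measurable_EFinP.
  - move=> z _; under eq_integral do rewrite EFinM.
    rewrite ge0_integralZl_EFin//; last 2 first.
    + by move=> x _; rewrite lee_fin.
    + exact/measurable_EFinP.
    by rewrite lee_wpmul2l ?lee_fin.
rewrite ge0_integralZr//; last 2 first.
- exact/measurable_EFinP.
- by move=> z _; rewrite lee_fin.
by rewrite EFinM lee_wpmul2r.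
Qed.

Section shift.
Variables (ma mb : {sigma_finite_measure set (R3 R) -> \bar R}).
Hypothesis maE : forall h : R3 R -> \bar R, measurable_fun setT h ->
  (forall x, 0 <= h x) -> \int[ma]_x h x = \int[leb3 R]_x (h x * (f x)%:E).
Hypothesis mbE : forall h : R3 R -> \bar R, measurable_fun setT h ->
  (forall x, 0 <= h x) -> \int[mb]_x h x = \int[leb3 R]_x (h x * (g x)%:E).

Let dpotE y A : measurable A ->
  dpot ma mb y A = \int[leb3 R]_z \int[leb3 R]_x sep_integrand 0 y A x z.
Proof.
move=> mA; rewrite /dpot maE; last 2 first.
- exact: measurable_dpot_integrand.
- by move=> z; exact: dpot_integrand_ge0.
apply: eq_integral => z _; rewrite /pot mbE; last 2 first.
- exact: measurable_pot_integrand.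
- by move=> x; exact: pot_integrand_ge0.
rewrite muleAC -EFinM -ge0_integralZl_EFin//.
- apply: eq_integral => x _; rewrite -!EFinM; congr EFin.
  by rewrite /sep_weight /separated !normr_ge0 mul1r /weight /=; ring.
- by move=> x _; rewrite mule_ge0 ?pot_integrand_ge0// lee_fin.
- apply: emeasurable_funM; last exact/measurable_EFinP.
  exact: (@measurable_pot_integrand _ A (z, enorm (z - y))%R mA).
- by rewrite mulr_ge0// newton_ge0.
Qed.

Lemma dpot_shift (s : R) : (0 < s)%R -> exists2 e0 : R, (0 < e0)%R &
  forall y A e, measurable A -> (0 <= e <= e0)%R ->
    dpot ma mb y (shift_set e A) <= dpot ma mb y A + s%:E.
Proof.
move=> s0; have [K [K0 newtonK]] := newton_potential_bounded (ltW L0).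
have K10 : (0 < K + 1)%R by rewrite ltr_wpDl.
(* The two parts near the slabs contribute [C * K * (C * u)] each, together at most s / 2; [K + 1]
   replaces K, which may be 0. *)
pose u := (s / (4 * C ^+ 2 * (K + 1)))%R.
have u0 : (0 < u)%R.
  by apply: divr_gt0 => //; apply: mulr_gt0 => //; apply: mulr_gt0 => //; exact: exprn_gt0.
have [d [d0 newtond]] := newton_potential_slab (ltW L0) u0.
have s20 : (0 < s / 2)%R by rewrite divr_gt0.
have [e0 e00 He0] := sep_mass_shift d0 s20.
exists e0 => // y A e mA ee; have mAe := measurable_shift_set e mA.
have swap B : measurable B -> sep_mass d y B =
    \int[leb3 R]_z \int[leb3 R]_x sep_integrand d y B x z.
  move=> mB; apply: (@fubini_tonelli _ _ _ _ _ (leb3 R) (leb3 R)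
    (fun q => sep_integrand d y B q.1 q.2)) => //.
  by apply: (@measurable_sep_integrand d y B _ _ fst snd).
have sep_le_weight B x z :
    sep_integrand d y B x z <= sep_integrand 0 y B x z.
  rewrite lee_fin ler_wpM2r ?indicE//; apply: (le_trans (sep_weight_le _ _ _ _)).
  by rewrite /sep_weight /separated !normr_ge0 mul1r.
have mzx d' B : measurable B -> measurable_fun setT
    (fun q : R3 R * R3 R => sep_integrand d' y B q.2 q.1).
  by move=> mB; apply: (@measurable_sep_integrand d' y B _ _ snd fst).
have mx d' B z : measurable B -> measurable_fun setT (fun x => sep_integrand d' y B x z).
  by move=> mB; apply: (@measurable_sep_integrand d' y B _ _ id (cst z)).
have mint d' B : measurable B ->
    measurable_fun setT (fun z => \int[leb3 R]_x sep_integrand d' y B x z).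
  move=> mB; apply: (@measurable_fun_fubini_tonelli_F _ _ _ _ _ (leb3 R)
    (fun q => sep_integrand d' y B q.2 q.1)) => //; exact: mzx.
have int_ge0 d' B z : 0 <= \int[leb3 R]_x sep_integrand d' y B x z.
  by apply: integral_ge0 => x _; exact: sep_integrand_ge0.
(* Only the translated side has to be split: on the other side the truncated mass is simply enlarged
   to the full one. *)
have sep_le : sep_mass d y A <= dpot ma mb y A.
  rewrite (swap _ mA) (dpotE _ mA).
  apply: ge0_le_integral; [by []|by []|exact: mint|exact: mint|].
  move=> z _; apply: ge0_le_integral; [by []|by []|exact: mx|exact: mx|].
  by move=> x _; exact: sep_le_weight.
pose p1 z := (f z * newton y z)%R.
pose q1 z x := (near d x z * (g x * newton z x))%R.
pose p2 z := (near d z y * (f z * newton y z))%R.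
pose q2 z x := (g x * newton z x)%R.
have p10 z : (0 <= p1 z)%R by rewrite mulr_ge0// newton_ge0.
have q20 z x : (0 <= q2 z x)%R by rewrite mulr_ge0// newton_ge0.
have q10 z x : (0 <= q1 z x)%R by rewrite /q1 mulr_ge0// q20.
have p20 z : (0 <= p2 z)%R by rewrite /p2 mulr_ge0// p10.
have mp1 : measurable_fun setT p1 by apply: measurable_funM => //; exact: measurable_newton.
have mp2 : measurable_fun setT p2 by apply: measurable_funM => //; exact: measurable_near.
have mq2 : measurable_fun setT (fun zx : R3 R * R3 R => q2 zx.1 zx.2).
  apply: measurable_funM; last exact: measurable_newton.
  by apply: measurableT_comp => //; exact: measurable_snd.
have mq1 : measurable_fun setT (fun zx : R3 R * R3 R => q1 zx.1 zx.2).
  by apply: measurable_funM => //; exact: measurable_near.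
have cutC (h : R3 R -> R) (z x : R3 R) : (0 <= h x <= C)%R ->
    (~ cube 0%R L x -> h x = 0%R) ->
    (0 <= h x * newton z x <= C * (newton z x * \1_(cube 0%R L) x))%R.
  move=> /andP[h0 hC] hs; rewrite mulr_ge0 ?newton_ge0//= indicE.
  case: (boolP (x \in _)) => [_|/negP xE]; first by rewrite mulr1 ler_wpM2r ?newton_ge0.
  by rewrite hs ?mul0r ?mulr0// => xE'; apply: xE; rewrite inE.
have cutd (h : R3 R -> R) (z x : R3 R) : (0 <= h x <= C)%R ->
    (~ cube 0%R L x -> h x = 0%R) ->
    (0 <= near d x z * (h x * newton z x) <=
     C * (newton z x * \1_(cube 0%R L `&` [set x | `|x.1.1 - z.1.1| < d]) x))%R.
  move=> hx hs; have /andP[h1 h2] := cutC h z x hx hs; rewrite mulr_ge0//=.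
  rewrite indicE in_setI -[X in (_ && X)]/(x \in [set x : R3 R | (`|x.1.1 - z.1.1| < d)%R]).
  have [xd|xd] := leP d `|x.1.1 - z.1.1|%R.
    have -> : near d x z = 0%R by rewrite /near xd subrr.
    by rewrite mul0r mulr_ge0 ?(ltW C0)// mulr_ge0// newton_ge0.
  have -> : near d x z = 1%R by rewrite /near leNgt xd subr0.
  have xd' : [set x : R3 R | (`|x.1.1 - z.1.1| < d)%R] x by [].
  by rewrite mul1r (mem_set xd') andbT -indicE.
have b1 : \int[leb3 R]_z \int[leb3 R]_x (p1 z * q1 z x)%:E <= ((C * K) * (C * u))%:E.
  apply: product_bound => //.
    apply: (cut_bound (measurable_box _ _) mp1 _ (newtonK y)) => z.
    by apply: cutC => //; exact: fsupp.
  move=> z; apply: (cut_bound _ _ _ (newtond z)).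
  - by apply: measurableI; [exact: measurable_box|exact: measurable_slab].
  - by apply: (measurableT_comp mq1 (g := fun x => (z, x))); exact: measurable_fun_pair.
  - by move=> x; apply: cutd => //; exact: gsupp.
have b2 : \int[leb3 R]_z \int[leb3 R]_x (p2 z * q2 z x)%:E <= ((C * u) * (C * K))%:E.
  apply: product_bound => //.
    apply: (cut_bound _ mp2 _ (newtond y)); last by move=> z; apply: cutd => //; exact: fsupp.
    by apply: measurableI; [exact: measurable_box|exact: measurable_slab].
  move=> z; apply: (cut_bound (measurable_box _ _) _ _ (newtonK z)).
    by apply: (measurableT_comp mq2 (g := fun x => (z, x))); exact: measurable_fun_pair.
  by move=> x; apply: cutC => //; exact: gsupp.
have pq_x (p : R3 R -> R) (q : R3 R -> R3 R -> R) z :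
    measurable_fun setT (fun zx : R3 R * R3 R => q zx.1 zx.2) ->
    measurable_fun setT (fun x => (p z * q z x)%:E).
  move=> mq; apply/measurable_EFinP/measurable_funM => //.
  by apply: (measurableT_comp mq (g := fun x => (z, x))); exact: measurable_fun_pair.
have pq_int (p : R3 R -> R) (q : R3 R -> R3 R -> R) :
    (forall z, 0 <= p z)%R -> (forall z x, 0 <= q z x)%R -> measurable_fun setT p ->
    measurable_fun setT (fun zx : R3 R * R3 R => q zx.1 zx.2) ->
    measurable_fun setT (fun z => \int[leb3 R]_x (p z * q z x)%:E).
  move=> p0 q0 mp mq; apply: (@measurable_fun_fubini_tonelli_F _ _ _ _ _ (leb3 R)
    (fun zx => (p zx.1 * q zx.1 zx.2)%:E)).
    apply/measurable_EFinP/measurable_funM => //.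
    by apply: measurableT_comp => //; exact: measurable_fst.
  by move=> zx; rewrite lee_fin mulr_ge0.
have pq_ge0 (p : R3 R -> R) (q : R3 R -> R3 R -> R) z :
    (forall z, 0 <= p z)%R -> (forall z x, 0 <= q z x)%R ->
    0 <= \int[leb3 R]_x (p z * q z x)%:E.
  by move=> p0 q0; apply: integral_ge0 => x _; rewrite lee_fin mulr_ge0.
rewrite (dpotE _ mAe).
apply: (@le_trans _ _ (\int[leb3 R]_z (\int[leb3 R]_x sep_integrand d y (shift_set e A) x z +
  (\int[leb3 R]_x (p1 z * q1 z x)%:E + \int[leb3 R]_x (p2 z * q2 z x)%:E)))).
  apply: ge0_le_integral => //; first exact: mint.
    by apply: emeasurable_funD; [exact: mint|apply: emeasurable_funD; exact: pq_int].
  move=> z _; rewrite -ge0_integralD//; last 4 first.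
  - by move=> x _; rewrite lee_fin mulr_ge0.
  - exact: pq_x.
  - by move=> x _; rewrite lee_fin mulr_ge0.
  - exact: pq_x.
  rewrite -ge0_integralD//; last 3 first.
  - exact: mx.
  - by move=> x _; rewrite adde_ge0// lee_fin mulr_ge0.
  - by apply: emeasurable_funD; exact: pq_x.
  apply: ge0_le_integral => //.
  - exact: mx.
  - by apply: emeasurable_funD; [exact: mx|apply: emeasurable_funD; exact: pq_x].
  move=> x _; rewrite -!EFinD lee_fin /sep_integrand.
  have W := weight_split d y z x; rewrite -/(p1 z) -/(q1 z x) -/(q2 z x) -/(p2 z) in W.
  have b0 : (0 <= p1 z * q1 z x + p2 z * q2 z x)%R by rewrite addr_ge0// mulr_ge0.
  have -> : sep_weight 0 y z x = weight y z x.
    by rewrite /sep_weight /separated !normr_ge0 mul1r.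
  by rewrite indicE; case: (_ \in _); rewrite ?mulr1 ?mulr0 ?add0r.
rewrite ge0_integralD//; last 3 first.
- exact: mint.
- by move=> z _; rewrite adde_ge0//; exact: pq_ge0.
- by apply: emeasurable_funD; exact: pq_int.
rewrite [X in _ + X <= _]ge0_integralD//; last 4 first.
- by move=> z _; exact: pq_ge0.
- exact: pq_int.
- by move=> z _; exact: pq_ge0.
- exact: pq_int.
rewrite -(swap _ mAe); apply: (le_trans (leeD (He0 y A e mA ee) (leeD b1 b2))).
rewrite -addeA; apply: leeD => //; rewrite -!EFinD lee_fin.
have -> : (C * K * (C * u) + C * u * (C * K) = 2 * C ^+ 2 * K * u)%R by ring.
have : (2 * C ^+ 2 * K * u <= 2 * C ^+ 2 * (K + 1) * u)%R.
  apply: ler_wpM2r; first exact: ltW.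
  by apply: ler_wpM2l; [rewrite mulr_ge0 ?sqr_ge0|rewrite lerDl].
have -> : (2 * C ^+ 2 * (K + 1) * u = s / 2)%R by rewrite /u; field; rewrite !gt_eqF.
by move=> h; rewrite [leRHS]splitr lerD2l.
Qed.

End shift.

End translation.

(** * The kernels S and S^2 *)

Section kernel_measure.
Context (R : realType).
Local Open Scope ereal_scope.
Implicit Types (m n : {sigma_finite_measure set (R3 R) -> \bar R}).
Implicit Types (A : set (R3 R * R)) (y z : R3 R) (K : R).

Let distance_map y (x : R3 R) := (x, enorm (x - y)%R).

Let measurable_distance_map y : measurable_fun setT (distance_map y).
Proof. by apply: measurable_fun_pair => //; exact: measurable_enormB. Qed.

Let measurable_newtonr y : measurable_fun setT (newton y).
Proof. exact: measurable_newton. Qed.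

Let newton_density m y : {measure set (R3 R) -> \bar R} :=
  density_measure m (newton_ge0 y) (measurable_newtonr y).

Definition kernel_measure m y : {measure set (R3 R * R)%type -> \bar R} :=
  measure_function_pushforward__canonical__measure_function_Measure
    (newton_density m y) (measurable_distance_map y).

Lemma kernel_measureE m y A : measurable A ->
  kernel_measure m y A = \int[m]_(x in [set x | A (x, enorm (x - y)%R)]) (newton y x)%:E.
Proof. by []. Qed.

Lemma kernel_measure_pot m y A : measurable A -> kernel_measure m y A = pot m A (y, 0%R).
Proof.
move=> mA; rewrite kernel_measureE// integral_mkcond; apply: eq_integral => x _.
rewrite /patch /= addr0 indicE.
rewrite (_ : (x \in [set x | A (x, enorm (x - y)%R)]) = ((x, enorm (x - y)%R) \in A)).
  by case: ifPn => _; rewrite ?mulr1 ?mulr0.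
by apply/idP/idP; rewrite !inE.
Qed.

Lemma integral_kernel_measure m y (F : R3 R * R -> \bar R) :
  measurable_fun setT F -> (forall p, 0 <= F p) ->
  \int[kernel_measure m y]_p F p = \int[m]_x (F (x, enorm (x - y)%R) * (newton y x)%:E).
Proof.
move=> mF F0; have := @ge0_integral_pushforward _ _ _ _ R _ (measurable_distance_map y)
  (newton_density m y) setT F measurableT mF (fun p _ => F0 p).
rewrite preimage_setT => ->; rewrite integral_density//.
  exact: (measurableT_comp mF (measurable_distance_map y)).
by move=> x; exact: F0.
Qed.

Lemma kernel_measure_le m y A K : measurable A ->
  \int[m]_x (newton y x)%:E <= K%:E -> kernel_measure m y A <= K%:E.
Proof. by move=> mA; apply: le_trans; rewrite kernel_measure_pot//; exact: pot_le. Qed.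

(** Identifies [dpot] with a composition of kernels: p is the pair (z, sigma) of [kernel_comp]. *)
Lemma integral_pot m n y A : measurable A ->
  \int[kernel_measure m y]_p pot n A p = dpot m n y A.
Proof.
move=> mA; rewrite integral_kernel_measure//; last 2 first.
- exact: measurable_pot.
- by move=> p; exact: pot_ge0.
by apply: eq_integral => z _; rewrite muleC.
Qed.

Section pot_difference.
Variables (m n1 n2 : {sigma_finite_measure set (R3 R) -> \bar R}) (K : R) (y : R3 R).
Variable A : set (R3 R * R).
Hypothesis mA : measurable A.
Hypothesis mK : \int[m]_x (newton y x)%:E <= K%:E.
Hypothesis n1K : forall z, \int[n1]_x (newton z x)%:E <= K%:E.
Hypothesis n2K : forall z, \int[n2]_x (newton z x)%:E <= K%:E.

Let pot_fin n p : (forall z, \int[n]_x (newton z x)%:E <= K%:E) -> pot n A p \is a fin_num.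
Proof.
move=> nK; rewrite ge0_fin_numE ?pot_ge0//.
by apply: (le_lt_trans (pot_le n p mA)); apply: (le_lt_trans (nK _)); rewrite ltey.
Qed.

Lemma dpot_fin n : (forall z, \int[n]_x (newton z x)%:E <= K%:E) ->
  dpot m n y A \is a fin_num.
Proof.
move=> nK; rewrite ge0_fin_numE ?dpot_ge0//.
by apply: (le_lt_trans (dpot_le mA mK nK)); rewrite ltey.
Qed.

Let integrable_pot n : (forall z, \int[n]_x (newton z x)%:E <= K%:E) ->
  (kernel_measure m y).-integrable setT (EFin \o (fun p => fine (pot n A p))).
Proof.
move=> nK; have E : EFin \o (fun p => fine (pot n A p)) = pot n A.
  by apply/funext => p /=; rewrite fineK// pot_fin.
rewrite E; apply/integrableP; split; first exact: measurable_pot.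
under eq_integral do rewrite gee0_abs ?pot_ge0//.
by rewrite integral_pot// -ge0_fin_numE ?dpot_ge0// dpot_fin.
Qed.

Let integral_fine_pot n : (forall z, \int[n]_x (newton z x)%:E <= K%:E) ->
  \int[kernel_measure m y]_p (fine (pot n A p))%:E = dpot m n y A.
Proof.
move=> nK; rewrite -integral_pot//; apply: eq_integral => p _.
by rewrite fineK// pot_fin.
Qed.

Lemma integrable_potB : (kernel_measure m y).-integrable setT
  (EFin \o (fun p => (fine (pot n1 A p) - fine (pot n2 A p))%R)).
Proof.
rewrite (_ : EFin \o _ = (EFin \o (fun p => fine (pot n1 A p))) \-
  (EFin \o (fun p => fine (pot n2 A p)))); last by apply/funext => p /=; rewrite EFinB.
by apply: integrableB => //; exact: integrable_pot.
Qed.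

Lemma integral_potB :
  fine (\int[kernel_measure m y]_p (fine (pot n1 A p) - fine (pot n2 A p))%:E) =
  (fine (dpot m n1 y A) - fine (dpot m n2 y A))%R.
Proof.
under eq_integral do rewrite EFinB.
rewrite integralB_EFin//; try exact: integrable_pot.
by rewrite !integral_fine_pot// fineB// dpot_fin.
Qed.

End pot_difference.

End kernel_measure.

Lemma set_base_measurable d (X : measurableType d) : set_base (@measurable d X).
Proof.
split=> //; [exact: measurableI|exact: measurableU|].
by exists (fun=> setT); split=> //; rewrite bigcup_const//; exists 0%N.
Qed.

(* The constant 4 comes from splitting a family of sets by the signs of the real
   and imaginary parts. *)
Lemma variation_le d (X : measurableType d) (R : realType) (nu : set X -> R[i]) (s : R) :
  (forall A B, measurable A -> measurable B -> A `&` B = set0 ->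
    nu (A `|` B) = nu A + nu B) ->
  (forall A, measurable A -> `|complex.Re (nu A)| <= s) ->
  (forall A, measurable A -> `|complex.Im (nu A)| <= s) ->
  (measure_variation measurable nu setT <= (4 * s)%:E)%E.
Proof.
move=> nuU nuR nuI.
have nu0 : nu set0 = 0.
  have := nuU set0 set0 measurable0 measurable0 (setI0 _).
  by rewrite setU0 => /eqP; rewrite -subr_eq0 opprD addrA subrr add0r oppr_eq0 => /eqP.
apply: ge_ereal_sup => _ [n [F [mF _ tF ->]]]; rewrite lee_fin.
have nu_big (P : pred 'I_n) : nu (\big[setU/set0]_(i | P i) F i) = \sum_(i | P i) nu (F i) /\
    measurable (\big[setU/set0]_(i | P i) F i).
  elim: (index_enum _) (index_enum_uniq 'I_n) => [|i r ih /= /andP[ir ur]].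
    by rewrite !big_nil; split.
  have [ih1 ih2] := ih ur; rewrite !big_cons; case: ifPn => // Pi; split.
    rewrite nuU ?ih1// big_distrr/= big_seq_cond big1// => j /andP[jr _].
    move/trivIsetP : tF; apply => //; apply: contraNneq ir => ->.
    exact: jr.
  exact: measurableU.
have part (h : R[i] -> R) : (forall z w, h (z + w) = h z + h w) -> h 0 = 0 ->
    (forall A, measurable A -> `|h (nu A)| <= s) -> \sum_(i < n) `|h (nu (F i))| <= 2 * s.
  move=> hD h0 hs.
  have h_sum (P : pred 'I_n) : h (\sum_(i | P i) nu (F i)) = \sum_(i | P i) h (nu (F i)).
    exact: (big_morph h).
  rewrite (bigID (fun i => 0 <= h (nu (F i))))/= mulr_natl mulr2n; apply: lerD.
    rewrite (eq_bigr (fun i => h (nu (F i)))); last by move=> i /ger0_norm.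
    rewrite -h_sum; have [<- mB] := nu_big (fun i => 0 <= h (nu (F i))).
    exact: le_trans (ler_norm _) (hs _ mB).
  rewrite (eq_bigr (fun i => - h (nu (F i)))); last first.
    by move=> i; rewrite -ltNge => /ltr0_norm.
  rewrite sumrN -h_sum; have [<- mB] := nu_big (fun i => ~~ (0 <= h (nu (F i)))).
  by apply: (le_trans (ler_norm _)); rewrite normrN; exact: hs.
have -> : 4 * s = 2 * s + 2 * s by lra.
apply: (@le_trans _ _ (\sum_(i < n) (`|complex.Re (nu (F i))| + `|complex.Im (nu (F i))|))).
  apply: ler_sum => i _; case: (nu (F i)) => a b /=.
  rewrite -[leRHS]ger0_norm ?addr_ge0// -sqrtr_sqr ler_wsqrtr//.
  by rewrite sqrrD !real_normK ?num_real//; have := mulr_ge0 (normr_ge0 a) (normr_ge0 b); lra.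
rewrite big_split/=; apply: lerD.
  by apply: (part (@complex.Re R)) => // -[? ?] [? ?].
by apply: (part (@complex.Im R)) => // -[? ?] [? ?].
Qed.

Section bounded_sets.
Context (R : realType).

Lemma measurable_ecball (r : R) : measurable (@ecball R r).
Proof.
rewrite (_ : ecball r = @enorm R @^-1` [set` `]-oo, r]]).
  by rewrite -[X in measurable X]setTI; apply: measurable_enorm => //; exact: measurable_itv.
by apply/seteqP; split => x /=; rewrite /ecball/= in_itv.
Qed.

Lemma set_base_bounded : set_base (@bounded_measurable R).
Proof.
split.
- by move=> A [].
- move=> E A [mE [r Er]] mA; split; first exact: measurableI.
  by exists r; apply: subset_trans Er; exact: subIsetl.
- move=> E F [mE [r Er]] [mF [s Fs]]; split; first exact: measurableU.
  exists (Num.max r s) => x [/Er|/Fs]; rewrite /ecball /= => h; rewrite le_max h ?orbT//.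
- exists (fun n => @ecball R n%:R); split.
  + by move=> n; split; [exact: measurable_ecball|exists n%:R].
  + move=> i j ij; apply/subsetPset => x; rewrite /ecball/= => /le_trans; apply.
    by rewrite ler_nat.
  + rewrite -subTset => x _; exists (Num.truncn (enorm x)).+1 => //.
    by rewrite /ecball/= ltW// truncnS_gt.
Qed.

End bounded_sets.

Section kernel_formulas.
Context (R : realType) (V : set (R3 R) -> R[i]).
Variables (m1 m2 m3 m4 : {sigma_finite_measure set (R3 R) -> \bar R}) (K : R).
Hypothesis repR : represents (@bounded_measurable R) (fun A => complex.Re (V A)) m1 m2.
Hypothesis repI : represents (@bounded_measurable R) (fun A => complex.Im (V A)) m3 m4.
Local Open Scope ereal_scope.
Hypothesis K1 : forall z, \int[m1]_x (newton z x)%:E <= K%:E.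
Hypothesis K2 : forall z, \int[m2]_x (newton z x)%:E <= K%:E.
Hypothesis K3 : forall z, \int[m3]_x (newton z x)%:E <= K%:E.
Hypothesis K4 : forall z, \int[m4]_x (newton z x)%:E <= K%:E.
Implicit Types (A : set (R3 R * R)) (y : R3 R).

Let mfine (m : {sigma_finite_measure set (R3 R) -> \bar R}) y A : R :=
  fine (kernel_measure m y A).

Lemma S_kernelE y A : measurable A -> S_kernel V y A =
  ((mfine m1 y A - mfine m2 y A)%R +i* (mfine m3 y A - mfine m4 y A)%R)%C.
Proof.
move=> mA; rewrite /S_kernel /complex_integral /=.
set D := [set x | A (x, enorm (x - y)%R)].
have mD : measurable D.
  have md : measurable_fun setT (fun x : R3 R => (x, enorm (x - y)%R)).
    by apply: measurable_fun_pair => //; exact: measurable_enormB.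
  by rewrite -[X in measurable X]setTI; exact: md.
have intw (m : {sigma_finite_measure set (R3 R) -> \bar R}) :
    (forall z, \int[m]_x (newton z x)%:E <= K%:E) -> m.-integrable D (EFin \o newton y).
  move=> mK; apply: (@integrableS _ _ _ _ setT) => //; apply/integrableP; split.
    exact/measurable_EFinP/measurable_newton.
  under eq_integral do rewrite gee0_abs ?lee_fin ?newton_ge0//.
  by apply: (le_lt_trans (mK y)); rewrite ltey.
have int0 (m : {sigma_finite_measure set (R3 R) -> \bar R}) :
    m.-integrable D (EFin \o (fun=> 0%R)) by exact: integrable0.
have E0 : forall m : {sigma_finite_measure set (R3 R) -> \bar R},
  fine (\int[m]_(x in D) ((fun=> 0%R) x)%:E) = 0%R.
  by move=> m; rewrite integral0.
rewrite (signed_integralE (set_base_bounded R) repR mD (intw _ K1) (intw _ K2)).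
rewrite (signed_integralE (set_base_bounded R) repI mD (intw _ K3) (intw _ K4)).
rewrite (signed_integralE (set_base_bounded R) repR mD (int0 _) (int0 _)).
rewrite (signed_integralE (set_base_bounded R) repI mD (int0 _) (int0 _)).
by rewrite !E0 !subr0 add0r.
Qed.

Let represents_kernel y (m m' : {sigma_finite_measure set (R3 R) -> \bar R})
    (h : R[i] -> R) :
  (forall A, measurable A -> h (S_kernel V y A) = mfine m y A - mfine m' y A)%R ->
  (forall z, \int[m]_x (newton z x)%:E <= K%:E) ->
  (forall z, \int[m']_x (newton z x)%:E <= K%:E) ->
  represents measurable (fun A => h (S_kernel V y A)) (kernel_measure m y) (kernel_measure m' y).
Proof.
move=> hS mK mK' A mA; split; last exact: hS.
- by apply: (le_lt_trans (kernel_measure_le mA (mK y))); rewrite ltey.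
- by apply: (le_lt_trans (kernel_measure_le mA (mK' y))); rewrite ltey.
Qed.

Let D (m n : {sigma_finite_measure set (R3 R) -> \bar R}) y A : R := fine (dpot m n y A).

(** In [D m n] the first measure carries z and the second x. Both levels of integration go through
    [signed_integralE], as the kernels of the given measures need not form the Jordan decompositions
    of the parts of [S_kernel V y]. *)
Lemma S_kernel2E y A : measurable A -> kernel_pow (S_kernel V) 2 y A =
  ((((D m1 m1 y A - D m1 m2 y A) - (D m2 m1 y A - D m2 m2 y A)) -
    ((D m3 m3 y A - D m3 m4 y A) - (D m4 m3 y A - D m4 m4 y A)))%R
   +i* (((D m1 m3 y A - D m1 m4 y A) - (D m2 m3 y A - D m2 m4 y A)) +
    ((D m3 m1 y A - D m3 m2 y A) - (D m4 m1 y A - D m4 m2 y A)))%R)%C.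
Proof.
move=> mA; rewrite /kernel_pow /= /kernel_comp.
have pre (p : R3 R * R) : measurable ((fun q : R3 R * R => (q.1, q.2 + p.2)%R) @^-1` A).
  have ms : measurable_fun setT (fun q : R3 R * R => (q.1, q.2 + p.2)%R).
    apply: measurable_fun_pair; first exact: measurable_fst.
    by apply: measurable_funD => //; exact: measurable_snd.
  by rewrite -[X in measurable X]setTI; exact: ms.
(* The translation by sigma in [kernel_comp] becomes the second component of the argument of
   [pot]. *)
have shift_pot m (p : R3 R * R) :
    kernel_measure m p.1 ((fun q : R3 R * R => (q.1, q.2 + p.2)%R) @^-1` A) = pot m A p.
  rewrite kernel_measure_pot//; apply: eq_integral => x _; rewrite /= addr0 !indicE.
  by congr (_ * _%:R)%:E; apply/idP/idP; rewrite !inE.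
have SE : (fun p : R3 R * R =>
    S_kernel V p.1 ((fun q : R3 R * R => (q.1, q.2 + p.2)%R) @^-1` A)) =
  (fun p => ((fine (pot m1 A p) - fine (pot m2 A p))%R +i*
             (fine (pot m3 A p) - fine (pot m4 A p))%R)%C).
  by apply/funext => p; rewrite S_kernelE// /mfine !shift_pot.
rewrite SE /complex_integral /=.
have rR : represents measurable (fun B => complex.Re (S_kernel V y B))
    (kernel_measure m1 y) (kernel_measure m2 y).
  by apply: represents_kernel => // B mB; rewrite S_kernelE.
have rI : represents measurable (fun B => complex.Im (S_kernel V y B))
    (kernel_measure m3 y) (kernel_measure m4 y).
  by apply: represents_kernel => // B mB; rewrite S_kernelE.
have bM := @set_base_measurable _ (R3 R * R)%type.
by rewrite !(signed_integralE bM rR measurableT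
    (integrable_potB mA (K1 y) _ _) (integrable_potB mA (K2 y) _ _))//
  !(signed_integralE bM rI measurableT
    (integrable_potB mA (K3 y) _ _) (integrable_potB mA (K4 y) _ _))//
  !(integral_potB mA (K1 y))// !(integral_potB mA (K2 y))//
  !(integral_potB mA (K3 y))// !(integral_potB mA (K4 y)).
Qed.

End kernel_formulas.

(** * Approximation by densities *)

Section continuous_functions.
Context (R : realType).
Implicit Types (u : R3 R -> R) (x : R3 R).

Lemma ball_R3 x y (e : R) : `|x.1.1 - y.1.1| < e -> `|x.1.2 - y.1.2| < e ->
  `|x.2 - y.2| < e -> ball x e y.
Proof. by move=> *; split; [split|]. Qed.

(** Measurability refers to the product sigma-algebra: U is the union of the countably many rational
    boxes that it contains. [F q] is empty for the other boxes, so that the union runs over all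
    indices. *)
Lemma open_measurable_R3 (U : set (R3 R)) : open U -> measurable U.
Proof.
move=> oU.
pose rbox (q : rat * rat * rat * nat) : set (R3 R) :=
  [set x | [/\ `|x.1.1 - ratr q.1.1.1| < q.2.+1%:R^-1, `|x.1.2 - ratr q.1.1.2| < q.2.+1%:R^-1
    & `|x.2 - ratr q.1.2| < q.2.+1%:R^-1]].
pose F q : set (R3 R) := [set x | rbox q x /\ rbox q `<=` U].
have mside (p : R3 R -> R) (a b : R) : measurable_fun setT p ->
    measurable [set x | `|p x - a| < b].
  move=> mp; have mq : measurable_fun setT (fun x => `|p x - a|).
    by apply: measurableT_comp => //; exact: measurable_funB.
  rewrite (_ : [set x | _] = (fun x => `|p x - a|) @^-1` [set` `]-oo, b[]).
    by rewrite -[X in measurable X]setTI; apply: mq => //; exact: measurable_itv.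
  by apply/seteqP; split => x /=; rewrite in_itv.
have mF q : measurable (F q).
  have [qU|qU] := pselect (rbox q `<=` U); last first.
    by rewrite (_ : F q = set0) //; apply/seteqP; split=> // x [].
  rewrite (_ : F q = rbox q); last by apply/seteqP; split=> x; [case|].
  rewrite (_ : rbox q = [set x : R3 R | `|x.1.1 - ratr q.1.1.1| < q.2.+1%:R^-1] `&`
     [set x : R3 R | `|x.1.2 - ratr q.1.1.2| < q.2.+1%:R^-1] `&`
     [set x : R3 R | `|x.2 - ratr q.1.2| < q.2.+1%:R^-1]); last first.
    by apply/seteqP; split=> x; [move=> [? ? ?]|move=> [[? ?] ?]].
  apply: measurableI; [apply: measurableI|]; apply: mside.
  - by apply: measurableT_comp => //; exact: measurable_fst.
  - by apply: measurableT_comp => //; exact: measurable_fst.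
  - exact: measurable_snd.
suff -> : U = \bigcup_q F q by exact: countable_bigcupT_measurable.
apply/seteqP; split=> [x Ux|x [q _ [qx]]]; last exact.
have /nbhs_ballP[e /= e0 xeU] : nbhs x U by exact: open_nbhs_nbhs.
have e20 : 0 < e / 2 by rewrite divr_gt0.
have [k kP] : exists k : nat, k.+1%:R^-1 < e / 2.
  exists (Num.truncn (e / 2)^-1); rewrite invf_plt ?posrE//; exact: truncnS_gt.
have k0 : 0 < k.+1%:R^-1 :> R by rewrite invr_gt0.
have ratx (a : R) : exists q : rat, `|a - ratr q| < k.+1%:R^-1.
  have [|q] := @rat_in_itvoo R (a - k.+1%:R^-1) (a + k.+1%:R^-1).
    by rewrite ltrD2l gtrN.
  by rewrite in_itv/= => qP; exists q; rewrite distrC ltr_distl.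
have [q1 h1] := ratx x.1.1; have [q2 h2] := ratx x.1.2; have [q3 h3] := ratx x.2.
exists (q1, q2, q3, k) => //; split=> // y [/= y1 y2 y3].
have near (a b c : R) : `|a - c| < k.+1%:R^-1 -> `|b - c| < k.+1%:R^-1 -> `|a - b| < e.
  move=> ac bc; apply: (le_lt_trans (ler_distD c _ _)); rewrite (splitr e) (distrC c).
  by apply: ltrD; [exact: lt_trans ac kP|exact: lt_trans bc kP].
by apply: xeU; apply: ball_R3; [exact: near h1 y1|exact: near h2 y2|exact: near h3 y3].
Qed.

Lemma continuous_measurable_R3 u : continuous u -> measurable_fun setT u.
Proof.
move=> cu; apply: (@measurability _ _ _ _ setT u (@RGenOpens.G R)); first exact: RGenOpens.measurableE.
move=> _ [_ [a [b ->]] <-]; rewrite setTI; apply: open_measurable_R3.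
by apply: open_comp; [move=> x _; exact: cu|exact: interval_open].
Qed.

Lemma compact_box (a b : R3 R) : compact (box a b).
Proof. by apply: compact_setX; [apply: compact_setX|]; exact: segment_compact. Qed.

Section compact_support.
Variables (u : R3 R -> R) (L : R).
Hypotheses (cu : continuous u) (usupp : forall x, ~ cube 0 L x -> u x = 0).

Lemma compact_support_bounded : exists2 C : R, 0 < C & forall x, `|u x| <= C.
Proof.
have cpt : compact (u @` cube 0 L).
  apply: continuous_compact; last exact: compact_box.
  exact: continuous_subspaceT.
have [M [_ HM]] := compact_bounded cpt.
exists (`|M| + 1); first by rewrite ltr_wpDl.
move=> x; have [xQ|xQ] := pselect (cube 0 L x); last by rewrite usupp// normr0 addr_ge0.
by apply: (HM (`|M| + 1)); [rewrite (le_lt_trans (ler_norm _))// ltrDl|exists x].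
Qed.

Lemma compact_support_uniform (w : R) : 0 < w -> exists2 h : R, 0 < h &
  forall (z' : R * R) s t, `|s - t| <= h -> `|u (z', s) - u (z', t)| <= w.
Proof.
move=> w0; pose P (h : R) (x : R3 R) := forall s, `|s - x.2| <= h -> `|u (x.1, s) - u x| <= w.
(* Compactness is applied to a larger cube. As h <= 1, if (z', t) is outside it then (z', t) and
   (z', s) are both outside the support. *)
have near : \forall h \near 0^'+, cube 0 (L + 1) `<=` P h.
  have cpt : compact (cube 0 (L + 1) : set (R3 R)) by exact: compact_box.
  move/compact_near_coveringP : cpt; apply => x _.
  have w20 : 0 < w / 2 by rewrite divr_gt0.
  have : u @ x --> u x by exact: cu.
  move=> /cvgrPdist_lt /(_ _ w20) /nbhs_ballP[d /= d0 dP].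
  have d20 : 0 < d / 2 by rewrite divr_gt0.
  exists (ball x (d / 2), [set h | h < d / 2]).
    split; first exact: nbhsx_ballx.
    exact: nbhs_right_lt.
  move=> [y h] [/= [[y1 y2] y3] hd] s sy.
  have yP : ball x d y.
    by move: y1 y2 y3; rewrite /ball/= => y1 y2 y3; apply: ball_R3;
       [apply: lt_trans y1 _|apply: lt_trans y2 _|apply: lt_trans y3 _]; lra.
  have sP : ball x d (y.1, s).
    have sy' := le_lt_trans sy hd.
    move: y1 y2 y3 sy'; rewrite /ball/= !ltr_norml => y1 y2 y3 sy'.
    by apply: ball_R3; rewrite ltr_norml/=; lra.
  have := dP _ yP; have := dP _ sP; rewrite /= !ltr_norml ler_norml; lra.
have [h [h0 h1 hP]] : exists h, [/\ 0 < h, h <= 1 & cube 0 (L + 1) `<=` P h].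
  have : \forall h \near 0^'+, [/\ 0 < h, h <= 1 & cube 0 (L + 1) `<=` P h].
    near=> h; split; [by []| by apply: ltW; near: h; exact: nbhs_right_lt|].
    by near: h.
  by move=> /filter_ex[h ?]; exists h.
exists h => // z' s t st.
have [tQ|tQ] := pselect (cube 0 (L + 1) (z', t)); first exact: (hP _ tQ).
have ut : ~ cube 0 L (z', t).
  move=> [[/= + +] +]; rewrite /= !in_itv/= !sub0r !add0r => a b c; apply: tQ.
  by split; [split|]; rewrite /= in_itv/=; lra.
have us : ~ cube 0 L (z', s).
  move: st; rewrite ler_norml => st.
  move=> [[/= + +] +]; rewrite /= !in_itv/= !sub0r !add0r => a b c; apply: tQ.
  by split; [split|]; rewrite /= in_itv/=; lra.
by rewrite !usupp// subrr normr0 ltW.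
Unshelve. all: end_near. Qed.

End compact_support.

End continuous_functions.

(** * Measures with bounded Newton potential *)

Section newton_bound.
Context (R : realType).
Local Open Scope ereal_scope.
Implicit Types (m : {measure set (R3 R) -> \bar R}).

Definition newton_bounded (m : set (R3 R) -> \bar R) (K : \bar R) :=
  forall y, \int[m]_x (newton y x)%:E <= K.

(** The centre lies outside the ball, at distance at least 1 from its points: at its own centre the
    kernel has the value 0 and would give no lower bound. With |r| the constant is positive even if
    r < 0, when the ball is empty. *)
Lemma newton_lower_bound (r : R) : exists y, exists2 c : R, (0 < c)%R &
  forall x, ecball r x -> (c <= newton y x)%R.
Proof.
exists (r + 1, 0, 0)%R; exists (4 * pi * (4 * `|r| + 2))^-1%R.
  by rewrite invr_gt0 mulr_gt0 ?mulr_gt0 ?pi_gt0// ltr_wpDl// mulr_ge0.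
move=> x xr; have [h1 h2 h3] := coord_le_enorm x.
have r0 : (0 <= r)%R := le_trans (enorm_ge0 x) xr.
have {}h1 := le_trans h1 xr; have {}h2 := le_trans h2 xr; have {}h3 := le_trans h3 xr.
move: h1 h2 h3; rewrite !ler_norml => /andP[a1 a2] /andP[b1 b2] /andP[c1 c2].
have e1 : (1 <= enorm (x - (r + 1, 0, 0)))%R.
  have [/= + _ _] := coord_le_enorm (x - (r + 1, 0, 0))%R.
  by apply: le_trans; rewrite distrC ger0_norm; lra.
have pi0 : (0 < 4 * pi :> R)%R by rewrite mulr_gt0// pi_gt0.
rewrite lef_pV2 ?posrE; last 2 first.
- by rewrite mulr_gt0// ltr_wpDl// mulr_ge0.
- by rewrite mulr_gt0// (lt_le_trans _ e1).
rewrite ler_pM2l// ger0_norm// -[leRHS]ger0_norm; last by lra.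
rewrite -sqrtr_sqr ler_wsqrtr//= !subr0; nra.
Qed.

Lemma newton_bounded_finite m (K : R) : newton_bounded m K%:E ->
  forall E, bounded_measurable E -> m E < +oo.
Proof.
move=> mK E [mE [r Er]]; have [y [c c0 hc]] := newton_lower_bound r.
rewrite -(@lte_pmul2l _ c%:E)// ?lte_fin// [c%:E * +oo]gt0_muley ?lte_fin//.
rewrite -(integral_cst _ mE)/=; apply: le_lt_trans (ltry K); apply: le_trans (mK y).
apply: (@le_trans _ _ (\int[m]_(x in E) (newton y x)%:E)).
  apply: ge0_le_integral => //.
  - by move=> x _; rewrite lee_fin ltW.
  - by apply/measurable_EFinP/measurable_funTS/measurable_newton.
  - by move=> x Ex; rewrite lee_fin; apply: hc; exact: Er.
apply: ge0_subset_integral => //; first exact/measurable_EFinP/measurable_newton.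
by move=> x _; rewrite lee_fin newton_ge0.
Qed.

Section sigma_finite_copy.
Variables (m : {measure set (R3 R) -> \bar R}) (K : R).
Hypothesis mK : newton_bounded m K%:E.

(** A copy of m that can carry the sigma-finite structure required by Fubini's theorem; the
    exhausting sets are balls, of finite mass because the potential is bounded. *)
Definition newton_sigma_finite : set (R3 R) -> \bar R := m.

HB.instance Definition _ := Measure.on newton_sigma_finite.

Let sf : sigma_finite setT newton_sigma_finite.
Proof.
have [G [BG _ GT]] := base_exhaustion (set_base_bounded R).
exists G => // n; split; first by case: (BG n).
exact: (newton_bounded_finite mK).
Qed.

HB.instance Definition _ := Measure_isSigmaFinite.Build _ _ _ newton_sigma_finite sf.

Lemma newton_bounded_sigma_finite :
  exists m' : {sigma_finite_measure set (R3 R) -> \bar R}, m' = m :> (set (R3 R) -> \bar R).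
Proof. by exists newton_sigma_finite. Qed.

End sigma_finite_copy.

Lemma newton_bounded_le (m n : set (R3 R) -> \bar R) K : m set0 = 0 -> n set0 = 0 ->
  (forall A, measurable A -> 0 <= m A <= n A) -> newton_bounded n K -> newton_bounded m K.
Proof.
move=> m0 n0 mn nK y; apply: le_trans (nK y); apply: le_integral_set_function => //.
- by move=> x _; rewrite lee_fin newton_ge0.
- by move=> x _; rewrite lee_fin newton_ge0.
Qed.

Lemma newton_bounded_add m m' K K' : newton_bounded m K -> newton_bounded m' K' ->
  newton_bounded (measure_add m m') (K + K').
Proof.
move=> mK mK' y; rewrite ge0_integral_measure_add//; first exact: leeD.
- by move=> x _; rewrite lee_fin newton_ge0.
- exact/measurable_EFinP/measurable_newton.
Qed.

End newton_bound.

Section variation.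
Context (R : realType).
Local Open Scope ereal_scope.
Variables (U : set (R3 R) -> R[i]) (nu : set (R3 R) -> R).
(** Allows the real and imaginary parts of U and their opposites to be treated at once. *)
Hypothesis nuU : forall A, (`|nu A| <= ComplexField.Normc.normc (U A))%R.
Hypothesis U0 : U set0 = 0%R.
Let B := @bounded_measurable R.

Let nu0 : nu set0 = 0%R.
Proof. by apply/normr0_eq0/le_anti; rewrite normr_ge0 (le_trans (nuU _))// U0 ComplexField.Normc.normc0. Qed.

Let pos_part_nonneg A : 0 <= pos_part B nu A.
Proof.
by have := pos_part_ub nu (base0 (set_base_bounded R)) (sub0set A); rewrite nu0.
Qed.

Lemma pos_part_le_variation A : pos_part B nu A <= measure_variation B U A.
Proof.
apply: ge_ereal_sup => _ [E [BE EA] <-].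
apply: (@le_trans _ _ (ComplexField.Normc.normc (U E))%:E).
  by rewrite lee_fin (le_trans (ler_norm _)).
apply: ereal_sup_ubound; exists 1%N, (fun=> E); split=> //.
- by move=> i j _ _; rewrite !ord1.
- by rewrite big_ord_recl big_ord0 addr0.
Qed.

Lemma measure_variation0 : measure_variation B U set0 = 0.
Proof.
apply/eqP; rewrite eq_le; apply/andP; split.
  apply: ge_ereal_sup => _ [n [F [_ F0 _ ->]]]; rewrite big1// => i _.
  by move: (F0 i); rewrite subset0 => ->; rewrite U0 ComplexField.Normc.normc0.
apply: ereal_sup_ubound; exists 0%N, (fun=> set0); split=> [[]//|[]//|[]//|]; by rewrite big_ord0.
Qed.

Lemma pos_part_newton_le_variation y (D E : set (R3 R)) : D `<=` E ->
  \int[pos_part B nu]_(x in D) (newton y x)%:E <=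
  \int[measure_variation B U]_(x in E) ((enorm (x - y)%R)%:E)^-1.
Proof.
move=> DE; apply: le_integral_set_function.
- apply/le_anti; rewrite pos_part_nonneg andbT.
  by apply: ge_ereal_sup => _ [E' [_ +] <-]; rewrite subset0 => ->; rewrite nu0.
- exact: measure_variation0.
- by move=> A _; rewrite pos_part_nonneg pos_part_le_variation.
- by move=> x _; rewrite lee_fin newton_ge0.
- by move=> x _; rewrite inve_ge0 lee_fin enorm_ge0.
- move=> x Dx; split; first exact: DE.
  by rewrite inver; case: ifPn => [_|_]; [exact: leey|rewrite lee_fin newton_le].
Qed.

Lemma pos_part_newton_bounded : newton_bounded (pos_part B nu) (kato_norm U).
Proof.
move=> y; apply: (le_trans (pos_part_newton_le_variation y (@subset_refl _ setT))).
by apply: ereal_sup_ubound; exists y.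
Qed.

End variation.

Section complex_parts.
Context (R : realType).
Implicit Types (z : R[i]) (V : set (R3 R) -> R[i]).

Lemma normc_ge_Re z : `|complex.Re z| <= ComplexField.Normc.normc z.
Proof.
case: z => a b /=; rewrite -sqrtr_sqr ler_wsqrtr// lerDl; exact: sqr_ge0.
Qed.

Lemma normc_ge_Im z : `|complex.Im z| <= ComplexField.Normc.normc z.
Proof.
case: z => a b /=; rewrite -sqrtr_sqr ler_wsqrtr// lerDr; exact: sqr_ge0.
Qed.

Lemma normcN_ge_Re z : `|- complex.Re z| <= ComplexField.Normc.normc z.
Proof. by rewrite normrN normc_ge_Re. Qed.

Lemma normcN_ge_Im z : `|- complex.Im z| <= ComplexField.Normc.normc z.
Proof. by rewrite normrN normc_ge_Im. Qed.

(** A bounded set and all its pieces lie in one ball, on which V agrees with a charge. *)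
Lemma charge_base_additive V (c : R[i] -> R) (mu : R -> {charge set (R3 R) -> \bar R}) :
  (forall r A, measurable A -> c (V (A `&` ecball r)) = fine (mu r A)) ->
  base_additive (@bounded_measurable R) (fun A => c (V A)).
Proof.
move=> Vmu E F [mE [r Er]] mF tF EF.
have FE i : F i `<=` E by rewrite EF; exact: bigcup_sup.
have VE A : measurable A -> A `<=` E -> c (V A) = fine (mu r A).
  by move=> mA AE; rewrite -Vmu// setIidl//; exact: subset_trans Er.
rewrite (_ : (fun n => _) = (fun n => \sum_(0 <= i < n) fine (mu r (F i)))); last first.
  by apply/funext => n; apply: eq_bigr => i _; exact: VE.
have Ff i : mu r (F i) \is a fin_num by rewrite fin_num_measure.
rewrite VE//; under eq_fun do rewrite sum_fine//.
apply: fine_cvg; rewrite fineK ?fin_num_measure// EF.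
by apply: charge_semi_sigma_additive => //; rewrite -EF.
Qed.

Lemma locally_bounded_variation_Re V : locally_bounded_variation V ->
  base_additive (@bounded_measurable R) (fun A => complex.Re (V A)).
Proof.
move=> /choice[mu Vmu]; apply: (@charge_base_additive V _ mu) => r A mA.
by have [nu2 ->] := Vmu r.
Qed.

Lemma locally_bounded_variation_Im V : locally_bounded_variation V ->
  base_additive (@bounded_measurable R) (fun A => complex.Im (V A)).
Proof.
move=> lV; have /choice[mu Vmu] : forall r, exists nu2 : {charge set (R3 R) -> \bar R},
    forall A, measurable A -> complex.Im (V (A `&` ecball r)) = fine (nu2 A).
  by move=> r; have [nu1 [nu2 H]] := lV r; exists nu2 => A mA; rewrite H.
exact: (@charge_base_additive V _ mu).
Qed.

Lemma complex_eq0 z : complex.Re z = 0 -> complex.Im z = 0 -> z = 0.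
Proof. by case: z => a b /= -> ->. Qed.

Lemma locally_bounded_variation0 V : locally_bounded_variation V -> V set0 = 0.
Proof.
move=> lV; have bB := set_base_bounded R; apply: complex_eq0.
- exact: (base_additive0 bB (locally_bounded_variation_Re lV)).
- exact: (base_additive0 bB (locally_bounded_variation_Im lV)).
Qed.

End complex_parts.

Section lebesgue_integral_R3.
Context (R : realType).
Local Open Scope ereal_scope.
Let L := @lebesgue_measure R.

Let id2 : measurableTypeR R * measurableTypeR R -> R * R := idfun.
Let id3 : measurableTypeR R * measurableTypeR R * measurableTypeR R -> R3 R := idfun.

Let measurable_id2 : measurable_fun setT id2.
Proof. by move=> _ Y mY; rewrite setTI. Qed.

Let measurable_id3 : measurable_fun setT id3.
Proof. by move=> _ Y mY; rewrite setTI. Qed.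

Let leb2E A : measurable A -> leb2 R A = (L \x L) A.
Proof.
move=> mA; have := @integral_leb R setT (leb R \o xsection A) measurableT.
by apply => // ; exact: measurable_fun_xsection.
Qed.

Let integral_leb2 (D : set (R * R)) (f : R * R -> \bar R) :
  measurable D -> measurable_fun D f -> (forall x, 0 <= f x) ->
  \int[leb2 R]_(x in D) f x = \int[L \x L]_(x in D) f x.
Proof.
move=> mD mf f0; rewrite -[RHS](ge0_integral_pushforward measurable_id2)//.
by apply: eq_measure_integral => A mA _; exact: leb2E.
Qed.

Let leb3E A : measurable A -> leb3 R A = ((L \x L) \x L) A.
Proof.
move=> mA; have := @integral_leb2 setT (leb R \o xsection A) measurableT.
by apply => //; exact: measurable_fun_xsection.
Qed.

(** Passes from the product measure in [density] to [leb3], for which the Fubini arguments are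
    made. *)
Lemma integral_leb3 (D : set (R3 R)) (f : R3 R -> \bar R) :
  measurable D -> measurable_fun D f -> (forall x, 0 <= f x) ->
  \int[(L \x L) \x L]_(x in D) f x = \int[leb3 R]_(x in D) f x.
Proof.
move=> mD mf f0; rewrite -[LHS](ge0_integral_pushforward measurable_id3)//.
by apply: eq_measure_integral => A mA _; apply/esym; exact: leb3E.
Qed.

End lebesgue_integral_R3.

(** * Densities of compact support and the decomposition of V *)

Section compact_density.
Context (R : realType).
Local Open Scope ereal_scope.

Definition pos_fun (u : R3 R -> R) (x : R3 R) : R := Num.max (u x) 0%R.

Lemma pos_fun_ge0 u x : (0 <= pos_fun u x)%R.
Proof. by rewrite /pos_fun le_max lexx orbT. Qed.

(* The properties of a density that [dpot_shift] needs. *)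
Definition compact_density (L C : R) (m : set (R3 R) -> \bar R) := exists f : R3 R -> R,
  [/\ measurable_fun setT f, forall x, (0 <= f x <= C)%R,
      forall x, ~ cube 0%R L x -> f x = 0%R,
      forall w, (0 < w)%R -> exists2 h, (0 < h)%R &
        forall (z' : R * R) s t, (`|s - t| <= h)%R -> (`|f (z', s) - f (z', t)| <= w)%R
    & forall h : R3 R -> \bar R, measurable_fun setT h -> (forall x, 0 <= h x) ->
        \int[m]_x h x = \int[leb3 R]_x (h x * (f x)%:E)].

Section positive_part.
Variables (u : R3 R -> R) (L C : R).
Hypotheses (cu : continuous u) (usupp : forall x, ~ cube 0%R L x -> u x = 0%R).
Hypotheses (C0 : (0 < C)%R) (uC : forall x, (`|u x| <= C)%R).

Lemma measurable_pos_fun : measurable_fun setT (pos_fun u).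
Proof. by apply: measurable_maxr => //; exact: continuous_measurable_R3. Qed.

Definition pos_density : {measure set (R3 R) -> \bar R} :=
  density_measure (leb3 R) (pos_fun_ge0 u) measurable_pos_fun.

Lemma pos_densityE A : pos_density A = \int[leb3 R]_(x in A) (pos_fun u x)%:E.
Proof. by []. Qed.

Lemma pos_density_compact : compact_density L C pos_density.
Proof.
exists (pos_fun u); split.
- exact: measurable_pos_fun.
- move=> x; rewrite pos_fun_ge0/= /pos_fun ge_max (le_trans (ler_norm _) (uC x))/=.
  exact: ltW.
- by move=> x /usupp ux; rewrite /pos_fun ux maxxx.
- move=> w /(compact_support_uniform cu usupp)[h h0 hP]; exists h => // z' s t st.
  apply: le_trans (hP z' s t st); rewrite /pos_fun.
  move: (u (z', s)) (u (z', t)) => a b.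
  have h1 := ler_norm (a - b); have := ler_norm (b - a); rewrite (distrC b) => h2.
  by rewrite ler_norml; case: (lerP a 0%R) => ?; case: (lerP b 0%R) => ?; apply/andP; split; lra.
- by move=> h mh h0; rewrite integral_density.
Qed.

Lemma pos_density_finite A : measurable A -> pos_density A < +oo.
Proof.
move=> mA; rewrite pos_densityE.
apply: (@le_lt_trans _ _ (\int[leb3 R]_(x in cube 0%R L) (cst C%:E) x)).
  rewrite integral_mkcond [leRHS]integral_mkcond; apply: ge0_le_integral => //.
  - by move=> x _; rewrite /patch; case: ifP => // _; rewrite lee_fin pos_fun_ge0.
  - apply: (measurable_restrictT _ mA).1; apply/measurable_EFinP/measurable_funTS.
    exact: measurable_pos_fun.
  - by apply: (measurable_restrictT _ (measurable_box _ _)).1.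
  - move=> x _; rewrite /patch; case: ifPn => _; case: ifPn => [_|/negP xQ] //.
    + by rewrite lee_fin /pos_fun ge_max (le_trans (ler_norm _) (uC x))/= ltW.
    + by rewrite /pos_fun usupp ?maxxx//; apply: contra_not xQ => ?; rewrite inE.
    + by rewrite lee_fin ltW.
rewrite integral_cst; last exact: measurable_box.
have [L0|L0] := leP 0%R L.
  suff : C%:E * (8 * L ^+ 3)%:E < +oo by rewrite -(leb3_cube 0%R L0).
  by rewrite -EFinM ltry.
rewrite (_ : cube _ _ = set0) ?measure0 ?mule0//.
apply/seteqP; split=> // x [[/= + _] _]; rewrite in_itv/= => /andP[]; lra.
Qed.

End positive_part.

Section signed_density.
Variables (u v : R3 R -> R) (L : R).
Hypotheses (cu : continuous u) (usupp : forall x, ~ cube 0%R L x -> u x = 0%R).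
(** The opposite of u is a function of its own, so that the lemmas also apply with u and v
    exchanged. *)
Hypotheses (cv : continuous v) (vE : forall x, v x = (- u x)%R).

Lemma signed_density_represents (B : set (set (R3 R))) : B `<=` measurable ->
  represents B (fun A => fine (\int[(@lebesgue_measure R \x @lebesgue_measure R)
      \x @lebesgue_measure R]_(x in A) (u x)%:E))
    (pos_density cu) (pos_density cv).
Proof.
move=> Bm A /Bm mA; have [C C0 uC] := compact_support_bounded cu usupp.
have vC x : (`|v x| <= C)%R by rewrite vE normrN.
have vsupp x : ~ cube 0%R L x -> v x = 0%R by move=> /usupp; rewrite vE => ->; rewrite oppr0.
have f1 := pos_density_finite cu usupp C0 uC mA.
have f2 := pos_density_finite cv vsupp C0 vC mA.
split=> //; rewrite integralE.
have m1 := measurable_pos_fun cu; have m2 := measurable_pos_fun cv.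
rewrite (_ : (fun x : R3 R => (u x)%:E)^\+ = fun x => (pos_fun u x)%:E); last first.
  by apply/funext => x; rewrite funeposE EFin_max.
rewrite (_ : (fun x : R3 R => (u x)%:E)^\- = fun x => (pos_fun v x)%:E); last first.
  by apply/funext => x; rewrite funenegE /pos_fun vE EFin_max.
rewrite !integral_leb3//; last 4 first.
- exact/measurable_EFinP/measurable_funTS.
- by move=> x; rewrite lee_fin pos_fun_ge0.
- exact/measurable_EFinP/measurable_funTS.
- by move=> x; rewrite lee_fin pos_fun_ge0.
by rewrite fineB// ge0_fin_numE//; apply: integral_ge0 => x _; rewrite lee_fin pos_fun_ge0.
Qed.

(** The set where u > 0 is a Hahn set: on its intersection E with A the negative density vanishes,
    and E carries the whole positive mass of A. The intersection with the cube makes E bounded,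
    hence a competitor in the supremum. *)
Lemma pos_density_le_pos_part (nu : set (R3 R) -> R) A : measurable A ->
  represents (@bounded_measurable R) nu (pos_density cu) (pos_density cv) ->
  pos_density cu A <= pos_part (@bounded_measurable R) nu A.
Proof.
move=> mA rep; pose P := [set x | (0 < u x)%R].
have mP : measurable P.
  rewrite (_ : P = u @^-1` [set` `]0%R, +oo[]).
    by rewrite -[X in measurable X]setTI; apply: continuous_measurable_R3 => //; exact: measurable_itv.
  by apply/seteqP; split=> x /=; rewrite in_itv/= andbT.
pose E := A `&` (P `&` cube 0%R L).
have mE : measurable E.
  by apply: measurableI => //; apply: measurableI => //; exact: measurable_box.
have BE : bounded_measurable E.
  split=> //; exists (2 * L)%R => x [_ [_ [[/= + +] +]]].
  rewrite !in_itv/= !sub0r !add0r => /andP[a1 a2] /andP[b1 b2] /andP[c1 c2].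
  rewrite /ecball/= /enorm -[leRHS]ger0_norm; last by lra.
  by rewrite -sqrtr_sqr ler_wsqrtr//; nra.
have [fE _ nuE] := rep E BE.
have E2 : pos_density cv E = 0.
  rewrite pos_densityE; apply: integral0_eq => x [_ [/= ux _]].
  by rewrite /pos_fun vE; congr EFin; apply/max_idPr; rewrite oppr_le0 ltW.
have -> : pos_density cu A = pos_density cu E.
  rewrite !pos_densityE [LHS]integral_mkcond [RHS]integral_mkcond.
  apply: eq_integral => x _; rewrite /patch.
  have [xA|xA] := boolP (x \in A); last first.
    by case: ifPn => // /set_mem[/mem_set]; rewrite (negbTE xA).
  case: ifPn => // xE; congr EFin; apply/max_idPr; rewrite leNgt; apply/negP => ux.
  move/negP : xE; apply; rewrite inE; split; first exact: set_mem.
  by split=> //; apply: contrapT => /usupp u0; move: ux; rewrite u0 ltxx.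
rewrite -[leLHS]fineK; last by rewrite ge0_fin_numE.
have -> : fine (pos_density cu E) = nu E by rewrite nuE E2 subr0.
by apply: pos_part_ub => // x [].
Qed.

End signed_density.

Section decomposition.
Variables (u : R3 R -> R) (L C K eta : R) (nuV nuW : set (R3 R) -> R).
Hypotheses (cu : continuous u) (usupp : forall x, ~ cube 0%R L x -> u x = 0%R).
Hypotheses (C0 : (0 < C)%R) (uC : forall x, (`|u x| <= C)%R).
Let B := @bounded_measurable R.
Let nuD (A : set (R3 R)) : R := fine (\int[(@lebesgue_measure R \x @lebesgue_measure R)
  \x @lebesgue_measure R]_(x in A) (u x)%:E).
Hypothesis nuWE : forall A, nuW A = (nuV A - nuD A)%R.
Hypothesis anuV : base_additive B nuV.
Hypothesis nuVK : newton_bounded (pos_part B nuV) K%:E.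
Hypothesis nuVNK : newton_bounded (pos_part B (fun A => - nuV A)%R) K%:E.
Hypothesis nuWeta : newton_bounded (pos_part B nuW) eta%:E.
Hypothesis nuWNeta : newton_bounded (pos_part B (fun A => - nuW A)%R) eta%:E.

(** L and C depend on the test function, the bounds on the potentials only on K and eta; the mixed
    terms of [dpot] involve only the latter. *)
Definition near_compact_density (m : {sigma_finite_measure set (R3 R) -> \bar R}) :=
  exists a b : {sigma_finite_measure set (R3 R) -> \bar R},
  [/\ compact_density L C a, forall E, measurable E -> m E = a E + b E,
      newton_bounded a (K + eta)%:E, newton_bounded b eta%:E
    & newton_bounded m (K + eta + eta)%:E].

Let near_compact_density_add (a b : {measure set (R3 R) -> \bar R}) :
  compact_density L C a -> newton_bounded a (K + eta)%:E -> newton_bounded b eta%:E ->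
  exists2 m : {sigma_finite_measure set (R3 R) -> \bar R}, near_compact_density m &
    forall E, m E = a E + b E.
Proof.
move=> ad ak bk; have mk := newton_bounded_add ak bk; rewrite -EFinD in mk.
have [a' a'E] := newton_bounded_sigma_finite ak.
have [b' b'E] := newton_bounded_sigma_finite bk.
have [m' m'E] := newton_bounded_sigma_finite mk.
have mE E : m' E = a E + b E by rewrite m'E; exact: measure_addE.
by exists m' => //; exists a', b'; split; rewrite ?a'E ?b'E ?m'E// => E _; rewrite -m'E.
Qed.

Let pos_part_split (nu nu1 nu2 : set (R3 R) -> R) A :
  (forall A, nu A = (nu1 A + nu2 A)%R) ->
  pos_part B nu A <= pos_part B nu1 A + pos_part B nu2 A.
Proof.
move=> nuE; apply: ge_ereal_sup => _ [E [BE EA] <-]; rewrite nuE EFinD.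
by apply: leeD; exact: pos_part_ub.
Qed.

(** With W the remainder, m1 is [u^+ + W^+] and m2 is [u^- + W^-]. As the density is V - W,
    [u^+ <= V^+ + W^-], whence the bound K + eta on the potential of [u^+]; the negative parts are
    symmetric. *)
Lemma near_compact_density_decomposition :
  exists m1 m2 : {sigma_finite_measure set (R3 R) -> \bar R},
    [/\ represents B nuV m1 m2, near_compact_density m1 & near_compact_density m2].
Proof.
have bB := set_base_bounded R.
have cv : continuous (fun x => - u x)%R by move=> x; apply: continuousN; exact: cu.
have vsupp x : ~ cube 0%R L x -> (- u x)%R = 0%R by move=> /usupp ->; rewrite oppr0.
have vC x : (`|- u x| <= C)%R by rewrite normrN.
have repD : represents B nuD (pos_density cu) (pos_density cv).
  exact: signed_density_represents usupp _ _ _ (base_measurable bB).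
have anuD := represents_additive bB repD.
have anuW : base_additive B nuW.
  move=> E F BE mF tF EF; under eq_fun do under eq_bigr do rewrite nuWE.
  under eq_fun do rewrite sumrB.
  by rewrite nuWE; apply: cvgB; [exact: anuV|exact: anuD].
pose b1 := pos_part_measure bB anuW; pose b2 := pos_part_measure bB (base_additiveN anuW).
have repW : represents B nuW b1 b2.
  by apply: jordan_represents => //; exact: (newton_bounded_finite (m := b1) nuWeta).
pose p1 := pos_part_measure bB anuV; pose p2 := pos_part_measure bB (base_additiveN anuV).
have a1K : newton_bounded (pos_density cu) (K + eta)%:E.
  rewrite EFinD.
  apply: newton_bounded_le (newton_bounded_add (m := p1) (m' := b2) nuVK nuWNeta) => //.
  move=> A mA; rewrite measure_ge0 measure_addE/=.
  apply: (le_trans (pos_density_le_pos_part usupp _ mA repD)) => //.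
  by apply: pos_part_split => A'; rewrite nuWE; ring.
have a2K : newton_bounded (pos_density cv) (K + eta)%:E.
  rewrite EFinD.
  apply: newton_bounded_le (newton_bounded_add (m := p2) (m' := b1) nuVNK nuWeta) => //.
  move=> A mA; rewrite measure_ge0 measure_addE/=.
  apply: (le_trans (pos_density_le_pos_part vsupp _ mA (representsN repD))).
    by move=> x; rewrite opprK.
  by apply: pos_part_split => A'; rewrite nuWE; ring.
have [m1 nm1 m1E] := near_compact_density_add (pos_density_compact cu usupp C0 uC) a1K
  (nuWeta : newton_bounded b1 _).
have [m2 nm2 m2E] := near_compact_density_add (pos_density_compact cv vsupp C0 vC) a2K
  (nuWNeta : newton_bounded b2 _).
exists m1, m2; split=> // E BE; rewrite m1E m2E.
have [d1 d2 dE] := repD E BE; have [w1 w2 wE] := repW E BE.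
have fin (m : {measure set (R3 R) -> \bar R}) : m E < +oo -> m E \is a fin_num.
  by move=> ?; rewrite ge0_fin_numE.
split; [by rewrite lte_add_pinfty|by rewrite lte_add_pinfty|].
rewrite (fineD (fin _ d1) (fin _ w1)) (fineD (fin _ d2) (fin _ w2)).
have -> : nuV E = (nuD E + nuW E)%R by rewrite nuWE; ring.
by rewrite opprD addrACA wE dE.
Qed.

End decomposition.

End compact_density.

(** * Translation of the double potentials *)

Section translated_double_potential.
Context (R : realType).
Variables (L C K eta : R).
Hypotheses (L0 : 0 < L) (C0 : 0 < C) (eta0 : 0 <= eta) (eta1 : eta <= 1).
Implicit Types (m : {sigma_finite_measure set (R3 R) -> \bar R}).

Let near := @near_compact_density R L C K eta.

(** With m = a + b and m' = a' + b', only the term (a, a') is compared with its translate. The terms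
    (a, b') and (b, m') are bounded by their total masses, with sum [eta * (2 * K + 3 * eta)], and
    dropped on the right. *)
Lemma dpot_near_shift m m' (s : R) : near m -> near m' -> 0 < s ->
  exists2 e0 : R, 0 < e0 & forall y A e, measurable A -> 0 <= e <= e0 ->
    (dpot m m' y (shift_set e A) <= dpot m m' y A + (s + eta * (2 * K + 3))%:E)%E.
Proof.
move=> [a [b [ad mab ak bk mk]]] [a' [b' [ad' mab' ak' bk' mk']]] s0.
have [f [mf f0 fs fu fE]] := ad; have [g [mg g0 gs gu gE]] := ad'.
have [e0 e00 He] := dpot_shift L0 C0 mf mg f0 g0 fs gs fu fE gE s0.
exists e0 => // y A e mA ee; have mAe := measurable_shift_set e mA.
have split B : measurable B -> (dpot m m' y B =
    dpot a a' y B + (dpot a b' y B + dpot b m' y B))%E.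
  by move=> mB; rewrite (dpot_suml _ mab)// (dpot_sumr a mab')// -[LHS]addeA.
rewrite !split//.
apply: (@le_trans _ _ (dpot a a' y A + s%:E + (eta * (2 * K + 3))%:E)%E).
  apply: leeD; first exact: He.
  apply: le_trans (leeD (dpot_le mAe (ak y) bk') (dpot_le mAe (bk y) mk')) _.
  rewrite -EFinD lee_fin; have -> : (K + eta) * eta + eta * (K + eta + eta) =
    eta * (2 * K + 3 * eta) by ring.
  by apply: ler_wpM2l; rewrite // lerD2l ler_piMr.
rewrite -addeA -EFinD; apply: leeD => //.
by rewrite leeDl// adde_ge0// dpot_ge0.
Qed.

Lemma shift_setK (e : R) (A : set (R3 R * R)) : shift_set (- e) (shift_set e A) = A.
Proof. by apply/seteqP; split=> -[x t]; rewrite /shift_set/= opprK addrK. Qed.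

Let complement_bound (p p' q q' c t : R) : p + p' = c -> q + q' = c ->
  q <= p + t -> q' <= p' + t -> `|q - p| <= t.
Proof. by move=> ? ? ? ?; rewrite ler_norml; apply/andP; split; lra. Qed.

(* Rewriting with distrC in the next proof would unfold dpot. *)
Let distance_bound_sym (p q t : R) : `|p - q| <= t -> `|q - p| <= t.
Proof. by rewrite distrC. Qed.

(* The lower bound is the upper bound for the complement of A. *)
Lemma dpot_near_translation m m' (s : R) : near m -> near m' -> 0 < s ->
  \forall e \near (0 : R), forall y A, measurable A ->
    `|fine (dpot m m' y (shift_set e A)) - fine (dpot m m' y A)| <= s + eta * (2 * K + 3).
Proof.
move=> nm nm' s0; have [e0 e00 He] := dpot_near_shift nm nm' s0.
set t := s + _ in He *.
have fin y A : measurable A -> dpot m m' y A \is a fin_num.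
  move: nm nm' => [_ [_ [_ _ _ _ mk]]] [_ [_ [_ _ _ _ mk']]] mA.
  exact: (dpot_fin mA (mk y) mk').
have up y A e : measurable A -> 0 <= e <= e0 ->
    fine (dpot m m' y (shift_set e A)) <= fine (dpot m m' y A) + t.
  move=> mA ee; have mAe := measurable_shift_set e mA.
  by have := He y A e mA ee; rewrite -(fineK (fin y _ mAe)) -(fineK (fin y _ mA)) -EFinD lee_fin.
have compl y A : measurable A ->
    fine (dpot m m' y A) + fine (dpot m m' y (~` A)) = fine (dpot m m' y setT).
  move=> mA; have mC : measurable (~` A) by exact: measurableC.
  by rewrite -(fineD (fin _ _ mA) (fin _ _ mC)) -(dpotU _ _ _ mA mC (setICr A)) setUv.
have two y A e : measurable A -> 0 <= e <= e0 ->
    `|fine (dpot m m' y (shift_set e A)) - fine (dpot m m' y A)| <= t.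
  move=> mA ee; have mC : measurable (~` A) by exact: measurableC.
  have mAe := measurable_shift_set e mA.
  exact: (@complement_bound _ _ _ _ _ _ (compl y A mA) (compl y _ mAe)
    (up y A e mA ee) (up y (~` A) e mC ee)).
near=> e => y A mA.
have ee : `|e| <= e0.
  by near: e; apply/nbhs_ballP; exists e0 => //= e; rewrite /ball/= sub0r normrN => /ltW.
have [e_ge0|e_lt0] := leP 0 e; first by apply: two; rewrite // -{2}(ger0_norm e_ge0) e_ge0.
(* For negative e, the positive translation by -e takes the translated set back to A. *)
have := two y _ (- e) (measurable_shift_set e mA).
move: (shift_setK e A); move: (shift_set (- e) _) => B ->.
move=> h; apply: distance_bound_sym; apply: h.
by rewrite oppr_ge0 ltW//= -(ltr0_norm e_lt0).
Unshelve. all: end_near. Qed.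

End translated_double_potential.

Section kernel_norm.
Context (R : realType).
Implicit Types (F : kernel3 R).

Lemma kernel_norm_ge0 F : (0 <= kernel_norm F)%E.
Proof.
apply: (@le_trans _ _ (measure_variation measurable (F 0) setT)).
  apply: ereal_sup_ubound; exists 0%N, (fun=> set0); split=> [[]//|[]//|[]//|].
  by rewrite big_ord0.
by apply: ereal_sup_ubound; exists 0.
Qed.

Lemma kernel_norm_le F (s : R) :
  (forall y A B, measurable A -> measurable B -> A `&` B = set0 ->
    F y (A `|` B) = F y A + F y B) ->
  (forall y A, measurable A -> `|complex.Re (F y A)| <= s) ->
  (forall y A, measurable A -> `|complex.Im (F y A)| <= s) ->
  (kernel_norm F <= (4 * s)%:E)%E.
Proof.
move=> FU FR FI; apply: ge_ereal_sup => _ [y _ <-].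
by apply: variation_le; [exact: FU|exact: FR|exact: FI].
Qed.

Lemma cvge0_nonneg (T : Type) (F : set_system T) (FF : Filter F) (f : T -> \bar R) :
  (forall x, (0 <= f x)%E) -> (forall s : R, 0 < s -> \forall x \near F, (f x <= s%:E)%E) ->
  f @ F --> 0%E.
Proof.
move=> f0 fs; apply/fine_cvgP; split.
  by apply: filterS (fs 1 ltr01) => x fx; rewrite ge0_fin_numE// (le_lt_trans fx)// ltry.
apply/cvgrPdist_le => s s0; apply: filterS (fs s s0) => x fx.
rewrite sub0r normrN ger0_norm ?fine_ge0// -lee_fin fineK//.
by rewrite ge0_fin_numE// (le_lt_trans fx)// ltry.
Qed.

End kernel_norm.

(** * The two limits *)

Section decay.
Context (R : realType) (V : set (R3 R) -> R[i]).
Hypothesis V_kato : kato V.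
Let B := @bounded_measurable R.
Let K := fine (kato_norm V).

Lemma kato_norm_ge0 : (0 <= kato_norm V)%E.
Proof.
apply: le_trans (pos_part_newton_bounded (nu := fun A => complex.Re (V A))
  (fun A => normc_ge_Re (V A)) (locally_bounded_variation0 V_kato.1) 0).
apply: (@integral_ge0 _ _ _ (pos_part_measure (set_base_bounded R)
  (locally_bounded_variation_Re V_kato.1))) => x _.
by rewrite lee_fin newton_ge0.
Qed.

Lemma kato_norm_fineK : (fine (kato_norm V))%:E = kato_norm V.
Proof. by rewrite fineK// ge0_fin_numE ?kato_norm_ge0// V_kato.2. Qed.

Let jordan_sigma_finite (nu : set (R3 R) -> R) : base_additive B nu ->
  newton_bounded (pos_part B nu) K%:E ->
  newton_bounded (pos_part B (fun A => - nu A)) K%:E ->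
  exists p n : {sigma_finite_measure set (R3 R) -> \bar R}, [/\ represents B nu p n,
    p = pos_part B nu :> (set (R3 R) -> \bar R)
    & n = pos_part B (fun A => - nu A) :> (set (R3 R) -> \bar R)].
Proof.
move=> anu pK nK; have bB := set_base_bounded R.
have [p pE] := @newton_bounded_sigma_finite _ (pos_part_measure bB anu) _ pK.
have [n nE] := @newton_bounded_sigma_finite _ (pos_part_measure bB (base_additiveN anu)) _ nK.
exists p, n; split=> //; rewrite pE nE.
by apply: jordan_represents => //; exact: (newton_bounded_finite (m := pos_part_measure bB anu) pK).
Qed.

Let tail (r : R) : \bar R := ereal_sup (range (fun y : R3 R =>
  \int[measure_variation B V]_(x in [set x | (r < enorm (x - y))%R])
    ((enorm (x - y)%R)%:E)^-1)%E).

(** The radius r - 1 reconciles the closed condition r <= rho of the restriction with the strict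
    inequality in the distal condition. *)
Let kernel_measure_tail (m : {sigma_finite_measure set (R3 R) -> \bar R})
    (nu : set (R3 R) -> R) y A (r : R) :
  (forall A, `|nu A| <= ComplexField.Normc.normc (V A)) ->
  m = pos_part B nu :> (set (R3 R) -> \bar R) -> measurable A ->
  (kernel_measure m y (A `&` [set p | (r <= p.2)%R]) <= tail (r - 1))%E.
Proof.
move=> nuV mE mA; rewrite kernel_measureE; last first.
  apply: measurableI => //; rewrite (_ : [set p | _] = snd @^-1` [set` `[r, +oo[]); last first.
    by apply/seteqP; split=> p /=; rewrite in_itv/= andbT.
  by rewrite -[X in measurable X]setTI; apply: measurable_snd => //; exact: measurable_itv.
rewrite mE; apply: (@le_trans _ _ (\int[measure_variation B V]_(x in
    [set x | (r - 1 < enorm (x - y))%R]) ((enorm (x - y)%R)%:E)^-1)%E).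
  apply: pos_part_newton_le_variation => //.
    exact: (locally_bounded_variation0 V_kato.1).
  move=> x [_ /=]; lra.
by apply: ereal_sup_ubound; exists y.
Qed.

Let addC_sub (a b c d a' b' c' d' : R) :
  (((a + a') - (b + b')) +i* ((c + c') - (d + d')) =
   ((a - b) +i* (c - d)) + ((a' - b') +i* (c' - d')))%C.
Proof. by congr (_ +i* _)%C; ring. Qed.

Let dist_bound (a b s : R) : 0 <= a <= s -> 0 <= b <= s -> `|a - b| <= s.
Proof. by move=> ? ?; rewrite ler_norml; lra. Qed.

Lemma kernel_restrict_decay : distal_kato V ->
  kernel_norm (kernel_restrict r (S_kernel V)) @[r --> +oo] --> 0%E.
Proof.
move=> dV; have V0 := locally_bounded_variation0 V_kato.1.
have bound nu : (forall A, `|nu A| <= ComplexField.Normc.normc (V A)) ->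
    newton_bounded (pos_part B nu) K%:E.
  by move=> nuV; rewrite kato_norm_fineK; exact: pos_part_newton_bounded.
have re A : `|complex.Re (V A)| <= ComplexField.Normc.normc (V A) by exact: normc_ge_Re.
have im A : `|complex.Im (V A)| <= ComplexField.Normc.normc (V A) by exact: normc_ge_Im.
have reN A : `|- complex.Re (V A)| <= ComplexField.Normc.normc (V A) by exact: normcN_ge_Re.
have imN A : `|- complex.Im (V A)| <= ComplexField.Normc.normc (V A) by exact: normcN_ge_Im.
have [m1 [m2 [rR m1E m2E]]] := jordan_sigma_finite
  (locally_bounded_variation_Re V_kato.1) (bound _ re) (bound _ reN).
have [m3 [m4 [rI m3E m4E]]] := jordan_sigma_finite
  (locally_bounded_variation_Im V_kato.1) (bound _ im) (bound _ imN).
have b1 : newton_bounded m1 K%:E by rewrite m1E; exact: bound.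
have b2 : newton_bounded m2 K%:E by rewrite m2E; exact: bound.
have b3 : newton_bounded m3 K%:E by rewrite m3E; exact: bound.
have b4 : newton_bounded m4 K%:E by rewrite m4E; exact: bound.
have SE := S_kernelE rR rI b1 b2 b3 b4.
have mP (r : R) A : measurable A -> measurable (A `&` [set p : R3 R * R | (r <= p.2)%R]).
  move=> mA; apply: measurableI => //.
  rewrite (_ : [set p | _] = snd @^-1` [set` `[r, +oo[]).
    by rewrite -[X in measurable X]setTI; apply: measurable_snd => //; exact: measurable_itv.
  by apply/seteqP; split=> p /=; rewrite in_itv/= andbT.
have kmU (m : {sigma_finite_measure set (R3 R) -> \bar R}) y E F : newton_bounded m K%:E ->
    measurable E -> measurable F -> E `&` F = set0 ->
    fine (kernel_measure m y (E `|` F)) = fine (kernel_measure m y E) + fine (kernel_measure m y F).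
  move=> mK mE mF EF.
  have fin G : measurable G -> kernel_measure m y G \is a fin_num.
    move=> mG; rewrite ge0_fin_numE//.
    by apply: (le_lt_trans (kernel_measure_le mG (mK y))); rewrite ltry.
  by rewrite measureU// fineD// fin.
apply: cvge0_nonneg => [r|s s0]; first exact: kernel_norm_ge0.
(* The 4 cancels the factor of [kernel_norm_le]. No further loss occurs, since each part is a
   difference of two masses between 0 and s / 4. *)
have s40 : 0 < s / 4 by rewrite divr_gt0.
have [M [_ HM]] : \forall r \near +oo, (tail r <= (s / 4)%:E)%E.
  have /fine_cvgP[tf /cvgrPdist_le/(_ _ s40) tc] := dV.
  near=> r; have rf : tail r \is a fin_num by near: r.
  have : `|0 - fine (tail r)| <= s / 4 by near: r.
  by rewrite sub0r normrN -(fineK rf) lee_fin; apply: le_trans; exact: ler_norm.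
exists (M + 1); split; first exact: num_real.
move=> r Mr; have tr : (tail (r - 1) <= (s / 4)%:E)%E by apply: HM; rewrite ltrBrDr.
rewrite (_ : s = 4 * (s / 4)); last by field.
have small (m : {sigma_finite_measure set (R3 R) -> \bar R}) nu y A : (forall A, `|nu A| <= ComplexField.Normc.normc (V A)) ->
    m = pos_part B nu :> (set (R3 R) -> \bar R) -> measurable A ->
    0 <= fine (kernel_measure m y (A `&` [set p | (r <= p.2)%R])) <= s / 4.
  move=> nuV mE mA; apply/andP; split; first by apply: fine_ge0; exact: measure_ge0.
  have h := le_trans (kernel_measure_tail y r nuV mE mA) tr.
  have f : kernel_measure m y (A `&` [set p | (r <= p.2)%R]) \is a fin_num.
    by rewrite ge0_fin_numE//; exact: le_lt_trans h (ltry _).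
  by rewrite -lee_fin fineK.
apply: kernel_norm_le => y A.
- move=> A' mA mA' AA'; rewrite /kernel_restrict setIUl !SE; try by [apply: mP|apply: measurableU; apply: mP].
  have AA'0 : (A `&` [set p | r <= p.2]) `&` (A' `&` [set p | r <= p.2]) = set0.
    by rewrite setIACA AA' set0I.
  have [mAr mAr'] := (mP r A mA, mP r A' mA').
  rewrite (kmU m1 y _ _ b1 mAr mAr' AA'0) (kmU m2 y _ _ b2 mAr mAr' AA'0).
  rewrite (kmU m3 y _ _ b3 mAr mAr' AA'0) (kmU m4 y _ _ b4 mAr mAr' AA'0).
  exact: addC_sub.
- move=> mA; rewrite /kernel_restrict SE; last exact: mP.
  exact: dist_bound (small m1 _ y A re m1E mA) (small m2 _ y A reN m2E mA).
- move=> mA; rewrite /kernel_restrict SE; last exact: mP.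
  exact: dist_bound (small m3 _ y A im m3E mA) (small m4 _ y A imN m4E mA).
Unshelve. all: end_near. Qed.

End decay.

Section square_combination.
Context (R : realType).
Implicit Types D E : bool * bool -> bool * bool -> R.

(* The product of (x1 - x2) + i (x3 - x4) with itself, with D for the products
   of the xk; these are indexed by imaginary part, then negative part. *)
Definition square_comb D : R[i] :=
  let D' k l := D k l in
  let p := (false, false) in let n := (false, true) in
  let ip := (true, false) in let im := (true, true) in
  ((((D p p - D p n) - (D n p - D n n)) - ((D ip ip - D ip im) - (D im ip - D im im)))
   +i* (((D p ip - D p im) - (D n ip - D n im)) + ((D ip p - D ip n) - (D im p - D im n))))%C.

Lemma square_combD D E :
  square_comb (fun k l => D k l + E k l) = square_comb D + square_comb E.
Proof. by congr (_ +i* _)%C; rewrite /=; ring. Qed.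

Lemma square_combB D E :
  square_comb (fun k l => D k l - E k l) = square_comb D - square_comb E.
Proof. by congr (_ +i* _)%C; rewrite /=; ring. Qed.

Lemma square_comb_bound D (s : R) : (forall k l, `|D k l| <= s) ->
  `|complex.Re (square_comb D)| <= 8 * s /\ `|complex.Im (square_comb D)| <= 8 * s.
Proof.
move=> Ds; have D1 k l : - s <= D k l <= s by rewrite -ler_norml.
split; rewrite /square_comb/= ler_norml.
- have := D1 (false, false) (false, false); have := D1 (false, false) (false, true).
  have := D1 (false, true) (false, false); have := D1 (false, true) (false, true).
  have := D1 (true, false) (true, false); have := D1 (true, false) (true, true).
  have := D1 (true, true) (true, false); have := D1 (true, true) (true, true).
  by do 8 move=> /andP[? ?]; apply/andP; split; lra.
- have := D1 (false, false) (true, false); have := D1 (false, false) (true, true).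
  have := D1 (false, true) (true, false); have := D1 (false, true) (true, true).
  have := D1 (true, false) (false, false); have := D1 (true, false) (false, true).
  have := D1 (true, true) (false, false); have := D1 (true, true) (false, true).
  by do 8 move=> /andP[? ?]; apply/andP; split; lra.
Qed.

End square_combination.

Section translation_of_the_square.
Context (R : realType) (V : set (R3 R) -> R[i]).
Variables (m : bool * bool -> {sigma_finite_measure set (R3 R) -> \bar R}) (K : R).
Let B := @bounded_measurable R.
Hypothesis repR : represents B (fun A => complex.Re (V A)) (m (false, false)) (m (false, true)).
Hypothesis repI : represents B (fun A => complex.Im (V A)) (m (true, false)) (m (true, true)).
Hypothesis mK : forall k, newton_bounded (m k) K%:E.

Let D y A k l : R := fine (dpot (m k) (m l) y A).

Let squareE y A : measurable A -> kernel_pow (S_kernel V) 2 y A = square_comb (D y A).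
Proof. exact: (S_kernel2E repR repI (mK _) (mK _) (mK _) (mK _)). Qed.

Let DU y A A' k l : measurable A -> measurable A' -> A `&` A' = set0 ->
  D y (A `|` A') k l = D y A k l + D y A' k l.
Proof.
move=> mA mA' AA'; have fin E : measurable E -> dpot (m k) (m l) y E \is a fin_num.
  by move=> mE; apply: (dpot_fin mE (mK k y)); exact: mK.
by rewrite /D (dpotU _ _ _ mA mA' AA') (fineD (fin _ mA) (fin _ mA')).
Qed.

Let squareU y A A' : measurable A -> measurable A' -> A `&` A' = set0 ->
  kernel_pow (S_kernel V) 2 y (A `|` A') =
  kernel_pow (S_kernel V) 2 y A + kernel_pow (S_kernel V) 2 y A'.
Proof.
move=> mA mA' AA'; rewrite !squareE//; last exact: measurableU.
rewrite -square_combD; congr square_comb; apply/funext => k; apply/funext => l.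
exact: DU.
Qed.

Lemma kernel_shiftE e (F : kernel3 R) y A : kernel_shift e F y A = F y (shift_set e A).
Proof.
congr (F y _); apply/seteqP; split=> [_ [[x r] Ar <-]|[x r] Ar].
  by rewrite /shift_set/= addrK.
by exists (x, r - e); rewrite //= subrK.
Qed.

(** The 8 counts the double potentials in each of the real and imaginary parts; the 4 is that of
    [kernel_norm_le]. *)
Lemma square_translation_le e (s : R) :
  (forall k l y A, measurable A -> `|D y (shift_set e A) k l - D y A k l| <= s) ->
  (kernel_norm (fun y A => kernel_shift e (kernel_pow (S_kernel V) 2) y A
                           - kernel_pow (S_kernel V) 2 y A)%R <= (4 * (8 * s))%:E)%E.
Proof.
move=> Ds.
have FE y A : measurable A -> kernel_shift e (kernel_pow (S_kernel V) 2) y A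
    - kernel_pow (S_kernel V) 2 y A =
    square_comb (fun k l => D y (shift_set e A) k l - D y A k l).
  move=> mA; rewrite kernel_shiftE (squareE y mA).
  by rewrite (squareE y (measurable_shift_set e mA)) square_combB.
apply: kernel_norm_le => y A.
- move=> A' mA mA' AA'; rewrite !kernel_shiftE.
  have sU : shift_set e (A `|` A') = shift_set e A `|` shift_set e A' by [].
  have sI : shift_set e A `&` shift_set e A' = set0.
    by rewrite -[RHS](_ : shift_set e (A `&` A') = _)// AA'.
  rewrite sU (squareU y mA mA' AA').
  rewrite (squareU y (measurable_shift_set e mA) (measurable_shift_set e mA') sI).
  by rewrite opprD addrACA.
- move=> mA; rewrite FE//.
  by have [] := square_comb_bound (fun k l => Ds k l y A mA).
- move=> mA; rewrite FE//.
  by have [] := square_comb_bound (fun k l => Ds k l y A mA).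
Qed.

End translation_of_the_square.

Section continuity.
Context (R : realType) (V : set (R3 R) -> R[i]).
Hypothesis V_kato : kato V.
Let B := @bounded_measurable R.
Let K := fine (kato_norm V).

Let K0 : 0 <= K. Proof. by rewrite fine_ge0// kato_norm_ge0. Qed.

Let cube_support (u : R3 R -> R) (r : R) x :
  (forall x, ~ ecball r x -> u x = 0) -> ~ cube 0 (`|r| + 1) x -> u x = 0.
Proof.
move=> u0 xr; apply: u0; apply: contra_not xr => xr; apply: in_cube.
rewrite subr0; apply: le_trans xr _.
by rewrite (le_trans (ler_norm _))// lerDl.
Qed.

Lemma kato0_decomposition (eta : R) : kato0 V -> 0 < eta -> exists L C,
  [/\ 0 < L, 0 < C & exists m : bool * bool -> {sigma_finite_measure set (R3 R) -> \bar R},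
    [/\ represents B (fun A => complex.Re (V A)) (m (false, false)) (m (false, true)),
        represents B (fun A => complex.Im (V A)) (m (true, false)) (m (true, true))
      & forall k, near_compact_density L C K eta (m k)]].
Proof.
move=> [_ V0] eta0; have [phi [[sRe sIm [r phir]] Weta]] := V0 eta eta0.
set W := (fun A => V A - density phi A) in Weta.
have [cRe _] := sRe [::]; have [cIm _] := sIm [::].
have suppRe x : ~ cube 0 (`|r| + 1) x -> complex.Re (phi x) = 0.
  by apply: (cube_support (u := fun x => complex.Re (phi x))) => {}x /phir ->.
have suppIm x : ~ cube 0 (`|r| + 1) x -> complex.Im (phi x) = 0.
  by apply: (cube_support (u := fun x => complex.Im (phi x))) => {}x /phir ->.
have [C1 C10 bRe] := compact_support_bounded cRe suppRe.
have [C2 C20 bIm] := compact_support_bounded cIm suppIm.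
(* The sum of the two bounds serves for both parts of phi, so that the four measures share L and
   C. *)
exists (`|r| + 1), (C1 + C2); split; [by rewrite ltr_wpDl|by rewrite addr_gt0|].
have V00 := locally_bounded_variation0 V_kato.1.
have W00 : W set0 = 0 by rewrite /W V00 /density !integral_set0 subrr.
have bV nu : (forall A, `|nu A| <= ComplexField.Normc.normc (V A)) ->
    newton_bounded (pos_part B nu) K%:E.
  by move=> nuV; rewrite kato_norm_fineK//; exact: pos_part_newton_bounded.
have bW nu : (forall A, `|nu A| <= ComplexField.Normc.normc (W A)) ->
    newton_bounded (pos_part B nu) eta%:E.
  by move=> nuW y; apply: le_trans (ltW Weta); exact: pos_part_newton_bounded.
have bReC x : `|complex.Re (phi x)| <= C1 + C2.
  by apply: le_trans (bRe x) _; rewrite lerDl ltW.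
have bImC x : `|complex.Im (phi x)| <= C1 + C2.
  by apply: le_trans (bIm x) _; rewrite lerDr ltW.
have [m1 [m2 [r1 n1 n2]]] := near_compact_density_decomposition
  (nuW := fun A => complex.Re (W A)) cRe suppRe (addr_gt0 C10 C20) bReC
  (fun A => raddfB _ _ _)
  (locally_bounded_variation_Re V_kato.1)
  (bV _ (fun A => normc_ge_Re (V A)))
  (bV _ (fun A => normcN_ge_Re (V A)))
  (bW _ (fun A => normc_ge_Re (W A)))
  (bW _ (fun A => normcN_ge_Re (W A))).
have [m3 [m4 [r2 n3 n4]]] := near_compact_density_decomposition
  (nuW := fun A => complex.Im (W A)) cIm suppIm (addr_gt0 C10 C20) bImC
  (fun A => raddfB _ _ _)
  (locally_bounded_variation_Im V_kato.1)
  (bV _ (fun A => normc_ge_Im (V A)))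
  (bV _ (fun A => normcN_ge_Im (V A)))
  (bW _ (fun A => normc_ge_Im (W A)))
  (bW _ (fun A => normcN_ge_Im (W A))).
exists (fun k => match k with
  | (false, false) => m1 | (false, true) => m2 | (true, false) => m3 | (true, true) => m4 end).
by split=> //; case=> [[] []].
Qed.

Lemma kernel_square_continuous : kato0 V ->
  kernel_norm (fun y A => kernel_shift e (kernel_pow (S_kernel V) 2) y A
                          - kernel_pow (S_kernel V) 2 y A)
    @[e --> 0^'] --> 0%E.
Proof.
move=> V0; apply: cvge0_nonneg => [e|s s0]; first exact: kernel_norm_ge0.
(* The total bound is [4 * (8 * (t + t))]: one t from the translation of the densities, one from
   [eta * (2 * K + 3)], the effect of the remainders. *)
pose t := s / 64; have t0 : 0 < t by rewrite divr_gt0.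
have K3 : 0 < 2 * K + 3 by rewrite ltr_wpDl// mulr_ge0.
pose eta := Num.min 1 (t / (2 * K + 3)).
have eta0 : 0 < eta by rewrite lt_min ltr01 divr_gt0.
have eta1 : eta <= 1 by rewrite ge_min lexx.
have etaK : eta * (2 * K + 3) <= t by rewrite -ler_pdivlMr// ge_min lexx orbT.
have [L [C [L0 C0 [m [rR rI mk]]]]] := kato0_decomposition V0 eta0.
have mK k : newton_bounded (m k) (K + eta + eta)%:E by have [? [? []]] := mk k.
have /filter_forall H : forall p : (bool * bool) * (bool * bool), \forall e \near 0^',
    forall y A, measurable A ->
    `|fine (dpot (m p.1) (m p.2) y (shift_set e A)) - fine (dpot (m p.1) (m p.2) y A)| <=
    t + eta * (2 * K + 3).
  move=> p; apply: nbhs_dnbhs.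
  exact: (dpot_near_translation L0 C0 (ltW eta0) eta1 (mk p.1) (mk p.2) t0).
apply: filterS H => e He; apply: le_trans (square_translation_le rR rI mK (s := t + t) _) _.
  move=> k l y A mA; apply: le_trans (He (k, l) y A mA) _.
  by rewrite lerD2l.
by rewrite lee_fin /t; lra.
Qed.

End continuity.

Theorem proposition1p10 (R : realType) (V : set (R3 R) -> R[i])
    (V_kato : kato V) :
  (distal_kato V ->
     kernel_norm (kernel_restrict r (S_kernel V)) @[r --> +oo] --> 0%E) /\
  (kato0 V ->
     kernel_norm (fun y A => kernel_shift e (kernel_pow (S_kernel V) 2) y A
                             - kernel_pow (S_kernel V) 2 y A)
       @[e --> 0^'] --> 0%E).
Proof.
split; first exact: kernel_restrict_decay.
exact: kernel_square_continuous.
Qed.
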